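(* Let $q\in H^{-1}_{per}(\mathbb{R},\mathbb{R})$ with $\widehat{q}(0)=0$. Then the operator $S(q)$ on $L_2(\mathbb{R})$ has continuous spectrum (its point spectrum is empty) with a band and gap structure: there are real numbers $$-\infty<\lambda_0(q)<\lambda_1^-(q)\le\lambda_1^+(q)<\lambda_2^-(q)\le\lambda_2^+(q)<\dots$$ such that $\sigma(S(q))=[\lambda_0(q),\lambda_1^-(q)]\cup\bigcup_{k\ge1}[\lambda_k^+(q),\lambda_{k+1}^-(q)]$, the spectral gaps being $(-\infty,\lambda_0(q))$ and $(\lambda_k^-(q),\lambda_k^+(q))$, $k\in\mathbb{N}$. Moreover, the gap endpoints with even index ($\lambda_0(q)$ and $\lambda_{2k}^\pm(q)$, $k\in\mathbb{N}$) are eigenvalues of the periodic problem $S_+(q)$ on $[0,1]$, and the gap endpoints with odd index ($\lambda_{2k-1}^\pm(q)$, $k\in\mathbb{N}$) are eigenvalues of the semiperiodic problem $S_-(q)$ on $[0,1]$.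
   Context: $H^{-1}_{per}(\mathbb{R},\mathbb{R})$: real-valued $1$-periodic distributions $q=\sum_{k\in 2\mathbb{Z}}\widehat{q}(k)e^{ik\pi x}$ with $\sum_{k}(1+|k|)^{-2}|\widehat{q}(k)|^2<\infty$, $\widehat{q}(k)=\overline{\widehat{q}(-k)}$. With $\widehat{q}(0)=0$ let $Q(x)=\sum_{k\ne0}\frac{\widehat{q}(k)}{ik\pi}e^{ik\pi x}$ (real, $1$-periodic, $Q'=q$). $S(q)$ is the self-adjoint operator on $L_2(\mathbb{R})$, $S(q)u=l_Q[u]:=-(u'-Qu)'-Q(u'-Qu)-Q^2u$ on $\{u\in L_2(\mathbb{R}): u,\,u'-Qu\in W^1_{1,loc}(\mathbb{R}),\,l_Q[u]\in L_2(\mathbb{R})\}$ (it equals the form-sum operator $-d^2/dx^2\dotplus q$). $S_\pm(q)$ are the self-adjoint lower semibounded form-sum operators $\left(-\frac{d^2}{dx^2}\right)_\pm\dotplus q$ on $L_2(0,1)$, i.e. the operators associated with the closed lower semibounded forms $t_\pm[u,v]=\int_0^1\big(u'\overline{v'}-Qu\overline{v'}-Qu'\overline{v}\big)\,dx$ on $\{u\in H^1[0,1]: u(1)=\pm u(0)\}$ (periodic for $+$, semiperiodic for $-$); for smooth $q$ these are $-u''+qu$ with $u^{(j)}(0)=\pm u^{(j)}(1)$, $j=0,1$. *)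

(* Defs.v *)
(* mathcomp-analysis over an abstract R : realType,
   complex numbers C := R[i] from mathcomp-real-closed. *)
From HB Require Import structures.
From mathcomp Require Import all_boot all_order all_algebra.
From mathcomp Require Import all_classical all_reals all_analysis.
From mathcomp Require Export complex.
Set Implicit Arguments. Unset Strict Implicit. Unset Printing Implicit Defensive.
Import Order.TTheory GRing.Theory Num.Theory.
Local Open Scope classical_set_scope.
Local Open Scope ring_scope.
Local Open Scope complex_scope.

(** Lebesgue measure on R *)
Definition leb (R : realType) := (@lebesgue_measure R).
Arguments leb R : clear implicits.

(** real and imaginary parts as real numbers *)
Definition reC (R : realType) (z : R[i]) : R := complex.Re z.
Definition imC (R : realType) (z : R[i]) : R := complex.Im z.

(** |z|^2 as a real number *)
Definition csq (R : realType) (z : R[i]) : R := (reC z) ^+ 2 + (imC z) ^+ 2.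

(** e^{i t} *)
Definition expi (R : realType) (t : R) : R[i] := (cos t) +i* (sin t).

(** complex-valued functions: measurability, integrability, integral *)
Definition cmeasurable (R : realType) (D : set R) (f : R -> R[i]) :=
  measurable_fun D (fun x => reC (f x)) /\ measurable_fun D (fun x => imC (f x)).

Definition cintegrable (R : realType) (D : set R) (f : R -> R[i]) :=
  (leb R).-integrable D (fun x => (reC (f x))%:E) /\
  (leb R).-integrable D (fun x => (imC (f x))%:E).

Definition cint (R : realType) (D : set R) (f : R -> R[i]) : R[i] :=
  (Rintegral (leb R) D (fun x => reC (f x))) +i* (Rintegral (leb R) D (fun x => imC (f x))).

(** f is in L_2(D) *)
Definition cL2 (R : realType) (D : set R) (f : R -> R[i]) :=
  cmeasurable D f /\ (leb R).-integrable D (fun x => (csq (f x))%:E).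

(** L_2(R) norm *)
Definition L2norm (R : realType) (f : R -> R[i]) : R :=
  Num.sqrt (Rintegral (leb R) setT (fun x => csq (f x))).

(** W^1_{1,loc}(R): u is absolutely continuous on compacts with
    (locally integrable) derivative g, i.e. u(y)-u(x) = int_x^y g. *)
Definition W11loc_with_deriv (R : realType) (u g : R -> R[i]) :=
  (forall a b : R, cintegrable `[a, b] g) /\
  (forall x y : R, x <= y -> u y - u x = cint `[x, y] g).

(** Graph of the operator S(q) = l_Q on L_2(R):
    u in Dom(S(q)) and S(q) u = f (equality in L_2, i.e. a.e.).
    Here u' = u1 + Q u, i.e. u1 = u' - Q u is the quasi-derivative,
    and w = (u' - Q u)'. *)
Definition S_graph (R : realType) (Q : R -> R) (u f : R -> R[i]) :=
  cL2 setT u /\ cL2 setT f /\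
  exists u1 w : R -> R[i],
    W11loc_with_deriv u (fun x => u1 x + (Q x)%:C * u x) /\
    W11loc_with_deriv u1 w /\
    {ae leb R, forall x, f x = - w x - (Q x)%:C * u1 x - ((Q x) ^+ 2)%:C * u x}.

(** resolvent set: S(q) - z is bounded below and onto L_2(R)
    (i.e. bijective from Dom(S(q)) onto L_2(R) with bounded inverse) *)
Definition S_resolvent (R : realType) (Q : R -> R) (z : R[i]) :=
  (exists M : R, 0 < M /\ forall u f, S_graph Q u f ->
      L2norm u <= M * L2norm (fun x => f x - z * u x)) /\
  (forall g, cL2 setT g -> exists u f, S_graph Q u f /\
      {ae leb R, forall x, f x - z * u x = g x}).

Definition S_spectrum (R : realType) (Q : R -> R) : set R[i] :=
  [set z | ~ S_resolvent Q z].

(** z is an eigenvalue of S(q) (point spectrum) *)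
Definition S_eigenvalue (R : realType) (Q : R -> R) (z : R[i]) :=
  exists u f, S_graph Q u f /\ {ae leb R, forall x, f x = z * u x} /\
    ~ {ae leb R, forall x, u x = 0}.

(** H^1[0,1] with derivative g *)
Definition H1_01 (R : realType) (u g : R -> R[i]) :=
  cL2 `[0, 1] g /\
  (forall x y : R, 0 <= x -> x <= y -> y <= 1 -> u y - u x = cint `[x, y] g).

(** the form t_± of S_±(q) evaluated at (u, v) with u' = g, v' = h *)
Definition t_form (R : realType) (Q : R -> R) (u g v h : R -> R[i]) : R[i] :=
  cint `[0, 1] (fun x => g x * (h x)^* - (Q x)%:C * u x * (h x)^*
                         - (Q x)%:C * g x * (v x)^*).

(** form domain of t_s: u in H^1[0,1], u(1) = s u(0); s = 1 periodic,
    s = -1 semiperiodic *)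
Definition tdom (R : realType) (s : R) (u g : R -> R[i]) :=
  H1_01 u g /\ u 1 = s%:C * u 0.

(** z is an eigenvalue of the operator S_s(q) associated with the form t_s:
    there is a nonzero u in Dom(S_s(q)) with S_s(q) u = z u, i.e.
    u in D(t_s), u <> 0 in L_2(0,1) and t_s[u,v] = <z u, v> for all v in D(t_s). *)
Definition Spm_eigenvalue (R : realType) (Q : R -> R) (s : R) (z : R[i]) :=
  exists u g, tdom s u g /\
    ~ {ae leb R, forall x, x \in `[0, 1] -> u x = 0} /\
    forall v h, tdom s v h ->
      t_form Q u g v h = cint `[0, 1] (fun x => z * u x * (v x)^*).

(** q in H^{-1}_per(R,R), given by its Fourier coefficients:
    qhat n := \hat q(2n), so q = sum_n qhat n e^{i 2n pi x}. *)
Definition Hm1per (R : realType) (qhat : int -> R[i]) :=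
  (forall n : int, qhat (- n) = (qhat n)^*) /\
  exists M : R, forall N : nat,
    \sum_(0 <= k < N)
       (csq (qhat k%:Z) / (1 + (2 * k)%:R) ^+ 2
        + csq (qhat (- (k.+1)%:Z)) / (1 + (2 * k.+1)%:R) ^+ 2) <= M.

(** Q is (a representative of) the 1-periodic real L_2,loc function
    Q = sum_{k in 2Z, k<>0} qhat(k)/(i k pi) e^{i k pi x}:
    its Fourier coefficients are those. *)
Definition Q_of (R : realType) (qhat : int -> R[i]) (Q : R -> R) :=
  (forall x, Q (x + 1) = Q x) /\
  measurable_fun setT Q /\
  (leb R).-integrable `[0, 1] (fun x => (Q x ^+ 2)%:E) /\
  forall n : int,
    cint `[0, 1] (fun x => (Q x)%:C * expi (- (2 * n%:~R * pi * x))) =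
    if n == 0 then 0 else qhat n / ('i * (2 * n%:~R * pi)%:C).

(* Main.v *)
Require Import Defs.
From HB Require Import structures.
From mathcomp Require Import all_boot all_order all_algebra.
From mathcomp Require Import all_classical all_reals all_analysis.
From mathcomp Require Import complex.
From mathcomp Require Import measurable_realfun.
From mathcomp Require Import ring lra.
Set Implicit Arguments.
Unset Strict Implicit.
Unset Printing Implicit Defensive.
Import Order.TTheory GRing.Theory Num.Theory.
Import numFieldNormedType.Exports.
Local Open Scope classical_set_scope.
Local Open Scope ring_scope.
Local Open Scope complex_scope.

(** Since q = Q', the equation S(q)u = zu is a first-order linear system for u and the
    quasi-derivative u1 = u' - Qu, whose coefficients (built from Q and Q^2) are 1-periodic and
    locally integrable. Classical Hill theory then applies, provided pointwise derivatives are
    replaced by integral identities ([ac], [cac]). The Picard series ([picard_sol]) solves the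
    system, and the quasi-Wronskian u v1 - u1 v plays the role of the Wronskian ([sol_lagrange]).
    The monodromy matrix over one period has determinant one and trace [Delta z]; its eigenvalues
    rho, the multipliers, satisfy rho^2 - Delta rho + 1 = 0 and carry Floquet solutions p(x + 1) =
    rho p(x) ([floquet]).

    The spectrum is the set of real l with |disc l| <= 2, where [disc] is [Delta] on the real line
    ([spectrumP]). If one multiplier has modulus less than one, a Floquet solution decaying to the
    right and one decaying to the left form a Green function, which is bounded on L_2 ([resolvent]).
    If the multipliers are unimodular, then z is real ([unimodular_real]), no nonzero solution is
    square integrable on a half-line, and this prevents S(q) - z from being onto
    ([unimodular_spectrum]). The same half-line argument excludes eigenvalues ([no_eigenvalue]).

    The gap structure is a statement about the graph of [disc]. Far to the left [disc] is at least
    2, because the quadratic form is positive there ([disc_low]). Arbitrarily far to the right it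
    reaches both [2, oo) and (-oo, -2], because the Pruefer angle of the Dirichlet solution passes
    every large multiple of pi ([disc_oscillates]). Its derivative does not vanish where |disc| < 2
    ([ddisc_neq0]); where |disc| = 2 and the derivative vanishes, the monodromy is plus or minus the
    identity and |disc| < 2 on both sides ([degenerate_gap]). These facts force [disc] to cross from
    2 to -2 and back with a gap, possibly a single point, after each crossing ([band_structure]).

    At the endpoints with index k, [disc] equals 2 (-1)^k, so (-1)^k is a multiplier; its Floquet
    solution restricted to [0,1] is an eigenfunction of the periodic or semiperiodic form
    ([quasiperiodic_eigenvalue]). *)

(** * Locally integrable functions and integrals over segments *)

Section itg.
Variable R : realType.
Local Notation mu := (@lebesgue_measure R).
Implicit Types (f g h : R -> R) (x y z : R).

Definition lint f := forall a b, mu.-integrable `[a, b] (EFin \o f).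
                                              
Definition itg f x y := Rintegral mu `[x, y] f.

Lemma lint_ext f g : f =1 g -> lint f -> lint g.
Proof. by move=> /funext ->. Qed.

Lemma measurable_itvcc x y : measurable (`[x, y] : set R).
Proof. exact: measurable_itv. Qed.

Lemma measurable_real f : (forall a b : R, measurable_fun (`[a, b] : set R) f) ->
  measurable_fun setT f.
Proof.
move=> mf; rewrite -(bigcup_itvT true false).
apply/measurable_fun_bigcup => // n.
Qed.

Lemma lint_measurable f : lint f -> measurable_fun setT f.
Proof.
move=> lf; apply: measurable_real => a b.
by apply/measurable_EFinP; exact: measurable_int (lf a b).
Qed.

Lemma lintD f g : lint f -> lint g -> lint (fun x => f x + g x).
Proof. by move=> lf lg a b; exact: (integrableD _ (lf a b) (lg a b)). Qed.

Lemma lintZ k f : lint f -> lint (fun x => k * f x).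
Proof. by move=> lf a b; exact: (integrableZl _ k (lf a b)). Qed.

Lemma lintN f : lint f -> lint (fun x => - f x).
Proof. by move=> lf a b; exact: (integrableN (lf a b)). Qed.

Lemma lintB f g : lint f -> lint g -> lint (fun x => f x - g x).
Proof. by move=> lf lg; apply: lintD => //; apply: lintN. Qed.

Lemma lint_sum (T : finType) (F : T -> R -> R) :
  (forall i, lint (F i)) -> lint (fun x => \sum_i F i x).
Proof.
move=> lF a b; rewrite (_ : EFin \o _ = fun x => (\sum_i (F i x)%:E)%E).
  by apply: integrable_sum => // i _; apply: lF.
by apply/funext => x /=; rewrite -sumEFin.
Qed.

Lemma lint_norm f : lint f -> lint (fun x => `|f x|).
Proof. by move=> lf a b; apply: integrable_norm. Qed.

Lemma lint_le f g : measurable_fun setT f -> (forall x, `|f x| <= g x) ->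
  lint g -> lint f.
Proof.
move=> mf fg lg a b; apply: (le_integrable _ _ _ (lg a b)) => //.
  by apply/measurable_EFinP; exact: measurable_funTS.
move=> x _ /=; rewrite lee_fin (le_trans (fg x))//; exact: ler_norm.
Qed.

Lemma lint_cont f : continuous f -> lint f.
Proof.
move=> cf a b; apply: continuous_compact_integrable; first exact: segment_compact.
by apply: continuous_subspaceT.
Qed.

Lemma lint_cst c : lint (fun=> c).
Proof. by apply: lint_cont => x; exact: cst_continuous. Qed.

Lemma cont_bounded f a b : continuous f ->
  exists2 M, 0 < M & forall x, a <= x <= b -> `|f x| <= M.
Proof.
move=> cf; have [ab|ba] := leP a b; last first.
  exists 1 => // x /andP[ax xb]; have := le_trans ax xb; rewrite leNgt ba; done.
have cn : {within `[a, b], continuous (fun x => `|f x|)}.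
  apply: continuous_subspaceT => x; apply: continuous_comp; first exact: cf.
  exact: norm_continuous.
have [c _ cM] := EVT_max ab cn.
exists (`|f c| + 1); first by rewrite ltr_wpDl.
move=> x xab; rewrite (le_trans (cM x _))//.
by rewrite lerDl.
Qed.

Lemma lint_mulc f g : continuous g -> lint f -> lint (fun x => g x * f x).
Proof.
move=> cg lf a b; have [M M0 gM] := cont_bounded a b cg.
apply: (le_integrable _ _ _ (integrableZl _ M (lf a b))) => //.
  apply/measurable_EFinP; apply: measurable_funTS.
  apply: measurable_funM; [exact: continuous_measurable_fun|exact: lint_measurable].
move=> x /= xab; rewrite lee_fin !normrM ler_wpM2r// (le_trans (gM x xab))//.
exact: ler_norm.
Qed.

Lemma lint_sqrt f : measurable_fun setT f -> lint (fun x => f x ^+ 2) -> lint f.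
Proof.
move=> mf lf; apply: (@lint_le _ (fun x => f x ^+ 2 + 1)) => //.
- move=> x; rewrite ler_norml; apply/andP; split; nra.
- by apply: lintD => //; apply: lint_cst.
Qed.

Lemma itgxx f x : itg f x x = 0.
Proof. by rewrite /itg set_itv1 Rintegral_set1. Qed.

Lemma itgD f g x y : lint f -> lint g ->
  itg (fun t => f t + g t) x y = itg f x y + itg g x y.
Proof. by move=> lf lg; apply: RintegralD. Qed.

Lemma itgB f g x y : lint f -> lint g ->
  itg (fun t => f t - g t) x y = itg f x y - itg g x y.
Proof. by move=> lf lg; apply: RintegralB. Qed.

Lemma itgZ k f x y : lint f -> itg (fun t => k * f t) x y = k * itg f x y.
Proof. by move=> lf; apply: RintegralZl. Qed.

Lemma itgN f x y : lint f -> itg (fun t => - f t) x y = - itg f x y.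
Proof.
move=> lf; rewrite -mulN1r -itgZ//; congr itg; apply/funext => t.
by rewrite mulN1r.
Qed.

Lemma leb_itvcc x y : x <= y -> mu (`[x, y]%classic : set R) = (y - x)%:E.
Proof.
move=> xy; rewrite lebesgue_measure_itv /= lte_fin.
by move: xy; rewrite le_eqVlt => /predU1P[->|->] //; rewrite ltxx subrr.
Qed.

Lemma itg_cst c x y : x <= y -> itg (fun=> c) x y = c * (y - x).
Proof.
move=> xy; rewrite /itg Rintegral_cst//; congr (_ * _).
exact: (congr1 fine (leb_itvcc xy)).
Qed.

Lemma itg_ge0 f x y : (forall t, x <= t <= y -> 0 <= f t) -> 0 <= itg f x y.
Proof. by move=> f0; apply: Rintegral_ge0 => t /= ty; exact: f0. Qed.

Lemma le_itg f g x y : lint f -> lint g ->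
  (forall t, x <= t <= y -> f t <= g t) -> itg f x y <= itg g x y.
Proof. by move=> lf lg fg; apply: le_Rintegral => // t /= ty; exact: fg. Qed.

Lemma itg_norm f x y : lint f -> `|itg f x y| <= itg (fun t => `|f t|) x y.
Proof. by move=> lf; apply: le_normr_Rintegral. Qed.

Lemma eq_itg f g x y : (forall t, x <= t <= y -> f t = g t) ->
  itg f x y = itg g x y.
Proof. by move=> fg; apply: eq_Rintegral => t; rewrite inE /= => ty; exact: fg. Qed.

Lemma itg_split f x y z : lint f -> x <= y -> y <= z ->
  itg f x z = itg f x y + itg f y z.
Proof.
move=> lf xy yz; apply/eqP; rewrite addrC -subr_eq; apply/eqP.
rewrite /itg (@Rintegral_itvB _ f (BLeft x) (BRight z) y) ?bnd_simp//.
rewrite Rintegral_itv_obnd_cbnd//.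
by apply: integrableS (lf y z) => //; move=> t /=; rewrite !in_itv /= => /andP[/ltW -> ->].
Qed.

Lemma itg_ge f x y x' y' : lint f -> (forall t, 0 <= f t) ->
  x' <= x -> x <= y -> y <= y' -> itg f x y <= itg f x' y'.
Proof.
move=> lf f0 x'x xy yy'.
rewrite (@itg_split f x' x y') ?(le_trans xy)// (@itg_split f x y y')//.
rewrite (addrC (itg f x y)) addrA lerDr addr_ge0//; apply: itg_ge0 => //.
Qed.

Lemma itg_small f a b (e : R) : lint f -> (forall t, 0 <= f t) -> 0 < e ->
  exists2 d, 0 < d & forall x y, a <= x -> x <= y -> y <= b -> y - x < d ->
    itg f x y < e.
Proof.
move=> lf f0 e0.
have ifab : mu.-integrable setT (EFin \o (f \_ `[a, b])).
  have := lf a b; rewrite integrable_mkcond//.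
  by rewrite restrict_EFin.
have [d [d0 dP]] := integral_normr_continuous ifab e0.
exists d => // x y ax xy yb yxd.
have mud : (mu (`[x, y]%classic : set R) < d%:E)%E by rewrite leb_itvcc// lte_fin.
apply: le_lt_trans (dP `[x, y]%classic (measurable_itvcc _ _) mud).
rewrite le_eqVlt; apply/orP; left; apply/eqP.
apply: eq_Rintegral => t; rewrite inE /= in_itv /= => /andP[xt ty].
rewrite patchE ifT ?ger0_norm// inE /= in_itv /=.
by rewrite (le_trans ax xt) (le_trans ty yb).
Qed.

Lemma lebesgue_measure_shift c (A : set R) : measurable A ->
  pushforward mu ((fun t : R => t + c) : _ -> measurableTypeR R) A = mu A.
Proof.
move=> mA.
have mphi : measurable_fun setT ((fun t : R => t + c) : _ -> measurableTypeR R).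
  by apply: measurable_funD.
apply/esym/lebesgue_measure_unique => //= _ [[a b]] _ <-.
rewrite /pushforward.
rewrite (_ : _ @^-1` _ = `]a - c, b - c]%classic); last first.
  by apply/seteqP; split => t /=; rewrite !in_itv /= ltrBlDr lerBrDr.
rewrite !lebesgue_measure_itv/= !lte_fin ltrD2r.
by case: ifP => // _; rewrite -!EFinD opprD addrACA subrr addr0.
Qed.

Lemma itg_shift f c x y : lint f -> lint (fun t => f (t + c)) /\
  itg (fun t => f (t + c)) x y = itg f (x + c) (y + c).
Proof.
move=> lf.
have mphi : measurable_fun setT ((fun t : R => t + c) : _ -> measurableTypeR R).
  by apply: measurable_funD.
have mf := lint_measurable lf.
have mfc : measurable_fun setT (fun t : R => f (t + c)).
  exact: measurableT_comp mf mphi.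
have pre a b : ((fun t : R => t + c) : _ -> measurableTypeR R) @^-1` (`[a + c, b + c]%classic : set R) = `[a, b]%classic.
  by apply/seteqP; split => t /=; rewrite !in_itv /= !lerD2r.
have lfc : lint (fun t => f (t + c)).
  move=> a b; apply/integrableP; split.
    by apply/measurable_EFinP; exact: measurable_funTS.
  have /integrableP[_] := lf (a + c) (b + c).
  rewrite -(@eq_measure_integral _ _ _ _ mu (pushforward mu ((fun t : R => t + c) : _ -> measurableTypeR R))); last first.
    by move=> A mA _; exact: lebesgue_measure_shift.
  rewrite ge0_integral_pushforward ?pre//.
  by apply: measurableT_comp => //; apply/measurable_EFinP; exact: measurable_funTS.
split => //; rewrite /itg /Rintegral; congr fine.
rewrite -[RHS](@eq_measure_integral _ _ _ _ mu (pushforward mu ((fun t : R => t + c) : _ -> measurableTypeR R))); last first.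
  by move=> A mA _; exact: lebesgue_measure_shift.
rewrite integral_pushforward ?pre//; exact/measurable_EFinP.
Qed.

                                                                                               
(** Increments that are quadratic in an absolutely continuous measure add up to nothing: on short
    steps one factor [itg h] is below any prescribed e/K, and the other factor is additive. This
    replaces differentiation almost everywhere in the calculus rules below. *)
Lemma itg_local_const (D : R -> R) h (C : R) a b : lint h -> (forall t, 0 <= h t) -> 0 <= C ->
  (forall x y, a <= x -> x <= y -> y <= b -> `|D y - D x| <= C * itg h x y ^+ 2) ->
  a <= b -> D b = D a.
Proof.
move=> lh h0 C0 HD ab; apply/eqP; rewrite -subr_eq0 -normr_le0; apply/ler_addgt0Pl.
move=> e e0; rewrite addr0.
pose K := C * itg h a b + 1.
have I0 x y : 0 <= itg h x y by exact: itg_ge0.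
have K0 : 0 < K by rewrite ltr_wpDl// mulr_ge0.
have [d d0 dP] := itg_small a b lh h0 (divr_gt0 e0 K0).
(* Induction on the number of steps of length d/2, so that every single step is shorter than the d
   of [itg_small]. *)
have claim : forall n y, a <= y -> y <= b -> y <= a + n%:R * (d / 2) ->
    `|D y - D a| <= C * (e / K) * itg h a y.
  elim=> [|n IH] y ay yb yn.
    rewrite mul0r addr0 in yn; have -> : y = a by apply/eqP; rewrite eq_le yn ay.
    by rewrite subrr normr0 itgxx mulr0.
  have [ya|ya] := leP (y - d / 2) a.
    rewrite (le_trans (HD _ _ (lexx a) ay yb))// expr2 mulrA ler_wpM2r// ler_wpM2l//.
    by apply/ltW/dP => //; lra.
  have := IH (y - d / 2); rewrite (ltW ya) => /(_ isT) IH'.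
  have yd : y - d / 2 <= y by lra.
  rewrite (@itg_split h a (y - d / 2) y) ?(ltW ya)// mulrDr.
  rewrite -(subrKA (D (y - d / 2))) (le_trans (ler_normD _ _))// addrC lerD//.
    apply: IH'; first exact: le_trans yd yb.
    by move: yn; rewrite -natr1; lra.
  rewrite (le_trans (HD _ _ (ltW ya) yd yb))// expr2 mulrA ler_wpM2r// ler_wpM2l//.
  by apply/ltW/dP => //; [exact: ltW|lra].
have [n nP] : exists n : nat, b <= a + n%:R * (d / 2).
  exists (Num.truncn ((b - a) / (d / 2))).+1.
  rewrite -lerBlDl -ler_pdivrMr ?divr_gt0//.
  by apply/ltW/truncnS_gt.
rewrite (le_trans (claim n b ab (lexx b) nP))//.
rewrite mulrC mulrA mulrCA mulrA -ler_pdivlMr ?invr_gt0// invrK mulrC ler_wpM2l ?(ltW e0)//.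
by rewrite /K lerDl.
Qed.

Lemma ae_sub (P P' : R -> Prop) : (forall x, P x -> P' x) ->
  {ae mu, forall x, P x} -> {ae mu, forall x, P' x}.
Proof. by move=> PP'; apply: negligibleS => x /= nP' /PP'. Qed.

Lemma ae_and (P P' : R -> Prop) : {ae mu, forall x, P x} ->
  {ae mu, forall x, P' x} -> {ae mu, forall x, P x /\ P' x}.
Proof.
move=> aP aP'; have := negligibleU aP aP'; apply: negligibleS => x /= /not_andP.
by case; [left|right].
Qed.

Lemma itg_ae f g : lint f -> measurable_fun setT g ->
  {ae mu, forall x, f x = g x} -> lint g /\ itg f =2 itg g.
Proof.
move=> lf mg fg.
have fgD (D : set R) : ae_eq mu D (EFin \o f) (EFin \o g).
  by apply: ae_sub fg => x /= ->.
have mf := lint_measurable lf.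
have meas (D : set R) (k : R -> R) : measurable_fun setT k -> measurable_fun D (EFin \o k).
  by move=> mk; apply/measurable_EFinP; exact: measurable_funTS.
split=> [a b|a b].
  apply/integrableP; split; first exact: meas.
  have /integrableP[_] := lf a b.
  have -> : (\int[mu]_(x in `[a, b]) `|(EFin \o f) x| =
            \int[mu]_(x in `[a, b]) `|(EFin \o g) x|)%E; last by [].
  apply: ae_eq_integral => //.
  - by apply: measurableT_comp => //; exact: meas.
  - by apply: measurableT_comp => //; exact: meas.
  - by apply: ae_sub fg => x /= ->.
rewrite /itg /Rintegral; congr fine; apply: ae_eq_integral => //.
- exact: meas.
- exact: meas.
Qed.

Lemma integrable_line f C : lint f -> (forall t, 0 <= f t) ->
  (forall n : nat, itg f (- n%:R) n%:R <= C) ->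
  mu.-integrable setT (EFin \o f) /\ Rintegral mu setT f <= C.
Proof.
move=> lf f0 fC.
have mf := lint_measurable lf.
have cv' : (\int[mu]_(x in `[(- n%:R)%R, n%:R]) (f x)%:E)%E @[n --> \oo]
    --> (\int[mu]_x (f x)%:E)%E.
  rewrite -(bigcup_itvT true false); apply: ge0_nondecreasing_set_cvg_integral.
  - move=> m n mn; apply/subsetPset => t /=; rewrite !in_itv /= => /andP[t1 t2].
    by rewrite (le_trans _ t1) ?(le_trans t2)// ?lerN2 ?ler_nat.
  - by move=> n; exact: measurable_itv.
  - by move=> n; apply/measurable_EFinP; exact: measurable_funTS.
  - by move=> n x _; rewrite lee_fin.
have leC : (\int[mu]_x (f x)%:E <= C%:E)%E.
  move/cvg_lim : (cv') => <- //; apply: lime_le; first by apply/cvg_ex; eexists; exact: cv'.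
  apply: nearW => n; have := fC n; rewrite /itg /Rintegral -lee_fin fineK//.
  exact: integrable_fin_num.
have ge0 : (0 <= \int[mu]_x (f x)%:E)%E.
  by apply: integral_ge0 => x _; rewrite lee_fin.
split.
  apply/integrableP; split; first exact/measurable_EFinP.
  under eq_integral do rewrite gee0_abs ?lee_fin//.
  by rewrite (le_lt_trans leC)// ltry.
rewrite /Rintegral -lee_fin fineK// ge0_fin_numE//.
by rewrite (le_lt_trans leC)// ltry.
Qed.

Lemma lint_line f : mu.-integrable setT (EFin \o f) -> lint f.
Proof. by move=> fi a b; apply: integrableS fi. Qed.

Lemma itg_le_line f x y : mu.-integrable setT (EFin \o f) -> (forall t, 0 <= f t) ->
  itg f x y <= Rintegral mu setT f.
Proof.
move=> fi f0; rewrite /itg /Rintegral -lee_fin !fineK.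
- apply: ge0_subset_integral => //; first exact: measurable_int fi.
  by move=> t _; rewrite lee_fin.
- exact: integrable_fin_num.
- by apply: integrable_fin_num => //; apply: lint_line.
Qed.

Lemma itg_gt0 f x y t0 : continuous f -> (forall t, 0 <= f t) -> x < y ->
  x <= t0 <= y -> 0 < f t0 -> 0 < itg f x y.
Proof.
move=> cf f0 xy /andP[xt ty] ft.
have /cvgrPdist_lt /(_ (f t0 / 2)) := cf t0.
rewrite divr_gt0// => /(_ isT) /nbhs_ballP[d /= d0 dP].
have fd t : `|t0 - t| < d -> f t0 / 2 <= f t.
  by move=> td; have := dP t td; rewrite /= ltr_norml => /andP[_]; lra.
pose a := Num.max x (t0 - d / 2); pose b := Num.min y (t0 + d / 2).
have ax : x <= a by rewrite le_max lexx.
have yb : b <= y by rewrite ge_min lexx.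
have ab : a < b.
  rewrite gt_max !lt_min xy /=; apply/andP; split; first lra.
  by apply/andP; split; lra.
have lf := lint_cont cf.
apply: lt_le_trans (itg_ge lf f0 ax (ltW ab) yb).
apply: (@lt_le_trans _ _ (itg (fun=> f t0 / 2) a b)).
  by rewrite itg_cst ?(ltW ab)// mulr_gt0// ?divr_gt0// subr_gt0.
apply: le_itg => //; first exact: lint_cst.
move=> t; rewrite ge_max le_min => /andP[/andP[_ t1] /andP[_ t2]].
by apply: fd; rewrite ltr_norml; apply/andP; split; lra.
Qed.
End itg.

(** * Calculus of absolutely continuous real functions *)

Section ac.
Variable R : realType.
Local Notation mu := (@lebesgue_measure R).
Implicit Types (f g h u v w : R -> R) (x y z : R).

(** The integrand is an explicit datum, so that no pointwise derivative is ever taken and the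
    calculus rules are identities between integrals. *)
Definition ac u g := lint g /\ forall x y, x <= y -> u y - u x = itg g x y.

Lemma ac_ext u g u' g' : u =1 u' -> g =1 g' -> ac u g -> ac u' g'.
Proof. by move=> /funext <- /funext <-. Qed.

Lemma ac_norm u g x y : ac u g -> x <= y -> `|u y - u x| <= itg (fun t => `|g t|) x y.
Proof. by move=> [lg ug] xy; rewrite ug// itg_norm. Qed.

Lemma ac_cont u g : ac u g -> continuous u.
Proof.
move=> uac x; apply/cvgrPdist_lt => e e0.
have [lg _] := uac.
have [d d0 dP] := itg_small (x - 1) (x + 1) (lint_norm lg) (fun=> normr_ge0 _) e0.
have m0 : 0 < Num.min d 1 by rewrite lt_min d0 ltr01.
apply/nbhs_ballP; exists (Num.min d 1) => //= y; rewrite /ball /= lt_min => /andP[yd y1].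
have [xy|/ltW yx] := leP x y.
  rewrite distrC (le_lt_trans (ac_norm uac xy))//; move: yd y1.
  rewrite distrC ger0_norm ?subr_ge0// => yd y1.
  by apply: dP => //; lra.
rewrite (le_lt_trans (ac_norm uac yx))//; move: yd y1.
rewrite ger0_norm ?subr_ge0// => yd y1.
by apply: dP => //; lra.
Qed.

Lemma ac_prim g c : lint g -> exists2 u, ac u g & u 0 = c.
Proof.
move=> lg; exists (fun x => c + (if 0 <= x then itg g 0 x else - itg g x 0)).
  split=> // x y xy; rewrite opprD addrACA subrr add0r.
  case: ifPn => y0; case: ifPn => x0.
  - by rewrite (itg_split lg x0 xy) addrAC subrr add0r.
  - rewrite opprK addrC -itg_split//; apply: ltW; rewrite ltNge//.
  - by rewrite (le_trans x0 xy) in y0.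
  - rewrite -ltNge in y0; rewrite opprK (itg_split lg xy (ltW y0)).
    by rewrite addrC -addrA subrr addr0.
by rewrite lexx itgxx addr0.
Qed.

Lemma acD u g v h : ac u g -> ac v h -> ac (fun x => u x + v x) (fun x => g x + h x).
Proof.
move=> [lg ug] [lh vh]; split; first exact: lintD.
by move=> x y xy; rewrite itgD// -ug// -vh//; ring.
Qed.

Lemma acZ k u g : ac u g -> ac (fun x => k * u x) (fun x => k * g x).
Proof.
move=> [lg ug]; split; first exact: lintZ.
by move=> x y xy; rewrite itgZ// -ug//; ring.
Qed.

Lemma acN u g : ac u g -> ac (fun x => - u x) (fun x => - g x).
Proof. by move=> /(acZ (-1)); apply: ac_ext => x; rewrite mulN1r. Qed.

Lemma acB u g v h : ac u g -> ac v h -> ac (fun x => u x - v x) (fun x => g x - h x).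
Proof. by move=> ug /acN; apply: acD. Qed.

Lemma ac_cst c : ac (fun=> c) (fun=> 0).
Proof. by split=> [|x y xy]; [exact: lint_cst|rewrite itg_cst// mul0r subrr]. Qed.

Lemma ac_const u g : ac u g -> (forall t, g t = 0) -> forall x y, u x = u y.
Proof.
move=> [lg ug] g0 x y; wlog xy : x y / x <= y.
  by move=> H; have [xy|/ltW yx] := leP x y; [exact: H|apply/esym/H].
apply/eqP; rewrite eq_sym -subr_eq0 ug// (@eq_itg _ _ (fun=> 0)) ?itg_cst ?mul0r//.
Qed.

(** The difference of u and a primitive of g has quadratically small increments, hence is constant
    by [itg_local_const]. The product and chain rules are both reduced to this criterion. *)
Lemma ac_local u g h (C : R) : lint g -> lint h -> (forall t, 0 <= h t) -> 0 <= C ->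
  (forall x y, x <= y -> `|u y - u x - itg g x y| <= C * itg h x y ^+ 2) -> ac u g.
Proof.
move=> lg lh h0 C0 H; split=> // a b ab.
have [p [_ pg] _] := ac_prim 0 lg.
have := itg_local_const (D := fun x => u x - p x) lh h0 C0 _ ab => /(_ _)/eqP.
rewrite -subr_eq0 opprD addrACA opprK -pg// => E; apply/eqP.
rewrite -subr_eq0 [X in X == _](_ : _ = u b - u a + (- p b + p a)); last by ring.
apply: E => x y ax xy yb.
rewrite [X in `|X|](_ : _ = u y - u x - (p y - p x)); last by ring.
by rewrite pg// H.
Qed.

Lemma itg_dev f w x y c (B : R) : lint f -> continuous w ->
  (forall t, x <= t <= y -> `|w t - c| <= B) ->
  `|itg (fun t => f t * w t) x y - c * itg f x y| <= B * itg (fun t => `|f t|) x y.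
Proof.
move=> lf cw wB.
have lfw : lint (fun t => f t * w t).
  by apply: lint_ext (lint_mulc cw lf) => t; rewrite mulrC.
rewrite -(itgZ c)// -itgB//; last exact: lintZ.
rewrite -itgZ; last exact: lint_norm.
have lA : lint (fun t => f t * w t - c * f t) by apply: lintB => //; exact: lintZ.
apply: le_trans (itg_norm _ _ lA) _; apply: le_itg.
- exact: lint_norm.
- by apply: lintZ; exact: lint_norm.
- move=> t txy; rewrite [X in `|X|](_ : _ = (w t - c) * f t); last by ring.
  by rewrite normrM ler_wpM2r// wB.
Qed.

Lemma ac_osc u g x y t : ac u g -> x <= t <= y ->
  `|u t - u x| <= itg (fun t => `|g t|) x y.
Proof.
move=> ug /andP[xt ty]; rewrite (le_trans (ac_norm ug xt))//.
by apply: itg_ge => //; apply: lint_norm; case: ug.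
Qed.

(** Freezing u and v at the left end of a step costs at most GH for each of the two integrals, and
    the product of the two increments costs another GH, where G and H are the integrals of |g| and
    |h|. All three are below (G + H)^2. *)
Lemma acM u g v h : ac u g -> ac v h ->
  ac (fun x => u x * v x) (fun x => g x * v x + u x * h x).
Proof.
move=> ug vh; have [[lg ug'] [lh vh']] := (ug, vh).
have cu := ac_cont ug; have cv := ac_cont vh.
have lgv : lint (fun t => g t * v t).
  by apply: lint_ext (lint_mulc cv lg) => t; rewrite mulrC.
have lhu : lint (fun t => h t * u t).
  by apply: lint_ext (lint_mulc cu lh) => t; rewrite mulrC.
have -> : (fun x => g x * v x + u x * h x) = (fun x => g x * v x + h x * u x).
  by apply/funext => t; rewrite (mulrC (u t)).
have lG : lint (fun t => `|g t|) by exact: lint_norm.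
have lH : lint (fun t => `|h t|) by exact: lint_norm.
apply: (@ac_local _ _ (fun t => `|g t| + `|h t|) 3) => //; [exact: lintD|exact: lintD|].
move=> x y xy; rewrite !itgD//.
have H1 := itg_dev lg cv (fun t (ht : x <= t <= y) => ac_osc vh ht).
have H2 := itg_dev lh cu (fun t (ht : x <= t <= y) => ac_osc ug ht).
have H3 := ac_norm ug xy; have H4 := ac_norm vh xy.
move: H1 H2 H3 H4; rewrite -ug'// -vh'//.
set G := itg (fun t => `|g t|) x y; set H := itg (fun t => `|h t|) x y.
set A := itg _ x y; set B := itg _ x y => H1 H2 H3 H4.
have G0 : 0 <= G by apply: itg_ge0.
have H0 : 0 <= H by apply: itg_ge0.
rewrite [X in `|X|](_ : _ = (u y - u x) * (v y - v x) - (A - v x * (u y - u x))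
   - (B - u x * (v y - v x))); last by ring.
rewrite (le_trans (ler_normB _ _))// (@le_trans _ _ (G * H + H * G + G * H))//; last nra.
rewrite lerD// (le_trans (ler_normB _ _))// lerD// normrM ler_pM//.
Qed.

(** A global second-order Taylor bound on F makes the remainder quadratic in the integral of |g|. It
    is needed only for sine and cosine. *)
Lemma ac_comp (F F' : R -> R) (K : R) u g : continuous F' -> 0 <= K ->
  (forall s t, `|F s - F t - F' t * (s - t)| <= K * (s - t) ^+ 2) ->
  (forall s t, `|F' s - F' t| <= K * `|s - t|) ->
  ac u g -> ac (fun x => F (u x)) (fun x => F' (u x) * g x).
Proof.
move=> cF' K0 HF HF' ug; have [lg ug'] := ug; have cu := ac_cont ug.
have cFu : continuous (fun x => F' (u x)).
  by move=> x; apply: continuous_comp; [exact: cu|exact: cF'].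
have lG : lint (fun t => `|g t|) by exact: lint_norm.
apply: (@ac_local _ _ (fun t => `|g t|) (K + K)) => //.
- exact: lint_mulc.
- exact: addr_ge0.
move=> x y xy.
have -> : itg (fun t => F' (u t) * g t) x y = itg (fun t => g t * F' (u t)) x y.
  by apply: eq_itg => t _; rewrite mulrC.
have := ac_norm ug xy; set G := itg (fun t => `|g t|) x y => HG.
have G0 : 0 <= G by apply: itg_ge0.
have : `|itg (fun t => g t * F' (u t)) x y - F' (u x) * itg g x y| <= (K * G) * G.
  apply: itg_dev => // t txy; rewrite (le_trans (HF' _ _))// ler_wpM2l//.
  exact: ac_osc.
rewrite -ug'//; set A := itg _ x y => H1.
rewrite [X in `|X|](_ : _ = F (u y) - F (u x) - F' (u x) * (u y - u x)
   - (A - F' (u x) * (u y - u x))); last by ring.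
rewrite (le_trans (ler_normB _ _))// mulrDl expr2 lerD//; last by rewrite mulrA.
rewrite (le_trans (HF _ _))// ler_wpM2l//.
by move: HG; rewrite ler_norml => /andP[? ?]; nra.
Qed.

Lemma ac_ae u g h : ac u g -> measurable_fun setT h ->
  {ae mu, forall x, g x = h x} -> ac u h.
Proof.
move=> [lg ug] mh gh; have [lh E] := itg_ae lg mh gh.
by split=> // x y xy; rewrite ug// E.
Qed.

Lemma ac_shift u g c : ac u g -> ac (fun x => u (x + c)) (fun x => g (x + c)).
Proof.
move=> [lg ug]; have [lgc _] := itg_shift c 0 0 lg.
split=> // x y xy; have [_ ->] := itg_shift c x y lg.
by rewrite ug// lerD2r.
Qed.

Lemma MVT_ler (f df : R -> R) s t : (forall x, is_derive x (1:R) f (df x)) ->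
  (forall x, `|df x| <= 1) -> `|f s - f t| <= `|s - t|.
Proof.
move=> fdf df1; wlog st : s t / t <= s.
  move=> H; have [|/ltW] := leP t s; first exact: H.
  by rewrite distrC (distrC s); exact: H.
have [|c _ ->] := MVT_segment st (fun x _ => fdf x).
  by apply: continuous_subspaceT => x; apply/differentiable_continuous/derivable1_diffP; case: (fdf x).
by rewrite normrM ler_piMl.
Qed.

Lemma MVT2_ler (f df d2f : R -> R) s t : (forall x, is_derive x (1:R) f (df x)) ->
  (forall x, is_derive x (1:R) df (d2f x)) ->
  (forall x, `|d2f x| <= 1) -> `|f s - f t - df t * (s - t)| <= (s - t) ^+ 2.
Proof.
move=> fdf dfd d1.
have H a b : a <= b -> exists2 c, c \in `[a, b] & f b - f a = df c * (b - a).
  move=> ab; apply: (MVT_segment ab (fun x _ => fdf x)).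
  by apply: continuous_subspaceT => x; apply/differentiable_continuous/derivable1_diffP; case: (fdf x).
have E c : `|c - t| <= `|s - t| -> `|(df c - df t) * (s - t)| <= (s - t) ^+ 2.
  move=> ct; rewrite normrM -[leRHS]real_normK ?num_real// expr2 ler_wpM2r//.
  by rewrite (le_trans _ ct)//; exact: MVT_ler.
have [ts|/ltW st] := leP t s.
  have [c] := H _ _ ts; rewrite in_itv /= => /andP[tc cs] ->.
  by rewrite -mulrBl E// !ger0_norm ?subr_ge0//; lra.
have [c] := H _ _ st; rewrite in_itv /= => /andP[tc cs] E'.
have -> : f s - f t = df c * (s - t) by rewrite -opprB E'; ring.
by rewrite -mulrBl E// !ler0_norm ?subr_le0//; lra.
Qed.

Lemma ac_cos u g : ac u g -> ac (fun x => cos (u x)) (fun x => - sin (u x) * g x).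
Proof.
apply: (@ac_comp _ (fun x => - sin x) 1) => //.
- by move=> x; apply: continuousN; exact: continuous_sin.
- move=> s t; rewrite mul1r; apply: (@MVT2_ler _ _ (fun x => - cos x)).
  by move=> x; rewrite normrN; exact: cos_max.
- move=> s t; rewrite mul1r; apply: (@MVT_ler _ (fun x => - cos x)).
  by move=> x; rewrite normrN; exact: cos_max.
Qed.

Lemma ac_sin u g : ac u g -> ac (fun x => sin (u x)) (fun x => cos (u x) * g x).
Proof.
apply: (@ac_comp _ cos 1) => //.
- exact: continuous_cos.
- move=> s t; rewrite mul1r; apply: (@MVT2_ler _ _ (fun x => - sin x)).
  by move=> x; rewrite normrN; exact: sin_max.
- move=> s t; rewrite mul1r; apply: (@MVT_ler _ (fun x => - sin x)).
  by move=> x; rewrite normrN; exact: sin_max.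
Qed.
End ac.

                                                            

(** * Linear systems with locally integrable coefficients *)

Section linsys.
Variable R : realType.
Local Notation mu := (@lebesgue_measure R).
Implicit Types (f g h u v w : R -> R) (x y z : R).

Lemma itg_dct (f_ : nat -> R -> R) f g : (forall n, lint (f_ n)) ->
  (forall t, f_ ^~ t @ \oo --> f t) -> lint g -> (forall n t, `|f_ n t| <= g t) ->
  lint f /\ forall x y, (fun n => itg (f_ n) x y) @ \oo --> itg f x y.
Proof.
move=> lf_ f_f lg f_g.
have mf : measurable_fun setT f.
  apply: (measurable_fun_cvg (h := f_)) => [n|t _]; last exact: f_f.
  exact: lint_measurable.
have D x y := @dominated_convergence _ _ _ mu `[x, y]%classic (measurable_itv _)
  (fun n => EFin \o f_ n) (EFin \o f) (EFin \o g).
have {}D x y : mu.-integrable `[x, y] (EFin \o f) /\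
    (fun n => itg (f_ n) x y) @ \oo --> itg f x y.
  have [|||//||] := D x y.
  - by move=> n; apply/measurable_EFinP; apply: measurable_funTS; exact: lint_measurable.
  - by apply/measurable_EFinP; exact: measurable_funTS.
  - by apply: aeW => t _; apply: cvg_EFin; [exact: nearW|exact: f_f].
  - by apply: aeW => t n _ /=; rewrite lee_fin.
  move=> If _ cf; split=> //.
  apply: fine_cvg; rewrite fineK//; exact: integrable_fin_num.
split=> [x y|x y]; first by case: (D x y).
by case: (D x y).
Qed.

Definition prim f x := if 0 <= x then itg f 0 x else - itg f x 0.

Lemma prim0 f : prim f 0 = 0.
Proof. by rewrite /prim lexx itgxx. Qed.

Lemma ac_primE f : lint f -> ac (prim f) f.
Proof.
move=> lf; split=> // x y xy; rewrite /prim.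
case: ifPn => y0; case: ifPn => x0.
- by rewrite (itg_split lf x0 xy) addrAC subrr add0r.
- rewrite opprK addrC -itg_split//; apply: ltW; rewrite ltNge//.
- by rewrite (le_trans x0 xy) in y0.
- rewrite -ltNge in y0; rewrite opprK (itg_split lf xy (ltW y0)).
  by rewrite addrC -addrA subrr addr0.
Qed.

Lemma acX u g k : ac u g -> ac (fun x => u x ^+ k.+1) (fun x => k.+1%:R * (u x ^+ k * g x)).
Proof.
move=> ug; elim: k => [|k IH].
  by apply: ac_ext ug => x; rewrite ?expr1// expr0 mul1r mul1r.
apply: ac_ext (acM ug IH) => x; first by rewrite -exprS.
rewrite -[k.+2%:R]natr1 !exprS; ring.
Qed.

Lemma exprn_continuous' f k : continuous f -> continuous (fun x => f x ^+ k).
Proof.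
move=> cf; elim: k => [|k IH] x.
  by under eq_fun do rewrite expr0; exact: cst_continuous.
rewrite (_ : (fun x => f x ^+ k.+1) = f \* (fun x => f x ^+ k)).
  by apply: continuousM; [exact: cf|exact: IH].
by apply/funext => t; rewrite exprS.
Qed.

(** One Picard step gains a factor 1/(k+1), because G^(k+1)/(k+1) is a primitive of G^k g when G =
    [prim g]. To the left of 0 the function G is nonpositive, and the same computation is made with
    -G. *)
Lemma prim_bound f g (M : R) k x : lint f -> lint g -> (forall t, 0 <= g t) ->
  (forall t, `|f t| <= M * (`|prim g t| ^+ k * g t)) ->
  `|prim f x| <= M * (`|prim g x| ^+ k.+1 / k.+1%:R).
Proof.
move=> lf lg g0 fM; have Gac := ac_primE lg.
have [_ GE] := acX k Gac; have [_ GNE] := acX k (acN Gac).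
have lG : lint (fun t => prim g t ^+ k * g t).
  apply: lint_mulc lg => t; apply: exprn_continuous'; exact: (ac_cont Gac).
have lGN : lint (fun t => (- prim g t) ^+ k * g t).
  apply: lint_mulc lg => t; apply: exprn_continuous'; exact: (ac_cont (acN Gac)).
have lfn := lint_norm lf.
have kn0 : k.+1%:R != 0 :> R by rewrite pnatr_eq0.
have [x0|x0] := leP 0 x.
  have gx t : 0 <= t -> 0 <= prim g t.
    by move=> t0; rewrite /prim t0 itg_ge0.
  rewrite (ger0_norm (gx _ x0)) {1}/prim x0 (le_trans (itg_norm _ _ lf))//.
  apply: (@le_trans _ _ (itg (fun t => M * (prim g t ^+ k * g t)) 0 x)).
    apply: le_itg => //; first exact: lintZ.
    by move=> t /andP[t0 _]; rewrite (le_trans (fM t))// ger0_norm ?gx.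
  have := GE 0 x x0; rewrite prim0 expr0n /= subr0 => ->.
  by rewrite !itgZ// [k.+1%:R * _]mulrC mulfK.
have gx t : t <= 0 -> prim g t <= 0.
  rewrite /prim; have [t0 t0'|t0 _] := leP 0 t.
    by have -> : t = 0; [apply/eqP; rewrite eq_le t0 t0'|rewrite itgxx].
  by rewrite oppr_le0 itg_ge0.
rewrite (ler0_norm (gx _ (ltW x0))) {1}/prim (leNgt 0 x) x0 /= normrN (le_trans (itg_norm _ _ lf))//.
apply: (@le_trans _ _ (itg (fun t => M * ((- prim g t) ^+ k * g t)) x 0)).
  apply: le_itg => //; first exact: lintZ.
  by move=> t /andP[_ t0]; rewrite (le_trans (fM t))// ler0_norm ?gx.
have := GNE x 0 (ltW x0); rewrite prim0 oppr0 expr0n /= sub0r.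
rewrite itgZ//; last by apply: lint_ext (lintN lGN) => t; rewrite mulrN.
have -> : itg (fun x1 => (- prim g x1) ^+ k * - g x1) x 0 = - itg (fun t => (- prim g t) ^+ k * g t) x 0.
  by rewrite -itgN//; apply: eq_itg => t _; rewrite mulrN.
rewrite mulrN => /oppr_inj ->.
by rewrite itgZ// [k.+1%:R * _]mulrC mulfK.
Qed.

Section picard.
Variables (T : finType) (a : T -> T -> R -> R) (c : T -> R).
Hypothesis la : forall i j, lint (a i j).

(** These are the terms of the Neumann series, not its partial sums: the solution is their sum over
    k. *)
Fixpoint picard (k : nat) (i : T) : R -> R :=
  if k is k'.+1 then prim (fun x => \sum_j a i j x * picard k' j x) else fun=> c i.

Let g (x : R) : R := \sum_i \sum_j `|a i j x|.
Let N : R := \sum_i `|c i|.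

Lemma lint_picard_norm : lint g.
Proof. by apply: lint_sum => i; apply: lint_sum => j; exact: lint_norm. Qed.
Let lg := lint_picard_norm.
Let g0 x : 0 <= g x.
Proof. by apply: sumr_ge0 => i _; apply: sumr_ge0. Qed.

Let lint_aY (y : T -> R -> R) i : (forall j, continuous (y j)) ->
  lint (fun x => \sum_j a i j x * y j x).
Proof.
move=> cy; apply: lint_sum => j; apply: lint_ext (lint_mulc (cy j) (la i j)) => x.
by rewrite mulrC.
Qed.

Lemma picard_cont k i : continuous (picard k i).
Proof.
elim: k i => [|k IH] i /=; first by move=> x; exact: cst_continuous.
by apply: ac_cont; apply: ac_primE; exact: lint_aY.
Qed.

Let rowsum (y : T -> R) (B : R) i x : (forall j, `|y j| <= B) ->
  `|\sum_j a i j x * y j| <= B * g x.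
Proof.
move=> yB; rewrite (le_trans (ler_norm_sum _ _ _))//.
have B0 : 0 <= B by exact: le_trans (yB i).
apply: (@le_trans _ _ (\sum_j B * `|a i j x|)).
  by apply: ler_sum => j _; rewrite normrM mulrC ler_wpM2r.
rewrite -mulr_sumr ler_wpM2l// /g [leRHS](bigD1 i)//= lerDl.
by apply: sumr_ge0 => i' _; apply: sumr_ge0.
Qed.

Lemma picard_bound k i x : `|picard k i x| <= N * exp_coeff `|prim g x| k.
Proof.
elim: k i x => [|k IH] i x.
  by rewrite /exp_coeff /= expr0 fact0 divr1 mulr1 /N (bigD1 i)//= lerDl sumr_ge0.
rewrite (_ : N * _ = (N / k`!%:R) * (`|prim g x| ^+ k.+1 / k.+1%:R)); last first.
  by rewrite /exp_coeff /= factS natrM invfM; ring.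
apply: prim_bound => //.
  by apply: lint_aY => j; exact: picard_cont.
move=> t; rewrite (le_trans (rowsum _ _ (fun j => IH j t)))//.
by rewrite le_eqVlt; apply/orP; left; apply/eqP; rewrite /exp_coeff /=; ring.
Qed.

Let psum n i x := series (fun k => picard k i x) n.
Let psum0 i x : psum 0 i x = 0.
Proof. by rewrite /psum seriesEnat /= big_nil. Qed.

Let psumS n i x : psum n.+1 i x = psum n i x + picard n i x.
Proof. by rewrite /psum seriesSr. Qed.

Let psum_cont n i : continuous (psum n i).
Proof.
elim: n => [|n IH] x.
  by rewrite (_ : psum 0 i = fun=> 0); [exact: cst_continuous|apply/funext => t].
rewrite (_ : psum n.+1 i = fun x => psum n i x + picard n i x); last exact/funext.
by apply: continuousD; [exact: IH|exact: picard_cont].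
Qed.

Let y (i : T) (x : R) : R := limn (fun n => psum n i x).

Let N0 : 0 <= N. Proof. exact: sumr_ge0. Qed.

Let psum_cvg i x : (fun n => psum n i x) @ \oo --> y i x.
Proof.
apply: normed_cvg; apply: (series_le_cvg (v_ := fun k => N * exp_coeff `|prim g x| k)).
- by move=> n; exact: normr_ge0.
- by move=> n; rewrite mulr_ge0// exp_coeff_ge0.
- by move=> n; exact: picard_bound.
- by apply: is_cvg_seriesZ; exact: is_cvg_series_exp_coeff.
Qed.

Let psum_bound n i x : `|psum n i x| <= N * expR `|prim g x|.
Proof.
rewrite /psum seriesEnat /= (le_trans (ler_norm_sum _ _ _))//.
apply: (@le_trans _ _ (\sum_(0 <= k < n) N * exp_coeff `|prim g x| k)).
  by apply: ler_sum => k _; exact: picard_bound.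
rewrite -mulr_sumr ler_wpM2l//.
have := @nondecreasing_cvgn_le _ (series (exp_coeff `|prim g x|)) _ (is_cvg_series_exp_coeff _) n.
rewrite seriesEnat /=; apply.
by apply: nondecreasing_series => k _ _; rewrite exp_coeff_ge0.
Qed.

Let y_bound i x : `|y i x| <= N * expR `|prim g x|.
Proof.
have cn : (fun n => `|psum n i x|) @ \oo --> `|y i x|.
  by apply: cvg_norm; exact: psum_cvg.
rewrite -(cvg_lim _ cn)//.
apply: limr_le; first by apply: cvgP; apply: cvg_norm; exact: psum_cvg.
by apply: nearW => n; exact: psum_bound.
Qed.

Let psum_int n i (u v : R) : u <= v ->
  psum n.+1 i v - psum n.+1 i u = itg (fun t => \sum_j a i j t * psum n j t) u v.
Proof.
move=> uv; elim: n => [|n IH].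
  rewrite !psumS !psum0 !add0r /= subrr (@eq_itg _ _ (fun=> 0)) ?itg_cst ?mul0r// => t _.
  by rewrite big1// => j _; rewrite psum0 mulr0.
rewrite psumS (psumS n.+1 i u) opprD addrACA IH.
have lY : lint (fun x => \sum_j a i j x * picard n j x).
  by apply: lint_aY => j; exact: picard_cont.
have [_ ->] := ac_primE lY => //.
rewrite -itgD//; last by apply: lint_aY => j; exact: psum_cont.
apply: eq_itg => t _; rewrite -big_split /=; apply: eq_bigr => j _.
by rewrite -mulrDr psumS.
Qed.

(** The increments of the partial sum of order n + 1 are integrals of the system applied to the
    partial sum of order n; dominated convergence with majorant N exp|G| g passes to the limit. The
    explicit bound later gives uniformity in the spectral parameter. *)
Lemma picard_sol : exists w : T -> R -> R,
  [/\ forall i, ac (w i) (fun x => \sum_j a i j x * w j x), forall i, w i 0 = c i &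
    forall i x, `|w i x| <= N * expR `|prim g x|].
Proof.
exists y; split=> //.
- move=> i; have [||||ly dct] := @itg_dct (fun n x => \sum_j a i j x * psum n j x)
   (fun x => \sum_j a i j x * y j x) (fun x => N * (expR `|prim g x| * g x)).
  + by move=> n; apply: lint_aY => j; exact: psum_cont.
  + move=> t; rewrite -[X in _ --> X]big_enum /=.
    rewrite (_ : (fun n => _) = fun n => \sum_(j <- enum T) a i j t * psum n j t); last first.
      by apply/funext => n; rewrite big_enum.
    elim: (enum T) => [|j s' IH].
      by rewrite big_nil; under eq_fun do rewrite big_nil; exact: cvg_cst.
    rewrite big_cons; under eq_fun do rewrite big_cons.
    by apply: cvgD IH; apply: cvgMr; exact: psum_cvg.
  + apply: lintZ; apply: lint_mulc lg => x; apply: continuous_comp; last exact: continuous_expR.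
    apply: continuous_comp; last exact: norm_continuous.
    exact: (ac_cont (ac_primE lg)).
  + move=> n t; rewrite (le_trans (rowsum _ _ (fun j => psum_bound n j t)))//.
    by rewrite mulrA.
  split=> // u v uv; have := dct u v; apply: cvg_unique => //.
  rewrite (_ : (fun n => _) = (fun n => psum n.+1 i v - psum n.+1 i u)); last first.
    by apply/funext => n; rewrite psum_int.
  by apply: cvgB; rewrite (cvg_shiftS (fun n => psum n i _)); exact: psum_cvg.
- move=> i; have H : (fun n => psum n i 0) @ \oo --> c i.
    rewrite -(cvg_shiftS (fun n => psum n i 0)) (_ : (fun n => _) = fun=> c i); first exact: cvg_cst.
    apply/funext => n; rewrite /psum seriesEnat /= big_nat_recl//= big1 ?addr0// => k _.
    exact: prim0.
  by rewrite /y (cvg_lim _ H).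
Qed.
End picard.
End linsys.

(** * Complex-valued absolutely continuous functions *)

Section cac.
Variable R : realType.
Local Notation C := R[i].
Implicit Types (x y : R) (z w : C).

Lemma reCD z w : reC (z + w) = reC z + reC w. Proof. by case: z w => ? ? []. Qed.
Lemma imCD z w : imC (z + w) = imC z + imC w. Proof. by case: z w => ? ? []. Qed.
Lemma reCN z : reC (- z) = - reC z. Proof. by case: z. Qed.
Lemma imCN z : imC (- z) = - imC z. Proof. by case: z. Qed.
Lemma reCM z w : reC (z * w) = reC z * reC w - imC z * imC w. Proof. by case: z w => ? ? []. Qed.
Lemma imCM z w : imC (z * w) = reC z * imC w + imC z * reC w. Proof. by case: z w => ? ? []. Qed.
Lemma reC_conj z : reC (conjc z) = reC z. Proof. by case: z. Qed.
Lemma imC_conj z : imC (conjc z) = - imC z. Proof. by case: z. Qed.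
Lemma reC_real x : reC x%:C = x. Proof. by []. Qed.
Lemma imC_real x : imC x%:C = 0. Proof. by []. Qed.
Lemma reC0 : reC (0 : C) = 0. Proof. by []. Qed.
Lemma imC0 : imC (0 : C) = 0. Proof. by []. Qed.
Lemma reC1 : reC (1 : C) = 1. Proof. by []. Qed.
Lemma imC1 : imC (1 : C) = 0. Proof. by []. Qed.

Lemma conjE z : Num.conj z = conjc z. Proof. by []. Qed.

Definition reimE := (reCD, imCD, reCN, imCN, reCM, imCM, reC_conj, imC_conj, conjE,
  reC_real, imC_real, reC0, imC0, reC1, imC1).

Lemma reim_inj z w : reC z = reC w -> imC z = imC w -> z = w.
Proof. by case: z w => ? ? [] ? ? /= -> ->. Qed.

Lemma csq_ge0 z : 0 <= csq z.
Proof. by rewrite addr_ge0 ?sqr_ge0. Qed.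

Lemma csqM z w : csq (z * w) = csq z * csq w.
Proof. by rewrite /csq !reimE; ring. Qed.

Lemma csqN z : csq (- z) = csq z.
Proof. by rewrite /csq !reimE; ring. Qed.

Lemma csq_conj z : csq (conjc z) = csq z.
Proof. by rewrite /csq !reimE; ring. Qed.

Lemma csq0 : csq (0 : C) = 0.
Proof. by rewrite /csq !reimE; ring. Qed.

Lemma csq1 : csq (1 : C) = 1.
Proof. by rewrite /csq !reimE; ring. Qed.

Lemma csq_eq0 z : (csq z == 0) = (z == 0).
Proof.
apply/idP/eqP => [|->]; last by rewrite csq0.
rewrite paddr_eq0 ?sqr_ge0// !sqrf_eq0 => /andP[/eqP a /eqP b].
exact: reim_inj.
Qed.

Lemma csq_gt0 z : (0 < csq z) = (z != 0).
Proof. by rewrite lt_def csq_ge0 andbT csq_eq0. Qed.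

Lemma csqD_le z w : csq (z + w) <= 2 * (csq z + csq w).
Proof.
rewrite /csq !reimE -subr_ge0.
rewrite [leRHS](_ : _ = (reC z - reC w) ^+ 2 + (imC z - imC w) ^+ 2); last by ring.
by rewrite addr_ge0 ?sqr_ge0.
Qed.

Lemma mulr_conj z : z * conjc z = (csq z)%:C.
Proof. by apply: reim_inj; rewrite /csq !reimE; ring. Qed.

Implicit Types u g v h : R -> C.
Definition cac u g := W11loc_with_deriv u g.

Lemma cacP u g : cac u g <->
  ac (fun x => reC (u x)) (fun x => reC (g x)) /\
  ac (fun x => imC (u x)) (fun x => imC (g x)).
Proof.
split=> [[lg ug]|[[lr ur] [li ui]]].
  split; split=> [a b|x y xy].
  - by case: (lg a b).
  - by have := congr1 (@reC R) (ug x y xy); rewrite !reimE.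
  - by case: (lg a b).
  - by have := congr1 (@imC R) (ug x y xy); rewrite !reimE.
split=> [a b|x y xy]; first by split; [exact: lr|exact: li].
by apply: reim_inj; rewrite !reimE ?ur ?ui.
Qed.

Lemma cac_ext u g u' g' : u =1 u' -> g =1 g' -> cac u g -> cac u' g'.
Proof. by move=> /funext <- /funext <-. Qed.

Lemma cacD u g v h : cac u g -> cac v h -> cac (fun x => u x + v x) (fun x => g x + h x).
Proof.
move=> /cacP[ur ui] /cacP[vr vi]; apply/cacP; split.
  by apply: ac_ext (acD ur vr) => x; rewrite reCD.
by apply: ac_ext (acD ui vi) => x; rewrite imCD.
Qed.

Lemma cacN u g : cac u g -> cac (fun x => - u x) (fun x => - g x).
Proof.
move=> /cacP[ur ui]; apply/cacP; split.
  by apply: ac_ext (acN ur) => x; rewrite reCN.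
by apply: ac_ext (acN ui) => x; rewrite imCN.
Qed.

Lemma cacB u g v h : cac u g -> cac v h -> cac (fun x => u x - v x) (fun x => g x - h x).
Proof. by move=> ug /cacN; exact: cacD. Qed.

Lemma cacM u g v h : cac u g -> cac v h ->
  cac (fun x => u x * v x) (fun x => g x * v x + u x * h x).
Proof.
move=> /cacP[ur ui] /cacP[vr vi]; apply/cacP; split.
  by apply: ac_ext (acB (acM ur vr) (acM ui vi)) => x; rewrite !reimE//; ring.
by apply: ac_ext (acD (acM ur vi) (acM ui vr)) => x; rewrite !reimE//; ring.
Qed.

Lemma cac_cst c : cac (fun=> c) (fun=> 0).
Proof. by apply/cacP; split; exact: ac_cst. Qed.

Lemma cacZ c u g : cac u g -> cac (fun x => c * u x) (fun x => c * g x).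
Proof.
move=> /(cacM (cac_cst c)); apply: cac_ext => // x.
by rewrite mul0r add0r.
Qed.

Lemma cac_conj u g : cac u g -> cac (fun x => conjc (u x)) (fun x => conjc (g x)).
Proof.
move=> /cacP[ur ui]; apply/cacP; split.
  by apply: ac_ext ur => x; rewrite reC_conj.
by apply: ac_ext (acN ui) => x; rewrite imC_conj.
Qed.

Lemma cac_shift u g c : cac u g -> cac (fun x => u (x + c)) (fun x => g (x + c)).
Proof. by move=> /cacP[ur ui]; apply/cacP; split; [exact: (ac_shift c ur)|exact: (ac_shift c ui)]. Qed.

Lemma cac_const u g : cac u g -> (forall t, g t = 0) -> forall x y, u x = u y.
Proof.
move=> /cacP[ur ui] g0 x y; apply: reim_inj.
  by apply: (ac_const ur) => t; rewrite g0.
by apply: (ac_const ui) => t; rewrite g0.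
Qed.

Lemma cac_cont u g : cac u g -> continuous (fun x => reC (u x)) /\ continuous (fun x => imC (u x)).
Proof. by move=> /cacP[/ac_cont ? /ac_cont ?]. Qed.

Lemma csq_cont u : continuous (fun x => reC (u x)) -> continuous (fun x => imC (u x)) ->
  continuous (fun x => csq (u x)).
Proof.
move=> cr ci x.
apply: (@continuousD _ _ _ (fun x => reC (u x) ^+ 2) (fun x => imC (u x) ^+ 2)).
  exact: (@exprn_continuous' _ _ 2 cr x).
exact: (@exprn_continuous' _ _ 2 ci x).
Qed.

Lemma cac_csq u g : cac u g -> continuous (fun x => csq (u x)).
Proof. by move=> /cac_cont[cr ci]; exact: csq_cont. Qed.

End cac.

(** * The quasi-differential equation as a first-order system *)

Section sol.
Variables (R : realType) (Q : R -> R).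
Local Notation C := R[i].
Implicit Types (x y : R) (z w : C) (u v g h : R -> C).
Hypotheses (mQ : measurable_fun setT Q) (lQ2 : lint (fun x => Q x ^+ 2)).

Let lQ : lint Q. Proof. exact: lint_sqrt. Qed.

                                                                    
(** With u1 = u' - Qu this system says l_Q[u] = z u + g; the distribution q = Q' itself never
    occurs. *)
Definition sol z u u1 g :=
  cac u (fun x => u1 x + (Q x)%:C * u x) /\
  cac u1 (fun x => - (Q x)%:C ^+ 2 * u x - (Q x)%:C * u1 x - z * u x - g x).

Lemma solD z u u1 g v v1 h : sol z u u1 g -> sol z v v1 h ->
  sol z (fun x => u x + v x) (fun x => u1 x + v1 x) (fun x => g x + h x).
Proof.
move=> [a b] [c d]; split.
  by apply: cac_ext (cacD a c) => x //; ring.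
by apply: cac_ext (cacD b d) => x //; ring.
Qed.

Lemma solZ c z u u1 g : sol z u u1 g ->
  sol z (fun x => c * u x) (fun x => c * u1 x) (fun x => c * g x).
Proof.
move=> [a b]; split.
  by apply: cac_ext (cacZ c a) => x //; ring.
by apply: cac_ext (cacZ c b) => x //; ring.
Qed.

Lemma solB z u u1 g v v1 h : sol z u u1 g -> sol z v v1 h ->
  sol z (fun x => u x - v x) (fun x => u1 x - v1 x) (fun x => g x - h x).
Proof.
move=> [a b] [c d]; split.
  by apply: cac_ext (cacB a c) => x //; ring.
by apply: cac_ext (cacB b d) => x //; ring.
Qed.

Lemma sol_ext z u u1 g u' u1' g' : u =1 u' -> u1 =1 u1' -> g =1 g' ->
  sol z u u1 g -> sol z u' u1' g'.
Proof. by move=> /funext <- /funext <- /funext <-. Qed.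

(** All terms containing Q cancel in the derivative of the quasi-Wronskian. Most later arguments
    integrate this identity for a suitable second solution. *)
Lemma sol_lagrange z z' u u1 g v v1 h : sol z u u1 g -> sol z' v v1 h ->
  cac (fun x => u x * v1 x - u1 x * v x)
      (fun x => (z - z') * u x * v x + g x * v x - u x * h x).
Proof.
move=> [a b] [c d].
by apply: cac_ext (cacB (cacM a d) (cacM b c)) => x //; ring.
Qed.

Lemma sol_conj z u u1 g : sol z u u1 g ->
  sol (conjc z) (fun x => conjc (u x)) (fun x => conjc (u1 x)) (fun x => conjc (g x)).
Proof.
move=> [a b]; split.
  apply: cac_ext (cac_conj a) => x //.
  by apply: reim_inj; rewrite !reimE; ring.
apply: cac_ext (cac_conj b) => x //.
by apply: reim_inj; rewrite !expr2 !reimE; ring.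
Qed.

Lemma sol_shift (c : R) z u u1 g : (forall x, Q (x + c) = Q x) -> sol z u u1 g ->
  sol z (fun x => u (x + c)) (fun x => u1 (x + c)) (fun x => g (x + c)).
Proof.
move=> Qc [/(cac_shift c) a /(cac_shift c) b]; split.
  by apply: cac_ext a => x //; rewrite Qc.
by apply: cac_ext b => x //; rewrite Qc.
Qed.

                                                                                                  
                                                             
(** The complex 2 by 2 system written as a real 4 by 4 one: the first boolean of an index marks the
    quasi-derivative, the second the imaginary part. *)
Definition sol_coef z (i j : bool * bool) (x : R) : R :=
  match i, j with
  | (false, false), (false, false) => Q x
  | (false, false), (true, false) => 1
  | (false, true), (false, true) => Q x
  | (false, true), (true, true) => 1
  | (true, false), (false, false) => - Q x ^+ 2 - reC z
  | (true, false), (false, true) => imC z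
  | (true, false), (true, false) => - Q x
  | (true, true), (false, true) => - Q x ^+ 2 - reC z
  | (true, true), (false, false) => - imC z
  | (true, true), (true, true) => - Q x
  | _, _ => 0
  end.

Lemma lint_sol_coef z i j : lint (sol_coef z i j).
Proof.
move: i j => [[] []] [[] []] /=; rewrite /sol_coef; try exact: lint_cst; try exact: lQ;
 try exact: (lintN lQ); try by apply: lintB; [exact: (lintN lQ2)|exact: lint_cst].
Qed.

(** Increased by 2|Re z| + 2|Im z|, this majorises the sum of the moduli of all sixteen
    coefficients. *)
Definition sol_rate x := 2 + 4 * `|Q x| + 2 * Q x ^+ 2.

Lemma lint_sol_rate : lint sol_rate.
Proof.
apply: lintD; last exact: lintZ.
by apply: lintD; [exact: lint_cst|apply: lintZ; exact: lint_norm].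
Qed.

Lemma big_bool2 (F : bool * bool -> R) :
  \sum_i F i = F (true, true) + F (true, false) + (F (false, true) + F (false, false)).
Proof.
rewrite (eq_bigr (fun p => F (p.1, p.2))); last by case.
by rewrite -(pair_bigA _ (fun a b => F (a, b))) /= !big_bool.
Qed.

Definition sol_bound z : R := expR (itg sol_rate 0 1 + 2 * `|reC z| + 2 * `|imC z|).

Lemma hsol_ex z c c1 : exists p : (R -> C) * (R -> C),
  [/\ sol z p.1 p.2 (fun=> 0), p.1 0 = c, p.2 0 = c1 &
   let N := `|reC c| + `|imC c| + `|reC c1| + `|imC c1| in
   forall x, 0 <= x <= 1 ->
   [/\ `|reC (p.1 x)| <= N * sol_bound z, `|imC (p.1 x)| <= N * sol_bound z,
      `|reC (p.2 x)| <= N * sol_bound z & `|imC (p.2 x)| <= N * sol_bound z] ].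
Proof.
pose c0 (i : bool * bool) : R := match i with
  (false, false) => reC c | (false, true) => imC c
 | (true, false) => reC c1 | (true, true) => imC c1 end.
have [w [wac w0 wb]] := picard_sol c0 (lint_sol_coef z).
exists (fun x => (w (false, false) x) +i* (w (false, true) x),
   fun x => (w (true, false) x) +i* (w (true, true) x)); split.
- split; apply/cacP; split.
  + by apply: ac_ext (wac (false, false)) => x; rewrite ?big_bool2 ?reimE /=; ring.
  + by apply: ac_ext (wac (false, true)) => x; rewrite ?big_bool2 ?reimE /=; ring.
  + by apply: ac_ext (wac (true, false)) => x; rewrite ?big_bool2 ?expr2 ?reimE /=; ring.
  + by apply: ac_ext (wac (true, true)) => x; rewrite ?big_bool2 ?expr2 ?reimE /=; ring.
- by apply: reim_inj => /=; rewrite w0.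
- by apply: reim_inj => /=; rewrite w0.
move=> N x /andP[x0 x1].
have K i : `|w i x| <= N * sol_bound z.
  rewrite (le_trans (wb i x))// big_bool2 /= /N.
  rewrite [X in X * _ <= _](_ : _ = N); last by rewrite /N; ring.
  rewrite ler_wpM2l ?ler_expR//; first by rewrite /N !addr_ge0.
  rewrite /prim x0 ger0_norm; last first.
    by apply: itg_ge0 => t _; apply: sumr_ge0 => ? _; apply: sumr_ge0.
  have <- : itg (fun t => sol_rate t + (2 * `|reC z| + 2 * `|imC z|)) 0 1 =
     itg sol_rate 0 1 + 2 * `|reC z| + 2 * `|imC z|.
    rewrite itgD ?itg_cst//; [by ring|exact: lint_sol_rate|exact: lint_cst].
  have lS : lint (fun t => \sum_i0 \sum_j `|sol_coef z i0 j t|).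
    by apply: lint_sum => a; apply: lint_sum => b; apply: lint_norm; exact: lint_sol_coef.
  have lT : lint (fun t => sol_rate t + (2 * `|reC z| + 2 * `|imC z|)).
    by apply: lintD; [exact: lint_sol_rate|exact: lint_cst].
  apply: (@le_trans _ _ (itg (fun t => \sum_i0 \sum_j `|sol_coef z i0 j t|) 0 1)).
    apply: itg_ge => // t; by apply: sumr_ge0 => ? _; apply: sumr_ge0.
  apply: le_itg => // t _; rewrite big_bool2 !big_bool2 /= !normr0 !normr1 !normrN.
  have := ler_normD (- Q t ^+ 2) (- reC z); rewrite !normrN (ger0_norm (sqr_ge0 _)).
  by rewrite /sol_rate; lra.
by split; exact: (K (_, _)).
Qed.
End sol.

                          

(** * Fundamental solutions, monodromy matrix and Floquet solutions *)

Section floquet.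
Variables (R : realType) (Q : R -> R).
Local Notation C := R[i].
Implicit Types (x y : R) (z w : C) (u v g h : R -> C).
Hypotheses (mQ : measurable_fun setT Q) (lQ2 : lint (fun x => Q x ^+ 2)).

Let lQ : lint Q. Proof. exact: lint_sqrt. Qed.

Definition hsol z u u1 := sol Q z u u1 (fun=> 0).

Lemma cac_re u g x y : cac u g -> x <= y ->
  reC (u y) - reC (u x) = itg (fun t => reC (g t)) x y.
Proof. by move=> /cacP[[_ ur] _]; exact: ur. Qed.

Lemma cac_im u g x y : cac u g -> x <= y ->
  imC (u y) - imC (u x) = itg (fun t => imC (g t)) x y.
Proof. by move=> /cacP[_ [_ ui]]; exact: ui. Qed.

Lemma cac_const_on u g x y : cac u g -> x <= y ->
  (forall t, x <= t <= y -> g t = 0) -> u y = u x.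
Proof.
move=> ug xy g0; apply: reim_inj; apply/eqP; rewrite -subr_eq0.
  by rewrite (cac_re ug)// (@eq_itg _ _ (fun=> 0)) ?itg_cst ?mul0r// => t /g0 ->.
by rewrite (cac_im ug)// (@eq_itg _ _ (fun=> 0)) ?itg_cst ?mul0r// => t /g0 ->.
Qed.

Lemma homD z u u1 v v1 : hsol z u u1 -> hsol z v v1 ->
  hsol z (fun x => u x + v x) (fun x => u1 x + v1 x).
Proof. by move=> /solD H /H; apply: sol_ext => // x; rewrite addr0. Qed.

Lemma homZ c z u u1 : hsol z u u1 -> hsol z (fun x => c * u x) (fun x => c * u1 x).
Proof. by move=> /(solZ c); apply: sol_ext => // x; rewrite mulr0. Qed.

Lemma homB z u u1 v v1 : hsol z u u1 -> hsol z v v1 ->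
  hsol z (fun x => u x - v x) (fun x => u1 x - v1 x).
Proof. by move=> /solB H /H; apply: sol_ext => // x; rewrite subr0. Qed.

Lemma wronsk_const z u u1 v v1 x y : hsol z u u1 -> hsol z v v1 ->
  u x * v1 x - u1 x * v x = u y * v1 y - u1 y * v y.
Proof.
move=> hu hv; apply: (cac_const (sol_lagrange hu hv)) => t.
by rewrite subrr !mul0r mulr0 addr0 subr0.
Qed.

Definition fund z c c1 := sval (cid (hsol_ex mQ lQ2 z c c1)).
(** [th] and [ph] are the solutions with Cauchy data (1,0) and (0,1), and a suffix 1 marks the
    quasi-derivative. Their values at 1 are the entries of the monodromy matrix. *)
Definition th z := (fund z 1 0).1.
Definition th1 z := (fund z 1 0).2.
Definition ph z := (fund z 0 1).1.
Definition ph1 z := (fund z 0 1).2.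

Lemma th_hom z : hsol z (th z) (th1 z).
Proof. by rewrite /th /th1 /fund; case: cid => p []. Qed.
Lemma ph_hom z : hsol z (ph z) (ph1 z).
Proof. by rewrite /ph /ph1 /fund; case: cid => p []. Qed.
Lemma th0 z : th z 0 = 1. Proof. by rewrite /th /fund; case: cid => p []. Qed.
Lemma th10 z : th1 z 0 = 0. Proof. by rewrite /th1 /fund; case: cid => p []. Qed.
Lemma ph0 z : ph z 0 = 0. Proof. by rewrite /ph /fund; case: cid => p []. Qed.
Lemma ph10 z : ph1 z 0 = 1. Proof. by rewrite /ph1 /fund; case: cid => p []. Qed.

Lemma fund_bound z c c1 x : 0 <= x <= 1 ->
  let N := `|reC c| + `|imC c| + `|reC c1| + `|imC c1| in
  `|reC ((fund z c c1).1 x)| <= N * sol_bound Q z /\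
  `|reC ((fund z c c1).2 x)| <= N * sol_bound Q z.
Proof. by move=> x01; rewrite /fund; case: cid => p [_ _ _ /= /(_ _ x01)[a _ b _]]. Qed.

Lemma th_bound z x : 0 <= x <= 1 -> [/\ `|reC (th z x)| <= sol_bound Q z,
  `|reC (th1 z x)| <= sol_bound Q z, `|reC (ph z x)| <= sol_bound Q z &
  `|reC (ph1 z x)| <= sol_bound Q z].
Proof.
move=> x01; have := fund_bound z 1 0 x01; have := fund_bound z 0 1 x01.
rewrite /= normr1 !normr0 !addr0 !add0r mul1r => -[a b] [c d].
by split.
Qed.

Lemma fund_wronsk z x : th z x * ph1 z x - th1 z x * ph z x = 1.
Proof.
rewrite (wronsk_const x 0 (th_hom z) (ph_hom z)).
by rewrite th0 th10 ph10 ph0 mulr1 mulr0 subr0.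
Qed.

(** The Wronskians of u with [th] and [ph] are constant, so they can be read off at 0; solving the
    two relations at x by Cramer's rule, with determinant one, gives the formulas. *)
Lemma hsol_repr z u u1 x : hsol z u u1 ->
  u x = u 0 * th z x + u1 0 * ph z x /\ u1 x = u 0 * th1 z x + u1 0 * ph1 z x.
Proof.
move=> hu; have A := wronsk_const x 0 hu (ph_hom z).
have B := wronsk_const x 0 hu (th_hom z); have D := fund_wronsk z x.
move: A B; rewrite th0 th10 ph0 ph10 !mulr1 !mulr0 subr0 sub0r => A B.
have -> : u1 0 = - (u x * th1 z x - u1 x * th z x) by rewrite B opprK.
rewrite -A; split.
  by rewrite -[LHS]mulr1 -D; ring.
by rewrite -[LHS]mulr1 -D; ring.
Qed.

Lemma hsol_zero z u u1 x0 x : hsol z u u1 -> u x0 = 0 -> u1 x0 = 0 -> u x = 0 /\ u1 x = 0.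
Proof.
move=> hu ux u1x; have A := wronsk_const x0 0 hu (ph_hom z).
have B := wronsk_const x0 0 hu (th_hom z).
move: A B; rewrite ux u1x th0 th10 ph0 ph10 !mulr1 !mulr0 !mul0r subr0 sub0r => A B.
have [-> ->] := hsol_repr x hu; move: A; rewrite subr0 => <-.
have -> : u1 0 = 0 by apply/eqP; rewrite -oppr_eq0 -B.
by rewrite !mul0r addr0.
Qed.

(** Between x and y the source vanishes, so the Wronskian of u with each homogeneous solution keeps
    the value 0 that it has at x; two independent homogeneous solutions then determine u and u1 at
    y. *)
Lemma sol_zero_on z u u1 g x y : sol Q z u u1 g -> u x = 0 -> u1 x = 0 ->
  (forall t, Num.min x y <= t <= Num.max x y -> g t = 0) -> u y = 0 /\ u1 y = 0.
Proof.
move=> su ux u1x g0.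
have W v v1 : hsol z v v1 -> u y * v1 y - u1 y * v y = 0.
  move=> hv; have L := sol_lagrange su hv.
  have := cac_const_on L; have [xy|/ltW yx] := leP x y.
    move=> /(_ _ _ xy) ->; first by rewrite ux u1x !mul0r subrr.
    by move=> t txy; rewrite subrr g0 ?(min_idPl xy) ?(max_idPr xy)// !mul0r mulr0 addr0 subr0.
  move=> /(_ _ _ yx) <-; first by rewrite ux u1x !mul0r subrr.
  by move=> t txy; rewrite subrr g0 ?(min_idPr yx) ?(max_idPl yx)// !mul0r mulr0 addr0 subr0.
have A := W _ _ (ph_hom z); have B := W _ _ (th_hom z); have D := fund_wronsk z y.
split.
  rewrite -[LHS]mulr1 -D [LHS](_ : _ = th z y * (u y * ph1 z y - u1 y * ph z y)
    - ph z y * (u y * th1 z y - u1 y * th z y)); last by ring.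
  by rewrite A B !mulr0 subrr.
rewrite -[LHS]mulr1 -D [LHS](_ : _ = th1 z y * (u y * ph1 z y - u1 y * ph z y)
    - ph1 z y * (u y * th1 z y - u1 y * th z y)); last by ring.
by rewrite A B !mulr0 subrr.
Qed.

Lemma itg_csq_ge0 u x y : 0 <= itg (fun t => csq (u t)) x y.
Proof. by apply: itg_ge0 => t _; exact: csq_ge0. Qed.

Lemma itg_csq_eq0 u x y : continuous (fun t => csq (u t)) -> x < y ->
  itg (fun t => csq (u t)) x y <= 0 -> forall t, x <= t <= y -> u t = 0.
Proof.
move=> cu xy I0 t txy; apply/eqP; rewrite -csq_eq0; apply/negP => /negP u0.
suff : 0 < itg (fun t => csq (u t)) x y by rewrite ltNge I0.
apply: (itg_gt0 cu (fun t => csq_ge0 _) xy txy).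
by rewrite lt_def u0 csq_ge0.
Qed.

(** Once u = 0 on the interval, the derivative of u times the conjugate of u1 reduces there to
    |u1|^2, while this product vanishes at both ends. So u1 = 0 on the interval as well, and
    uniqueness carries the zero everywhere. *)
Lemma hsol_itg_eq0 z u u1 x y : hsol z u u1 -> x < y ->
  itg (fun t => csq (u t)) x y <= 0 -> forall t, u t = 0 /\ u1 t = 0.
Proof.
move=> hu xy I0; have [a b] := hu.
have u0 := itg_csq_eq0 (cac_csq a) xy I0.
have := cacM a (cac_conj b) => H.
have u10 : forall t, x <= t <= y -> u1 t = 0.
  apply: (itg_csq_eq0 (cac_csq b) xy).
  rewrite (@eq_itg _ _ (fun t => reC ((u1 t + (Q t)%:C * u t) * conjc (u1 t) +
         u t *
         conjc (- (Q t)%:C ^+ 2 * u t - (Q t)%:C * u1 t - z * u t - 0)))).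
    have ux : u x = 0 by apply: u0; rewrite lexx ltW.
    have uy : u y = 0 by apply: u0; rewrite lexx ltW.
    have := cac_re H (ltW xy); rewrite ux uy !mul0r subrr => <-.
    exact: lexx.
  by move=> t txy; rewrite u0// mul0r !mulr0 !addr0 mulr_conj.
by move=> t; apply: (hsol_zero t hu (x0 := x)); rewrite ?u0 ?u10 ?lexx ?ltW.
Qed.

Hypothesis perQ : forall x, Q (x + 1) = Q x.

Lemma hsol_shift z u u1 : hsol z u u1 -> hsol z (fun x => u (x + 1)) (fun x => u1 (x + 1)).
Proof. by move=> /(sol_shift perQ). Qed.

(** The Hill discriminant, that is, the trace of the monodromy matrix. *)
Definition Delta z := th z 1 + ph1 z 1.

Lemma th_shift z x : th z (x + 1) = th z 1 * th z x + th1 z 1 * ph z x /\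
  th1 z (x + 1) = th z 1 * th1 z x + th1 z 1 * ph1 z x.
Proof. by have := hsol_repr x (hsol_shift (th_hom z)); rewrite /= add0r. Qed.

Lemma ph_shift z x : ph z (x + 1) = ph z 1 * th z x + ph1 z 1 * ph z x /\
  ph1 z (x + 1) = ph z 1 * th1 z x + ph1 z 1 * ph1 z x.
Proof. by have := hsol_repr x (hsol_shift (ph_hom z)); rewrite /= add0r. Qed.

(** This is the Cayley-Hamilton identity for a monodromy matrix of determinant one. *)
Lemma hsol_rec z u u1 x : hsol z u u1 -> u (x + 1 + 1) = Delta z * u (x + 1) - u x.
Proof.
move=> hu; have [-> _] := hsol_repr (x + 1 + 1) hu; have [-> _] := hsol_repr (x + 1) hu.
have [-> _] := hsol_repr x hu.
have [-> _] := th_shift z (x + 1); have [-> _] := ph_shift z (x + 1).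
have [-> _] := th_shift z x; have [-> _] := ph_shift z x.
have D := fund_wronsk z 1; rewrite /Delta.
rewrite -[X in _ = _ - X]mulr1 -D; ring.
Qed.

(** The hypothesis is the characteristic equation of the monodromy matrix, and an eigenvector (a,b)
    of that matrix provides the Cauchy data at 0. *)
Lemma floquet z rho : rho ^+ 2 - Delta z * rho + 1 = 0 -> exists p p1,
  [/\ hsol z p p1, forall x, p (x + 1) = rho * p x, forall x, p1 (x + 1) = rho * p1 x &
    ~ (p 0 = 0 /\ p1 0 = 0)].
Proof.
move=> rE; have D := fund_wronsk z 1.
suff [a [b [E1 E2 ab]]] : exists a b, [/\ a * th z 1 + b * ph z 1 = rho * a,
    a * th1 z 1 + b * ph1 z 1 = rho * b & ~ (a = 0 /\ b = 0)].
  exists (fun x => a * th z x + b * ph z x), (fun x => a * th1 z x + b * ph1 z x).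
  split.
  - by apply: homD; apply: homZ; [exact: th_hom|exact: ph_hom].
  - move=> x; have [-> _] := th_shift z x; have [-> _] := ph_shift z x.
    rewrite [RHS](_ : _ = (rho * a) * th z x + (rho * b) * ph z x); last by ring.
    by rewrite -E1 -E2; ring.
  - move=> x; have [_ ->] := th_shift z x; have [_ ->] := ph_shift z x.
    rewrite [RHS](_ : _ = (rho * a) * th1 z x + (rho * b) * ph1 z x); last by ring.
    by rewrite -E1 -E2; ring.
  - by rewrite th0 ph0 th10 ph10 !mulr1 !mulr0 addr0 add0r.
have K : (rho - th z 1) * (rho - ph1 z 1) = th1 z 1 * ph z 1.
  apply/eqP; rewrite -subr_eq0; apply/eqP.
  by rewrite -rE /Delta -D; ring.
(* A nonzero off-diagonal entry gives an eigenvector directly; if both are zero the matrix is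
   diagonal and a coordinate vector serves. *)
have [m12|m12] := eqVneq (ph z 1) 0; last first.
  exists (ph z 1), (rho - th z 1); split; [by ring| |by move=> [/eqP]; rewrite (negbTE m12)].
  apply/eqP; rewrite -subr_eq0; apply/eqP; rewrite [LHS](_ : _ =
    th1 z 1 * ph z 1 - (rho - th z 1) * (rho - ph1 z 1)); last by ring.
  by rewrite K subrr.
have [m21|m21] := eqVneq (th1 z 1) 0; last first.
  exists (rho - ph1 z 1), (th1 z 1); split; [|by ring|by move=> [_ /eqP]; rewrite (negbTE m21)].
  apply/eqP; rewrite -subr_eq0; apply/eqP; rewrite [LHS](_ : _ =
    th1 z 1 * ph z 1 - (rho - th z 1) * (rho - ph1 z 1)); last by ring.
  by rewrite K subrr.
move: K; rewrite m12 m21 mulr0 => /eqP; rewrite mulf_eq0 !subr_eq0 => /orP[]/eqP E.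
  by exists 1, 0; split; rewrite ?E ?mul1r ?mulr1 ?mul0r ?mulr0 ?addr0// => -[/eqP]; rewrite oner_eq0.
by exists 0, 1; split; rewrite ?E ?mul1r ?mulr1 ?mul0r ?mulr0 ?add0r// => -[_ /eqP]; rewrite oner_eq0.
Qed.

(** The two roots have product one, so they cannot both lie outside the closed unit disc. *)
Lemma multiplier z : exists rho, rho ^+ 2 - Delta z * rho + 1 = 0 /\ csq rho <= 1.
Proof.
have [s sE] : exists s : C, s ^+ 2 = Delta z ^+ 2 - 4.
  by exists (sqrtc (Delta z ^+ 2 - 4)); rewrite sqr_sqrtc.
pose r1 := (Delta z + s) / 2; pose r2 := (Delta z - s) / 2.
have r12 : r1 * r2 = 1.
  rewrite /r1 /r2 [LHS](_ : _ = (Delta z ^+ 2 - s ^+ 2) / 4).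
    by rewrite sE opprB addrC subrK divff// pnatr_eq0.
  by field.
have E1 : r1 ^+ 2 - Delta z * r1 + 1 = 0 by rewrite -r12 /r1 /r2; field.
have E2 : r2 ^+ 2 - Delta z * r2 + 1 = 0 by rewrite -r12 /r1 /r2; field.
have [c1|c1] := leP (csq r1) 1; first by exists r1.
exists r2; split=> //; have := csqM r1 r2; rewrite r12 csq1 => c12.
have := csq_ge0 r2; nra.
Qed.

(** The masses of |u|^2 on successive unit windows do not decrease, so n windows carry at least n
    times the first mass; a uniform bound forces that mass to be zero. *)
Lemma quasi_right u kap a B : continuous (fun t => csq (u t)) ->
  (forall x, a <= x -> u (x + 1) = kap * u x) -> 1 <= csq kap ->
  (forall y, a <= y -> itg (fun t => csq (u t)) a y <= B) -> forall x, a <= x -> u x = 0.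
Proof.
move=> cu uk k1 uB x0 ax0; have lu := lint_cont cu.
have cg0 t : 0 <= csq (u t) by exact: csq_ge0.
pose A := itg (fun t => csq (u t)) x0 (x0 + 1).
have xn n : a <= x0 + n%:R by rewrite (le_trans ax0)// lerDl.
have An n : A <= itg (fun t => csq (u t)) (x0 + n%:R) (x0 + n%:R + 1).
  elim: n => [|n IH]; first by rewrite addr0.
  rewrite (le_trans IH)// -natr1 addrA.
  have [_ <-] := itg_shift 1 (x0 + n%:R) (x0 + n%:R + 1) lu.
  have cu1 : lint (fun t => csq (u (t + 1))) by have [] := itg_shift 1 0 0 lu.
  apply: le_itg => // t /andP[xt _]; rewrite uk ?(le_trans (xn n))// csqM.
  by rewrite ler_peMl.
have AN n : n%:R * A <= itg (fun t => csq (u t)) x0 (x0 + n%:R).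
  elim: n => [|n IH]; first by rewrite mul0r addr0 itgxx.
  rewrite -natr1 addrA (@itg_split _ _ x0 (x0 + n%:R)) ?lerDl//.
  by rewrite mulrDl mul1r lerD.
have nB n : n%:R * A <= B.
  rewrite (le_trans (AN n))// (le_trans _ (uB (x0 + n%:R) _))//.
  by apply: itg_ge => //; rewrite lerDl.
suff A0 : A <= 0.
  by apply: (itg_csq_eq0 cu _ A0); rewrite ?lexx ?ltrDl ?lerDl ?ltr01 ?ler01.
rewrite leNgt; apply/negP => A0.
have := nB (Num.truncn (B / A)).+1; rewrite -ler_pdivlMr// leNgt truncnS_gt//.
Qed.

Lemma quasi_left u kap a B : continuous (fun t => csq (u t)) ->
  (forall x, x + 1 <= a -> u (x + 1) = kap * u x) -> csq kap <= 1 ->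
  (forall y, y <= a -> itg (fun t => csq (u t)) y a <= B) -> forall x, x <= a -> u x = 0.
Proof.
move=> cu uk k1 uB x0 ax0; have lu := lint_cont cu.
have cg0 t : 0 <= csq (u t) by exact: csq_ge0.
pose A := itg (fun t => csq (u t)) (x0 - 1) x0.
have xn n : x0 - n%:R <= a by rewrite (le_trans _ ax0)// gerBl.
have An n : A <= itg (fun t => csq (u t)) (x0 - n%:R - 1) (x0 - n%:R).
  elim: n => [|n IH]; first by rewrite subr0.
  rewrite (le_trans IH)// -natr1 opprD addrA.
  have [_] := itg_shift 1 (x0 - n%:R - 1 - 1) (x0 - n%:R - 1) lu.
  rewrite !subrK => <-.
  have cu1 : lint (fun t => csq (u (t + 1))) by have [] := itg_shift 1 0 0 lu.
  apply: le_itg => // t /andP[_ xt]; rewrite uk ?csqM; last first.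
    by rewrite (le_trans _ (xn n))// -lerBrDr.
  by rewrite ler_piMl.
have AN n : n%:R * A <= itg (fun t => csq (u t)) (x0 - n%:R) x0.
  elim: n => [|n IH]; first by rewrite mul0r subr0 itgxx.
  rewrite -natr1 opprD addrA (@itg_split _ _ _ (x0 - n%:R)) ?gerBl//.
  by rewrite mulrDl mul1r [leRHS]addrC lerD// An.
have nB n : n%:R * A <= B.
  rewrite (le_trans (AN n))// (le_trans _ (uB (x0 - n%:R) _))//.
  by apply: itg_ge => //; rewrite gerBl.
suff A0 : A <= 0.
  by apply: (itg_csq_eq0 cu _ A0); rewrite ?lexx ?gtrBl ?gerBl ?ltr01 ?ler01.
rewrite leNgt; apply/negP => A0.
have := nB (Num.truncn (B / A)).+1; rewrite -ler_pdivlMr// leNgt truncnS_gt//.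
Qed.
End floquet.

(** * The operator on the line: no eigenvalues, and unimodular multipliers *)

Section spectrum.
Variables (R : realType) (Q : R -> R).
Local Notation C := R[i].
Local Notation mu := (@lebesgue_measure R).
Implicit Types (x y : R) (z w : C) (u v g h : R -> C).
Hypotheses (mQ : measurable_fun setT Q) (lQ2 : lint (fun x => Q x ^+ 2)).
Hypothesis perQ : forall x, Q (x + 1) = Q x.
Local Notation th := (th mQ lQ2).
Local Notation th1 := (th1 mQ lQ2).
Local Notation ph := (ph mQ lQ2).
Local Notation ph1 := (ph1 mQ lQ2).
Local Notation Delta := (Delta mQ lQ2).
Local Notation hsol := (hsol Q).

Local Notation cmeas := (cmeasurable setT).

Lemma cmeasD u v : cmeas u -> cmeas v -> cmeas (fun x => u x + v x).
Proof.
move=> [ur ui] [vr vi]; split.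
  by under eq_fun do rewrite reCD; exact: measurable_funD.
by under eq_fun do rewrite imCD; exact: measurable_funD.
Qed.

Lemma cmeasN u : cmeas u -> cmeas (fun x => - u x).
Proof.
move=> [ur ui]; split.
  by under eq_fun do rewrite reCN; exact: measurableT_comp.
by under eq_fun do rewrite imCN; exact: measurableT_comp.
Qed.

Lemma cmeasB u v : cmeas u -> cmeas v -> cmeas (fun x => u x - v x).
Proof. by move=> mu' /cmeasN; exact: cmeasD. Qed.

Lemma cmeasM u v : cmeas u -> cmeas v -> cmeas (fun x => u x * v x).
Proof.
move=> [ur ui] [vr vi]; split.
  under eq_fun do rewrite reCM.
  by apply: measurable_funB; exact: measurable_funM.
under eq_fun do rewrite imCM.
by apply: measurable_funD; exact: measurable_funM.
Qed.

Lemma cmeas_real (f : R -> R) : measurable_fun setT f -> cmeas (fun x => (f x)%:C).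
Proof. by move=> mf; split => //; exact: measurable_cst. Qed.

Lemma cmeas_cst (c : C) : cmeas (fun=> c).
Proof. by split; exact: measurable_cst. Qed.

Lemma cac_meas u g : cac u g -> cmeas u.
Proof. by move=> /cac_cont[cr ci]; split; exact: continuous_measurable_fun. Qed.

Lemma cac_ae u g h : cac u g -> cmeas h -> {ae mu, forall x, g x = h x} -> cac u h.
Proof.
move=> /cacP[ur ui] [hr hi] gh; apply/cacP; split.
  by apply: (ac_ae ur hr); apply: ae_sub gh => x ->.
by apply: (ac_ae ui hi); apply: ae_sub gh => x ->.
Qed.

(** The operator relation holds only almost everywhere; changing the integrand of u1 on a null set
    turns it into an exact solution of the system. *)
Lemma graph_sol u f z g : S_graph Q u f -> cmeas g ->
  {ae mu, forall x, f x - z * u x = g x} -> exists u1, sol Q z u u1 g.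
Proof.
move=> [_ [_ [u1 [w [a [b fE]]]]]] mg fg; exists u1; split => //.
have mu' := cac_meas a; have mu1 := cac_meas b; have mQ' := cmeas_real mQ.
apply: (cac_ae b).
  apply: cmeasB => //; apply: cmeasB; last by apply: cmeasM => //; exact: cmeas_cst.
  apply: cmeasB; last exact: cmeasM.
  by apply: cmeasM => //; apply: cmeasN; rewrite /GRing.exp /=; apply: cmeasM.
apply: ae_sub (ae_and fE fg) => x [fx gx].
rewrite -gx fx rmorphXn /=; ring.
Qed.

Lemma cL2_le u (h : R -> R) : cmeas u -> mu.-integrable setT (EFin \o h) ->
  (forall x, csq (u x) <= h x) -> cL2 setT u.
Proof.
move=> [ur ui] ih uh; split => //.
apply: (le_integrable _ _ _ ih) => //.
  apply/measurable_EFinP; apply: measurable_funD; exact: measurable_funX.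
move=> x _ /=; rewrite lee_fin !ger0_norm ?csq_ge0//.
by rewrite (le_trans _ (uh x))// csq_ge0.
Qed.

Lemma cL2D u v : cL2 setT u -> cL2 setT v -> cL2 setT (fun x => u x + v x).
Proof.
move=> [mu' iu] [mv iv].
apply: (@cL2_le _ (fun x => 2 * (csq (u x) + csq (v x)))); first exact: cmeasD.
  exact: (integrableZl measurableT 2 (integrableD measurableT iu iv)).
by move=> x; exact: csqD_le.
Qed.

Lemma cL2Z c u : cL2 setT u -> cL2 setT (fun x => c * u x).
Proof.
move=> [mu' iu].
apply: (@cL2_le _ (fun x => csq c * csq (u x))).
- by apply: cmeasM => //; exact: cmeas_cst.
- exact: (integrableZl measurableT (csq c) iu).
- by move=> x; rewrite csqM.
Qed.

Lemma cL2B u v : cL2 setT u -> cL2 setT v -> cL2 setT (fun x => u x - v x).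
Proof.
move=> Lu /(cL2Z (-1)) Lv; rewrite (_ : (fun x => _) = fun x => u x + -1 * v x).
  exact: cL2D.
by apply/funext => x; rewrite mulN1r.
Qed.

Lemma sol_graph u u1 z g : sol Q z u u1 g -> cL2 setT u -> cL2 setT g ->
  S_graph Q u (fun x => z * u x + g x).
Proof.
move=> [a b] Lu Lg; split=> //; split; first by apply: cL2D => //; exact: cL2Z.
exists u1; eexists; split; first exact: a.
split; first exact: b.
by apply: aeW => x; rewrite rmorphXn /=; ring.
Qed.

Definition norm2 u := Rintegral mu setT (fun x => csq (u x)).

Lemma cL2_itg u x y : cL2 setT u -> itg (fun t => csq (u t)) x y <= norm2 u.
Proof. by move=> [_ iu]; apply: itg_le_line => // t; exact: csq_ge0. Qed.

Lemma hsol_csq_cont z u u1 g : sol Q z u u1 g -> continuous (fun x => csq (u x)).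
Proof. by move=> [/cac_csq]. Qed.

Lemma root_inv z rho : rho ^+ 2 - Delta z * rho + 1 = 0 ->
  (Delta z - rho) * rho = 1 /\ csq (Delta z - rho) * csq rho = 1.
Proof.
move=> rE; have E : (Delta z - rho) * rho = 1.
  by apply/eqP; rewrite -subr_eq0 -oppr_eq0 -rE; apply/eqP; ring.
by split=> //; rewrite -csqM E csq1.
Qed.

(** With T the shift by one period, the recursion [hsol_rec] is (T - kap)(T - rho)u = 0, where kap =
    Delta - rho is the other multiplier. *)
Lemma shift_diff z rho u u1 x : rho ^+ 2 - Delta z * rho + 1 = 0 -> hsol z u u1 ->
  u (x + 1 + 1) - rho * u (x + 1) = (Delta z - rho) * (u (x + 1) - rho * u x).
Proof.
move=> /root_inv[E _] hu; rewrite (hsol_rec mQ lQ2 perQ x hu).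
by rewrite mulrBr mulrA E mul1r; ring.
Qed.

Lemma itg_diff_le z rho u u1 x y B1 B2 : hsol z u u1 ->
  itg (fun t => csq (u t)) x y <= B1 ->
  itg (fun t => csq (u t)) (x + 1) (y + 1) <= B2 ->
  itg (fun t => csq (u (t + 1) - rho * u t)) x y <= 2 * (B2 + csq rho * B1).
Proof.
move=> hu uB1 uB2; have lu := lint_cont (hsol_csq_cont hu).
have [lu1 Eu] := itg_shift 1 x y lu.
have H : lint (fun t => 2 * (csq (u (t + 1)) + csq rho * csq (u t))).
  by apply: lintZ; apply: lintD => //; apply: lintZ.
apply: (@le_trans _ _ (itg (fun t => 2 * (csq (u (t + 1)) + csq rho * csq (u t))) x y)).
  apply: le_itg => //.
    apply: lint_cont; apply: (@cac_csq _ (fun t => u (t + 1) - rho * u t)).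
    have := homB (hsol_shift perQ hu) (homZ rho hu) => -[H' _]; exact: H'.
  by move=> t _; rewrite (le_trans (csqD_le _ _))// csqN csqM.
rewrite itgZ//; last by apply: lintD => //; apply: lintZ.
rewrite itgD// ?itgZ//; last exact: lintZ.
by rewrite Eu ler_wpM2l// lerD// ler_wpM2l// csq_ge0.
Qed.

Lemma diff_csq_cont z rho u u1 : hsol z u u1 ->
  continuous (fun t : R => csq (u (t + 1) - rho * u t)).
Proof.
move=> hu; apply: (@cac_csq _ (fun t => u (t + 1) - rho * u t)).
have := homB (hsol_shift perQ hu) (homZ rho hu) => -[H' _]; exact: H'.
Qed.

(** The difference u(x + 1) - rho u(x) is multiplied by the other root, of modulus at least one, at
    each shift; being square integrable to the right, it vanishes by [quasi_right]. *)
Lemma hsol_right z rho u u1 a B : rho ^+ 2 - Delta z * rho + 1 = 0 -> csq rho <= 1 ->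
  hsol z u u1 -> (forall y, a <= y -> itg (fun t => csq (u t)) a y <= B) ->
  forall x, a <= x -> u (x + 1) = rho * u x.
Proof.
move=> rE r1 hu uB x ax; apply/eqP; rewrite -subr_eq0; apply/eqP.
have [_ cE] := root_inv rE; have := csq_ge0 (Delta z - rho) => c0.
apply: (@quasi_right _ (fun t => u (t + 1) - rho * u t) (Delta z - rho) a
  (2 * (B + csq rho * B))) => //.
- exact: diff_csq_cont hu.
- by move=> t _; rewrite (shift_diff _ rE hu).
- have := csq_ge0 rho; nra.
- move=> y ay; apply: (itg_diff_le _ hu); first exact: uB.
  rewrite (le_trans _ (uB (y + 1) _)) ?(le_trans ay) ?lerDl//.
  by apply: itg_ge => //; [exact: lint_cont (hsol_csq_cont hu)|move=> t; exact: csq_ge0|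
    rewrite lerDl|rewrite lerD2r].
Qed.

Lemma hsol_left z rho u u1 a B : rho ^+ 2 - Delta z * rho + 1 = 0 -> 1 <= csq rho ->
  hsol z u u1 -> (forall y, y <= a -> itg (fun t => csq (u t)) y a <= B) ->
  forall x, x <= a - 1 -> u (x + 1) = rho * u x.
Proof.
move=> rE r1 hu uB x ax; apply/eqP; rewrite -subr_eq0; apply/eqP.
have [_ cE] := root_inv rE; have := csq_ge0 (Delta z - rho) => c0.
apply: (@quasi_left _ (fun t => u (t + 1) - rho * u t) (Delta z - rho) (a - 1)
  (2 * (B + csq rho * B))) => //.
- exact: diff_csq_cont hu.
- by move=> t _; rewrite (shift_diff _ rE hu).
- have := csq_ge0 rho; nra.
- move=> y ya; have ya' : y <= a by rewrite (le_trans ya)// gerBl.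
  apply: (itg_diff_le _ hu).
    rewrite (le_trans _ (uB y _))//.
    by apply: itg_ge => //; [exact: lint_cont (hsol_csq_cont hu)|move=> t; exact: csq_ge0|
      rewrite gerBl].
  rewrite subrK (le_trans _ (uB (y + 1) _)) -?lerBrDr//.
Qed.

(** Square integrability to the right makes u quasi-periodic with a multiplier of modulus at most
    one, and such a function is square integrable to the left only if it is zero. *)
Lemma hsol_L2_zero z u u1 B : hsol z u u1 ->
  (forall x y, x <= y -> itg (fun t => csq (u t)) x y <= B) -> forall x, u x = 0.
Proof.
move=> hu uB x; have [rho [rE r1]] := multiplier mQ lQ2 z.
have E y : u (y + 1) = rho * u y.
  by apply: (hsol_right rE r1 hu (a := y) (B := B)) => // ? /uB.
by apply: (quasi_left (hsol_csq_cont hu) (kap := rho) (a := x) (B := B)) => // ? /uB.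
Qed.

Lemma no_eigenvalue z : ~ S_eigenvalue Q z.
Proof.
move=> [u [f [G [fE]]]]; apply.
have [u1 hu] : exists u1, hsol z u u1.
  apply: (graph_sol G (cmeas_cst 0)); apply: ae_sub fE => x ->.
  by rewrite subrr.
have [Lu _] := G; apply: aeW => x; apply: (hsol_L2_zero hu (B := norm2 u)).
by move=> y ? _; exact: cL2_itg.
Qed.

(** Over one period the Wronskian of p with its conjugate is multiplied by |rho|^2 = 1, so its
    increment vanishes. By Lagrange's identity the imaginary part of that increment is 2 Im z times
    the mass of p on [0,1], and this mass is positive. *)
Lemma unimodular_real z rho : rho ^+ 2 - Delta z * rho + 1 = 0 -> csq rho = 1 -> imC z = 0.
Proof.
move=> rE r1; have [p [p1 [hp pE p1E p0]]] := floquet perQ rE.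
have L := sol_lagrange hp (sol_conj hp).
have := cac_im L ler01; rewrite -[X in p X]add0r -[X in p1 X]add0r pE p1E.
rewrite -[X in X - _ = _](_ : imC ((rho * conjc rho) * (p 0 * conjc (p1 0) - p1 0 * conjc (p 0))) = _); last first.
  by congr imC; apply: reim_inj; rewrite !reimE; ring.
rewrite -[X in (_ * X) * _](conjE rho) mulr_conj r1 mul1r subrr.
rewrite (@eq_itg _ _ (fun t => (2 * imC z) * csq (p t))); last first.
  by move=> t _; rewrite !reimE /csq; ring.
rewrite itgZ; last exact: lint_cont (hsol_csq_cont hp).
move=> /esym/eqP; rewrite mulf_eq0 => /orP[|/eqP I0].
  by rewrite mulf_eq0 pnatr_eq0 /= => /eqP.
exfalso; apply: p0.
by have := hsol_itg_eq0 mQ lQ2 hp ltr01; rewrite I0 lexx => /(_ isT 0).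
Qed.

Lemma integrable_supp (f : R -> R) a b : lint f -> (forall t, 0 <= f t) -> a <= b ->
  (forall t, ~~ (a < t < b) -> f t = 0) -> mu.-integrable setT (EFin \o f).
Proof.
move=> lf f0 ab fz; have [|//] := integrable_line lf f0 (C := itg f a b).
move=> n; have n0 : - n%:R <= n%:R :> R by rewrite lerNl (le_trans _ (ler0n _ n))// oppr_le0.
have xa : Num.min (- n%:R) a <= a by rewrite ge_min lexx orbT.
have by_ : b <= Num.max (n%:R) b by rewrite le_max lexx orbT.
apply: (@le_trans _ _ (itg f (Num.min (- n%:R) a) (Num.max n%:R b))).
  by apply: itg_ge => //; rewrite ?ge_min ?le_max lexx.
rewrite (itg_split lf (le_trans xa ab) by_) (itg_split lf xa ab).
have E c d : (forall t, c <= t <= d -> ~~ (a < t < b)) -> c <= d -> itg f c d = 0.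
  move=> H cd; rewrite (@eq_itg _ _ (fun=> 0)) ?itg_cst ?mul0r// => t tcd.
  by rewrite fz// H.
rewrite (E _ a)//; last by move=> t /andP[_ t2]; rewrite negb_and -!leNgt t2.
rewrite (E b)//; last by move=> t /andP[t1 _]; rewrite negb_and -!leNgt t1 orbT.
by rewrite add0r addr0.
Qed.

                                                                                    
                                                                                        
                                 
(** The range misses g, the conjugate of the Floquet solution p cut off to (0,1). A preimage u in
    L_2 would solve the homogeneous equation on both sides of (0,1), and with unimodular multipliers
    a half-line solution in L_2 is zero. So u and u1 vanish at 0 and at 1, and Lagrange's identity
    for u and p gives a zero integral of |p|^2 over (0,1). *)
Lemma unimodular_spectrum z rho : rho ^+ 2 - Delta z * rho + 1 = 0 -> csq rho = 1 ->
  S_spectrum Q z.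
Proof.
move=> rE r1 [_ onto]; have [p [p1 [hp pE p1E p0]]] := floquet perQ rE.
pose I x : R := \1_(`]0, 1[%classic : set R) x.
have Iin x : 0 < x < 1 -> I x = 1.
  by move=> x01; rewrite /I indicE mem_set.
have Iout x : ~~ (0 < x < 1) -> I x = 0.
  move=> x01; rewrite /I indicE memNset//= in_itv /=; exact/negP.
have mI : measurable_fun setT I by exact: measurable_indic.
pose g x := conjc (p x) * (I x)%:C.
have [hpa _] := hp; have mg : cmeas g.
  by apply: cmeasM; [exact: cac_meas (cac_conj hpa)|exact: cmeas_real].
have gout x : ~~ (0 < x < 1) -> g x = 0 by move=> /Iout; rewrite /g => ->; rewrite mulr0.
have cp := hsol_csq_cont hp.
have lI : lint I.
  apply: (@lint_le _ _ (fun=> 1)) => //; last exact: lint_cst.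
  move=> x; have [/Iin ->|/Iout ->] := boolP (0 < x < 1); first by rewrite normr1.
  by rewrite normr0.
have csqg x : csq (g x) = csq (p x) * I x.
  rewrite /g csqM csq_conj; have [/Iin ->|/Iout ->] := boolP (0 < x < 1).
    by rewrite csq1.
  by rewrite csq0.
have Lg : cL2 setT g.
  split=> //; apply: (@integrable_supp _ 0 1) => //.
  - by under eq_fun do rewrite csqg; exact: lint_mulc.
  - by move=> t; exact: csq_ge0.
  - by move=> t /gout ->; rewrite csq0.
have [u [f [G fE]]] := onto g Lg.
have [u1 su] := graph_sol G mg fE; have [Lu _] := G.
have [hua _] := su.
(* [v c] is the homogeneous solution that shares the Cauchy data of u at c; it equals u wherever no
   part of the support of g lies in between. *)
pose v c x := (u c * ph1 z c - u1 c * ph z c) * th z x - (u c * th1 z c - u1 c * th z c) * ph z x.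
pose v1 c x := (u c * ph1 z c - u1 c * ph z c) * th1 z x - (u c * th1 z c - u1 c * th z c) * ph1 z x.
have hv c : hsol z (v c) (v1 c).
  by apply: homB; apply: homZ; [exact: th_hom|exact: ph_hom].
have vc c : v c c = u c /\ v1 c c = u1 c.
  have D := fund_wronsk mQ lQ2 z c; rewrite /v /v1.
  by split; rewrite -[RHS]mulr1 -[in RHS]D; ring.
have eqv c x : (forall t, Num.min c x <= t <= Num.max c x -> ~~ (0 < t < 1)) -> u x = v c x.
  move=> H; have S := solB su (hv c).
  have [a b] : u x - v c x = 0 /\ u1 x - v1 c x = 0.
    apply: (sol_zero_on mQ lQ2 S (x := c)).
    - by case: (vc c) => -> _; rewrite subrr.
    - by case: (vc c) => _ ->; rewrite subrr.
    - by move=> t /H /gout ->; rewrite subr0.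
  by apply/eqP; rewrite -subr_eq0 a.
have r0 : u 1 = 0 /\ u1 1 = 0.
  have [<- <-] := vc 1.
  have eqv1 x : 1 <= x -> u x = v 1 x.
    move=> x1; apply: eqv => t; rewrite (min_idPl x1) (max_idPr x1) => /andP[t1 _].
    by rewrite negb_and -!leNgt t1 orbT.
  have vB y : 1 <= y -> itg (fun t => csq (v 1 t)) 1 y <= norm2 u.
    move=> y1; rewrite -(@eq_itg _ (fun t => csq (u t))); first exact: cL2_itg.
    by move=> t /andP[t1 _]; rewrite eqv1.
  have r1' : csq rho <= 1 by rewrite r1.
  have vE := hsol_right rE r1' (hv 1) vB.
  have V0 : forall x, 1 <= x -> v 1 x = 0.
    apply: (quasi_right (hsol_csq_cont (hv 1)) vE _ vB); by rewrite r1.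
  apply: (hsol_itg_eq0 mQ lQ2 (hv 1) (ltr1n _ 2)).
  rewrite (@eq_itg _ _ (fun=> 0)) ?itg_cst ?mul0r ?ler1n// => t /andP[t1 _].
  by rewrite V0// csq0.
have l0 : u 0 = 0 /\ u1 0 = 0.
  have [<- <-] := vc 0.
  have eqv0 x : x <= 0 -> u x = v 0 x.
    move=> x0; apply: eqv => t; rewrite (min_idPr x0) (max_idPl x0) => /andP[_ t0].
    by rewrite negb_and -!leNgt t0.
  have vB y : y <= 0 -> itg (fun t => csq (v 0 t)) y 0 <= norm2 u.
    move=> y0; rewrite -(@eq_itg _ (fun t => csq (u t))); first exact: cL2_itg.
    by move=> t /andP[_ t0]; rewrite eqv0.
  have r1' : 1 <= csq rho by rewrite r1.
  have vE := hsol_left rE r1' (hv 0) vB.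
  have V0 : forall x, x <= 0 -> v 0 x = 0.
    apply: (quasi_left (hsol_csq_cont (hv 0)) _ _ vB (kap := rho)); last by rewrite r1.
    by move=> x x1; apply: vE; rewrite lerBrDr.
  apply: (hsol_itg_eq0 mQ lQ2 (hv 0) (ltrN10 _)).
  rewrite (@eq_itg _ _ (fun=> 0)) ?itg_cst ?mul0r ?lerN10// => t /andP[_ t0].
  by rewrite V0// csq0.
have := cac_re (sol_lagrange su hp) ler01.
case: r0 l0 => -> -> [-> ->]; rewrite !mul0r !subrr (@eq_itg _ _ (fun t => csq (p t) * I t)); last first.
  move=> t _; rewrite !mul0r mulr0 subr0 add0r /g !reimE /csq; ring.
have [lpI p0'] : lint (fun t => csq (p t) * I t) /\ forall t, 0 <= csq (p t) * I t.
  by split; [exact: lint_mulc|move=> t; rewrite -csqg; exact: csq_ge0].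
(* The indicator is one only inside the open interval, so the vanishing mass is used on
   [1/4, 3/4]. *)
move=> I0; apply: p0; apply: (hsol_itg_eq0 mQ lQ2 hp (x := 1/4) (y := 3/4)); first by lra.
rewrite (@eq_itg _ _ (fun t => csq (p t) * I t)); last first.
  by move=> t /andP[t1 t2]; rewrite Iin ?mulr1//; apply/andP; split; lra.
by rewrite [leRHS]I0; apply: itg_ge => //; lra.
Qed.
End spectrum.

(** * Recursive inequalities and geometric convergence *)

Section sequences.
Variable R : realType.
Local Notation C := R[i].

Lemma sum_forward (x y : nat -> R) (theta S : R) : 0 <= theta -> theta < 1 ->
  (forall n, 0 <= x n) -> (forall n, x n.+1 <= theta * x n + y n) ->
  (forall N, \sum_(0 <= n < N) y n <= S) -> 0 <= S ->
  forall N, \sum_(0 <= n < N) x n <= (x 0 + S) / (1 - theta).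
Proof.
move=> t0 t1 x0 xy yS S0 N.
have t1' : 0 < 1 - theta by rewrite subr_gt0.
case: N => [|N]; first by rewrite big_nil divr_ge0//; [exact: addr_ge0|exact: ltW].
rewrite ler_pdivlMr// mulrBr mulr1 lerBlDr.
have H : \sum_(0 <= n < N.+1) x n <= x 0 + (theta * \sum_(0 <= n < N) x n + \sum_(0 <= n < N) y n).
  rewrite big_nat_recl// lerD2l mulr_sumr -big_split /=.
  by apply: ler_sum => n _; exact: xy.
rewrite (le_trans H)// -addrA lerD2l addrC lerD//.
by rewrite mulrC ler_wpM2r// big_nat_recr//= lerDl.
Qed.

(** The recursion runs from infinity towards 0. Iterating it k times leaves theta^k x(n + k), which
    tends to 0 because x is bounded; boundedness thus excludes the growing solution theta^(-n). *)
Lemma sum_backward (x y : nat -> R) (theta S B : R) : 0 <= theta -> theta < 1 ->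
  (forall n, 0 <= x n) -> (forall n, x n <= theta * x n.+1 + y n) ->
  (forall n, 0 <= y n) ->
  (forall N, \sum_(0 <= n < N) y n <= S) -> (forall n, x n <= B) ->
  x 0 <= S /\ forall N, \sum_(0 <= n < N) x n <= 2 * S / (1 - theta).
Proof.
move=> t0 t1 x0 xy y0 yS xB.
have t1' : 0 < 1 - theta by rewrite subr_gt0.
have itx n k : x n <= theta ^+ k * x (n + k)%N + \sum_(n <= j < n + k) y j.
  elim: k => [|k IH]; first by rewrite addn0 expr0 mul1r big_geq ?addr0.
  rewrite (le_trans IH)// addnS big_nat_recr ?leq_addr//= [\sum_(_ <= _ < _) _ + _]addrC addrA lerD2r.
  rewrite exprSr -mulrA (le_trans (ler_wpM2l (exprn_ge0 k t0) (xy (n + k)%N)))//.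
  rewrite mulrDr lerD2l ler_piMl// exprn_ile1// ltW//.
have xS n : x n <= S.
  apply/ler_addgt0Pl => e e0.
  have B1 : 0 < B + 1 by rewrite ltr_wpDl// (le_trans (x0 0%N)).
  have [k _ kP] : \forall k \near \oo, theta ^+ k < e / (B + 1).
    have /cvgrPdist_lt/(_ _ (divr_gt0 e0 B1)) : theta ^+ k @[k --> \oo] --> 0.
      by apply: cvg_expr; rewrite ger0_norm.
    apply: filterS => k; rewrite sub0r normrN ger0_norm// exprn_ge0//.
  have := kP k (leqnn k) => /= tk.
  rewrite (le_trans (itx n k))// lerD//.
    have xk := xB (n + k)%N; rewrite ltr_pdivlMr// in tk.
    rewrite (le_trans _ (ltW tk))// ler_wpM2l ?exprn_ge0// (le_trans xk)// lerDl//.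
  rewrite (le_trans _ (yS (n + k)%N))// [leRHS](@big_cat_nat _ _ _ n)//= ?leq_addr//.
  by rewrite lerDr sumr_ge0.
split=> // N; rewrite ler_pdivlMr// mulrBr mulr1 lerBlDr.
have H : \sum_(0 <= n < N) x n <= theta * \sum_(0 <= n < N) x n.+1 + \sum_(0 <= n < N) y n.
  by rewrite mulr_sumr -big_split /=; apply: ler_sum => n _; exact: xy.
have H2 : \sum_(0 <= n < N) x n.+1 <= \sum_(0 <= n < N) x n + x N.
  rewrite -big_nat_recr//= [leRHS]big_nat_recl// lerDr//.
have := yS N; have := xS N; have := x0 N; nra.
Qed.

Lemma geometric_limit (s : nat -> R) (c r : R) : 0 <= r -> r < 1 ->
  (forall n, `|s n.+1 - s n| <= c * r ^+ n) ->
  exists L, forall n, `|L - s n| <= c * r ^+ n / (1 - r).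
Proof.
move=> r0 r1 sc; have r1' : 0 < 1 - r by rewrite subr_gt0.
have c0 : 0 <= c by have := sc 0%N; rewrite expr0 mulr1; exact: le_trans.
have D n k : `|s (n + k)%N - s n| <= c * r ^+ n / (1 - r) * (1 - r ^+ k).
  elim: k => [|k IH]; first by rewrite addn0 subrr normr0 expr0 subrr mulr0.
  rewrite addnS -(subrKA (s (n + k)%N)) (le_trans (ler_normD _ _))//.
  rewrite (le_trans (lerD (sc _) IH))// exprD exprS le_eqVlt; apply/orP; left; apply/eqP.
  by field; rewrite lt0r_neq0.
have D' n k : `|s (n + k)%N - s n| <= c * r ^+ n / (1 - r).
  rewrite (le_trans (D n k))// ler_piMr ?gerBl ?exprn_ge0//.
  by rewrite divr_ge0 ?mulr_ge0 ?exprn_ge0// ltW.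
pose d k := s k.+1 - s k.
have cd : cvgn (series d).
  apply: normed_cvg; apply: (series_le_cvg (v_ := geometric c r)).
  - by move=> n; exact: normr_ge0.
  - by move=> n; rewrite /geometric /= mulr_ge0 ?exprn_ge0.
  - by move=> n; exact: sc.
  - by apply: is_cvg_geometric_series; rewrite ger0_norm.
pose L := s 0%N + limn (series d).
have cs : s @ \oo --> L.
  rewrite (_ : s = fun n => s 0%N + series d n).
    by apply: cvgD; [exact: cvg_cst|exact: cd].
  by apply/funext => n; rewrite seriesEnat /= telescope_sumr// addrC subrK.
exists L => n.
have cn : (fun k => `|s (n + k)%N - s n|) @ \oo --> `|L - s n|.
  apply: cvg_norm; apply: cvgB; last exact: cvg_cst.
  rewrite (_ : (fun k => s (n + k)%N) = (fun k => s (k + n)%N)); last first.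
    by apply/funext => k; rewrite addnC.
  by rewrite (cvg_shiftn n s).
rewrite -(cvg_lim _ cn)//; apply: limr_le; first by apply: cvgP cn.
by apply: nearW => k; exact: D'.
Qed.

Lemma csq_geometric_limit (s : nat -> C) (F q : R) : 0 <= q -> q < 1 -> 0 <= F ->
  (forall n, csq (s n.+1 - s n) <= F * q ^+ n) ->
  exists L B, forall n, csq (L - s n) <= B * q ^+ n.
Proof.
move=> q0 q1 F0 sF; pose r := Num.sqrt q.
have rq : r ^+ 2 = q by rewrite sqr_sqrtr.
have r0 : 0 <= r by exact: sqrtr_ge0.
have r1 : r < 1 by rewrite -(ltr_pXn2r (n := 2)) ?nnegrE// rq expr1n.
pose c := Num.sqrt F; have c0 : 0 <= c by exact: sqrtr_ge0.
have cF : c ^+ 2 = F by rewrite sqr_sqrtr.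
have bnd a b n : a ^+ 2 + b ^+ 2 <= F * q ^+ n -> `|a| <= c * r ^+ n.
  move=> H; rewrite -(ler_pXn2r (n := 2)) ?nnegrE ?mulr_ge0 ?exprn_ge0//.
  rewrite real_normK ?num_real// exprMn cF exprAC rq (le_trans _ H)// lerDl sqr_ge0//.
have [L1 L1P] := @geometric_limit (fun n => reC (s n)) c r r0 r1
  (fun n => @bnd _ _ n ltac:(have := sF n; rewrite /csq !reimE; exact)).
have [L2 L2P] := @geometric_limit (fun n => imC (s n)) c r r0 r1
  (fun n => @bnd _ _ n ltac:(have := sF n; rewrite /csq !reimE addrC; exact)).
exists (L1 +i* L2), (2 * (c / (1 - r)) ^+ 2) => n.
have r1' : 0 < 1 - r by rewrite subr_gt0.
have K (a : R) : `|a| <= c * r ^+ n / (1 - r) -> a ^+ 2 <= (c / (1 - r)) ^+ 2 * q ^+ n.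
  move=> H; rewrite -rq -exprAC -exprMn -real_normK ?num_real//.
  rewrite ler_pXn2r ?nnegrE//; first by rewrite (le_trans H)// mulrAC.
  by rewrite mulr_ge0 ?exprn_ge0// divr_ge0// ltW.
rewrite (_ : 2 * _ * _ = (c / (1 - r)) ^+ 2 * q ^+ n + (c / (1 - r)) ^+ 2 * q ^+ n); last by ring.
rewrite /csq !reimE; by rewrite lerD//; apply: K; [exact: L1P|exact: L2P].
Qed.

(** Young's inequality with weight e = (1 - |rho|^2)/2, small enough that |rho|^2 (1 + e) is still
    below one. *)
Lemma csq_contract (rho : C) : csq rho < 1 -> exists theta K, [/\ 0 <= theta, theta < 1, 0 <= K &
  forall a f : C, csq (rho * a + f) <= theta * csq a + K * csq f].
Proof.
set s := csq rho => s1; have s0 : 0 <= s by exact: csq_ge0.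
pose e := (1 - s) / 2; have e0 : 0 < e by rewrite /e; lra.
exists (s * (1 + e)), (1 + e^-1); split.
- by rewrite mulr_ge0//; lra.
- by rewrite /e; nra.
- by rewrite addr_ge0// invr_ge0 ltW.
move=> a f; rewrite -[s * _ * _]mulrAC /s -csqM; move: (rho * a) => w.
rewrite /csq !reimE; set a1 := reC w; set a2 := imC w; set b1 := reC f; set b2 := imC f.
rewrite -subr_ge0 (_ : _ - _ = e * ((a1 - b1 / e) ^+ 2 + (a2 - b2 / e) ^+ 2)).
  by rewrite mulr_ge0 ?(ltW e0)// addr_ge0// sqr_ge0.
by field; rewrite lt0r_neq0.
Qed.
End sequences.

(** * Cauchy-Schwarz estimates on unit cells *)

Section cells.
Variable R : realType.
Local Notation C := R[i].
Implicit Types (u v g w : R -> C) (c t x y : R).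

Lemma csqX (z : C) n : csq (z ^+ n) = csq z ^+ n.
Proof. by elim: n => [|n IH]; [exact: csq1|rewrite !exprS csqM IH]. Qed.

(** The right side minus the left is the variance of h on a cell of length one. *)
Lemma itg_sq (h : R -> R) c : lint h -> lint (fun t => h t ^+ 2) ->
  itg h c (c + 1) ^+ 2 <= itg (fun t => h t ^+ 2) c (c + 1).
Proof.
move=> lh lh2; set H := itg h c (c + 1).
have : 0 <= itg (fun t => (h t ^+ 2 - 2 * H * h t) + H ^+ 2) c (c + 1).
  apply: itg_ge0 => t _.
  rewrite (_ : _ + _ = (h t - H) ^+ 2); [exact: sqr_ge0|by ring].
have l1 : lint (fun t => 2 * H * h t) by exact: lintZ.
have l2 := lintB lh2 l1.
rewrite (itgD _ _ l2 (lint_cst _)) (itgB _ _ lh2 l1) itgZ// itg_cst ?lerDl// -/H.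
by rewrite (_ : c + 1 - c = 1); [lra|ring].
Qed.

Lemma lint_csq_parts w : cmeasurable setT w -> lint (fun t => csq (w t)) ->
  [/\ lint (fun t => reC (w t)), lint (fun t => imC (w t)),
    lint (fun t => reC (w t) ^+ 2) & lint (fun t => imC (w t) ^+ 2)].
Proof.
move=> [mr mi] lw.
have lr : lint (fun t => reC (w t) ^+ 2).
  apply: lint_le lw; first exact: measurable_funX.
  by move=> t; rewrite ger0_norm ?sqr_ge0// lerDl sqr_ge0.
have li : lint (fun t => imC (w t) ^+ 2).
  apply: lint_le lw; first exact: measurable_funX.
  by move=> t; rewrite ger0_norm ?sqr_ge0// lerDr sqr_ge0.
by split=> //; exact: lint_sqrt.
Qed.

Lemma cell_diff (W w : R -> C) c t : cac W w -> cmeasurable setT w ->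
  lint (fun t => csq (w t)) -> 0 <= t <= 1 ->
  csq (W (c + t) - W c) <= itg (fun t => csq (w t)) c (c + 1).
Proof.
move=> Ww mw lw /andP[t0 t1]; have [lr li lr2 li2] := lint_csq_parts mw lw.
have ct : c <= c + t by rewrite lerDl.
have ct1 : c + t <= c + 1 by rewrite lerD2l.
have sq (h : R -> R) : lint h -> lint (fun t => h t ^+ 2) -> 
    itg h c (c + t) ^+ 2 <= itg (fun t => h t ^+ 2) c (c + 1).
  move=> lh lh2; apply: (@le_trans _ _ (itg (fun t => `|h t|) c (c + 1) ^+ 2)).
    rewrite -real_normK ?num_real// ler_pXn2r ?nnegrE//; last exact: itg_ge0.
    rewrite (le_trans (itg_norm _ _ lh))//; apply: itg_ge => //; exact: lint_norm.
  rewrite (le_trans (itg_sq _ _ _))//; first exact: lint_norm.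
    by apply: lint_ext lh2 => s; rewrite real_normK ?num_real.
  by rewrite le_eqVlt; apply/orP; left; apply/eqP/eq_itg => s _; rewrite real_normK ?num_real.
rewrite /csq !reimE (cac_re Ww ct) (cac_im Ww ct).
rewrite (@itgD _ (fun t => reC (w t) ^+ 2) (fun t => imC (w t) ^+ 2))//.
by rewrite lerD// sq.
Qed.

Definition cprim w x : C := prim (fun t => reC (w t)) x +i* prim (fun t => imC (w t)) x.

Lemma cac_prim w : lint (fun t => reC (w t)) -> lint (fun t => imC (w t)) ->
  cac (cprim w) w.
Proof. by move=> lr li; apply/cacP; split; exact: ac_primE. Qed.

Lemma cprim0 w : cprim w 0 = 0.
Proof. by rewrite /cprim !prim0. Qed.

End cells.

                      

(** * The Green function and the bounded resolvent when |rho| < 1 *)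

Section resolvent.
Variables (R : realType) (Q : R -> R).
Local Notation C := R[i].
Local Notation mu := (@lebesgue_measure R).
Implicit Types (x y c t : R) (u v g h : R -> C).
Hypotheses (mQ : measurable_fun setT Q) (lQ2 : lint (fun x => Q x ^+ 2)).
Hypothesis perQ : forall x, Q (x + 1) = Q x.
Local Notation Delta := (Delta mQ lQ2).
Local Notation hsol := (hsol Q).
Variables (z rho : C).
Hypotheses (rE : rho ^+ 2 - Delta z * rho + 1 = 0) (r1 : csq rho < 1).
Let kap := Delta z - rho.

Let kr : kap * rho = 1. Proof. by case: (root_inv rE). Qed.
Let q := csq rho.
Let q0 : 0 <= q. Proof. exact: csq_ge0. Qed.
Let kq : csq kap * q = 1. Proof. by case: (root_inv rE). Qed.
Let qk n : q ^+ n * csq (kap ^+ n) = 1.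
Proof. by rewrite csqX -exprMn mulrC kq expr1n. Qed.
Let krn n : kap ^+ n * rho ^+ n = 1. Proof. by rewrite -exprMn kr expr1n. Qed.

(** The second solution m belongs to [kap], the inverse of rho. As |rho| < 1 < |kap|, the
    multipliers are distinct, so the two eigenvectors are independent and the Wronskian is nonzero;
    p is rescaled to make it one. *)
Lemma floquet_pair : exists p p1 m m1, [/\ hsol z p p1 /\ hsol z m m1,
  forall x, p (x + 1) = rho * p x, forall x, m (x + 1) = kap * m x &
  forall x, p x * m1 x - p1 x * m x = 1].
Proof.
have [p [p1 [hp pE p1E pn]]] := floquet perQ rE.
have kE : kap ^+ 2 - Delta z * kap + 1 = 0.
  by rewrite -[X in _ + X]kr /kap; ring.
have [m [m1 [hm mE m1E mn]]] := floquet perQ kE.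
have rk : rho - kap != 0.
  apply/eqP => /eqP; rewrite subr_eq0 => /eqP rk.
  by move: kq; rewrite -rk -/q => qq; move: r1; rewrite -/q => q1; have := q0; nra.
pose W := p 0 * m1 0 - p1 0 * m 0.
have W0 : W != 0.
  apply/eqP => W0.
  (* If a p and b m have the same Cauchy data at 0, comparing them one period later gives (rho -
     kap) a p = 0 there. *)
  have D (a b : C) : a * p 0 - b * m 0 = 0 -> a * p1 0 - b * m1 0 = 0 ->
     a * p 0 = 0 /\ a * p1 0 = 0.
    move=> E1 E2; have hD := homB (homZ a hp) (homZ b hm).
    have [/= F1 F2] := hsol_zero mQ lQ2 (0 + 1) hD E1 E2.
    move: F1 F2; rewrite pE mE p1E m1E => F1 F2.
    have H (s t : C) : a * s - b * t = 0 -> a * (rho * s) - b * (kap * t) = 0 -> a * s = 0.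
      move=> G1 G2; apply/eqP; have : (rho - kap) * (a * s) == 0.
        apply/eqP; rewrite [LHS](_ : _ = (a * (rho * s) - b * (kap * t)) - kap * (a * s - b * t)).
          by rewrite G1 G2 mulr0 subrr.
        by ring.
      by rewrite mulf_eq0 (negbTE rk).
    by split; [exact: H E1 F1|exact: H E2 F2].
  have [A1 A2] : m 0 * p 0 = 0 /\ m 0 * p1 0 = 0.
    by apply: (D _ (p 0)); [ring|rewrite -[RHS]oppr0 -W0 /W; ring].
  have [B1 B2] : m1 0 * p 0 = 0 /\ m1 0 * p1 0 = 0.
    by apply: (D _ (p1 0)); [rewrite -[RHS]W0 /W; ring|ring].
  have [m0|/eqP m0] := eqVneq (m 0) 0.
    have [m10|/eqP m10] := eqVneq (m1 0) 0; first by apply: mn.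
    by apply: pn; split; apply/eqP; [move/eqP: B1|move/eqP: B2];
      rewrite mulf_eq0 => /orP[/eqP|//].
  by apply: pn; split; apply/eqP; [move/eqP: A1|move/eqP: A2];
    rewrite mulf_eq0 => /orP[/eqP|//].
exists (fun x => W^-1 * p x), (fun x => W^-1 * p1 x), m, m1; split.
- by split=> //; exact: homZ.
- by move=> x; rewrite pE; ring.
- exact: mE.
- move=> x; rewrite [LHS](_ : _ = W^-1 * (p x * m1 x - p1 x * m x)); last by ring.
  by rewrite (wronsk_const x 0 hp hm) -/W mulVf.
Qed.

Lemma mult_add (p : R -> C) r x n : (forall x, p (x + 1) = r * p x) -> p (x + n%:R) = r ^+ n * p x.
Proof.
move=> pE; elim: n => [|n IH]; first by rewrite addr0 mul1r.
by rewrite -natr1 addrA pE IH exprS mulrA.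
Qed.

Lemma mult_sub (p : R -> C) (r k : C) x n : k * r = 1 -> (forall x, p (x + 1) = r * p x) ->
  p (x - n%:R) = k ^+ n * p x.
Proof.
move=> kr' pE; have := mult_add (x - n%:R) n pE; rewrite subrK => ->.
by rewrite mulrA -exprMn kr' expr1n mul1r.
Qed.

Section green.
Variables (p p1 m m1 : R -> C).
Hypotheses (hp : hsol z p p1) (hm : hsol z m m1).
Hypotheses (pE : forall x, p (x + 1) = rho * p x) (mE : forall x, m (x + 1) = kap * m x).
Hypothesis W1 : forall x, p x * m1 x - p1 x * m x = 1.
Variable M : R.
Hypotheses (pM : forall t, 0 <= t <= 1 -> csq (p t) <= M)
  (mM : forall t, 0 <= t <= 1 -> csq (m t) <= M).
Variable g : R -> C.
Hypothesis Lg : cL2 setT g.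

Let M0 : 0 <= M. Proof. by apply: le_trans (pM (t := 0) _); rewrite ?csq_ge0 ?lexx ?ler01. Qed.
Let S0 := norm2 g.

Let lg : lint (fun t => csq (g t)).
Proof. by apply: lint_line; case: Lg. Qed.

Let gmeas : cmeasurable setT g. Proof. by case: Lg. Qed.

Let win c := itg (fun t => csq (g t)) c (c + 1).
Let win_ge0 c : 0 <= win c. Proof. exact: itg_csq_ge0. Qed.

Lemma green_prod w w1 : hsol z w w1 ->
  [/\ cac (cprim (fun t => g t * w t)) (fun t => g t * w t),
   cmeasurable setT (fun t => g t * w t) & lint (fun t => csq (g t * w t))].
Proof.
move=> [wa _]; have [cr ci] := cac_cont wa.
have [lr li _ _] := lint_csq_parts gmeas lg.
have mul a b : continuous a -> lint b -> lint (fun t => b t * a t) :> Prop.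
  by move=> ca lb; apply: lint_ext (lint_mulc ca lb) => t; rewrite mulrC.
split.
- apply: cac_prim.
    by under eq_fun do rewrite reCM; apply: lintB; exact: mul.
  by under eq_fun do rewrite imCM; apply: lintD; exact: mul.
- by apply: cmeasM => //; exact: cac_meas wa.
- by under eq_fun do rewrite csqM; apply: mul => //; exact: cac_csq wa.
Qed.

Let P := cprim (fun t => g t * m t).
Let N := cprim (fun t => g t * p t).

(** On the cell starting at c the solution w is l' times its values on [0,1]; the factor l undoes
    this growth, so that the normalised increment is controlled by the local mass of g alone. *)
Lemma green_cell w w1 (l l' : C) c t : hsol z w w1 -> (forall t, 0 <= t <= 1 -> csq (w t) <= M) ->
  l * l' = 1 -> (forall t, w (c + t) = l' * w t) -> 0 <= t <= 1 ->
  csq (l * (cprim (fun t => g t * w t) (c + t) - cprim (fun t => g t * w t) c)) <= M * win c.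
Proof.
move=> hw wM ll wE t01; have [A B D] := green_prod hw.
rewrite csqM (le_trans (ler_wpM2l (csq_ge0 l) (cell_diff c A B D t01)))//.
rewrite -itgZ// -itgZ//; apply: le_itg; [exact: lintZ|exact: lintZ|].
move=> s /andP[s1 s2]; rewrite mulrC csqM -mulrA [M * _]mulrC ler_wpM2l ?csq_ge0//.
rewrite -[s](subrKC c) wE csqM mulrC mulrA -csqM ll csq1 mul1r.
by apply: wM; apply/andP; split; lra.
Qed.

                                                                                 
                                                  
(** Since m decays to the left, P(-n) converges geometrically. With [a0] the opposite of the limit,
    [a0 + P] is the integral of g m from minus infinity, small enough at -n to compensate the growth
    of p. The resulting bound is the one that [sum_backward] asks for. *)
Lemma green_select_left : exists a0 B, forall n : nat,
  csq (kap ^+ n * (a0 + P (- n%:R))) <= B.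
Proof.
have F0 : 0 <= M * S0 by rewrite mulr_ge0// /S0; apply: le_trans (cL2_itg 0 0 Lg); rewrite itgxx.
have [n|L [B LB]] := @csq_geometric_limit _ (fun n => P (- n%:R)) (M * S0) q q0 r1 F0.
  have := @green_cell m m1 (kap ^+ n.+1) (rho ^+ n.+1) (- n.+1%:R) 1 hm mM (krn _).
  rewrite ler01 lexx => /(_ _ isT) H.
  have {}H : csq (kap ^+ n.+1 * (P (- n%:R) - P (- n.+1%:R))) <= M * win (- n.+1%:R).
    rewrite {1}(_ : - n%:R = - n.+1%:R + 1); last by rewrite -natr1 opprD subrK.
    apply: H => t; rewrite addrC; apply: mult_sub mE; by rewrite mulrC.
  rewrite -csqN opprB -[csq _]mul1r -[X in X * _](qk n.+1) -mulrA -csqM.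
  apply: (@le_trans _ _ (q ^+ n.+1 * (M * S0))).
    rewrite ler_wpM2l ?exprn_ge0// (le_trans H)// ler_wpM2l//; exact: cL2_itg.
  rewrite (_ : q ^+ n.+1 * _ = q * (M * S0 * q ^+ n)); last by rewrite exprS; ring.
  by rewrite ler_piMl ?(ltW r1)// mulr_ge0 ?exprn_ge0.
exists (- L), B => n; rewrite csqM -(csqN (_ + _)) opprD opprK (le_trans (ler_wpM2l (csq_ge0 _) (LB n)))//.
by rewrite mulrC -mulrA qk mulr1.
Qed.

(** The mirror image: p decays to the right, and [b0 + N] becomes minus the integral of g p up to
    plus infinity. *)
Lemma green_select_right : exists b0 B, forall n : nat,
  csq (kap ^+ n * (b0 + N n%:R)) <= B.
Proof.
have F0 : 0 <= M * S0 by rewrite mulr_ge0// /S0; apply: le_trans (cL2_itg 0 0 Lg); rewrite itgxx.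
have [n|L [B LB]] := @csq_geometric_limit _ (fun n => N n%:R) (M * S0) q q0 r1 F0.
  have := @green_cell p p1 (kap ^+ n) (rho ^+ n) n%:R 1 hp pM (krn _).
  rewrite ler01 lexx => /(_ _ isT) H.
  have {}H : csq (kap ^+ n * (N n.+1%:R - N n%:R)) <= M * win n%:R.
    rewrite -natr1; apply: H => t; rewrite addrC; exact: mult_add.
  rewrite -[csq _]mul1r -[X in X * _](qk n) -mulrA -csqM mulrC ler_wpM2r ?exprn_ge0//.
  by rewrite (le_trans H)// ler_wpM2l//; exact: cL2_itg.
exists (- L), B => n; rewrite csqM -(csqN (_ + _)) opprD opprK (le_trans (ler_wpM2l (csq_ge0 _) (LB n)))//.
by rewrite mulrC -mulrA qk mulr1.
Qed.

(** Variation of constants: the terms with P' and N' cancel in the first equation, and in the second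
    they add up to -g because the Wronskian is one. *)
Lemma green_sol a0 b0 : sol Q z
  (fun x => (a0 + P x) * p x - (b0 + N x) * m x)
  (fun x => (a0 + P x) * p1 x - (b0 + N x) * m1 x) g.
Proof.
have [PA _ _] := green_prod hm; have [NA _ _] := green_prod hp.
have PA' := cacD (cac_cst a0) PA; have NA' := cacD (cac_cst b0) NA.
have [pa pb] := hp; have [ma mb] := hm.
split.
  by apply: cac_ext (cacB (cacM PA' pa) (cacM NA' ma)) => x //; rewrite /P /N; ring.
apply: cac_ext (cacB (cacM PA' pb) (cacM NA' mb)) => x //.
by rewrite -[X in _ = _ - X]mulr1 -(W1 x) /P /N; ring.
Qed.

Lemma green_cell_u a0 b0 (l l' : C) c : l * l' = 1 ->
  (forall t, p (c + t) = l * p t) -> (forall t, m (c + t) = l' * m t) ->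
  itg (fun x => csq ((a0 + P x) * p x - (b0 + N x) * m x)) c (c + 1) <=
  4 * M * (csq (l * (a0 + P c)) + csq (l' * (b0 + N c)) + 2 * M * win c).
Proof.
move=> ll pc mc; set K := _ * (_ + _ + _).
have l'l : l' * l = 1 by rewrite mulrC.
have -> : K = itg (fun=> K) c (c + 1) by rewrite itg_cst ?lerDl// addrC addKr mulr1.
apply: le_itg; last 2 [exact: lint_cst].
- by apply: lint_cont; exact: hsol_csq_cont (green_sol a0 b0).
move=> s /andP[s1 s2]; pose t := s - c.
have t01 : 0 <= t <= 1 by rewrite /t; apply/andP; split; lra.
rewrite -(subrKC c s) -/t pc mc.
have A : csq (l * (a0 + P (c + t))) <= 2 * (csq (l * (a0 + P c)) + M * win c).
  rewrite [l * _](_ : _ = l * (a0 + P c) + l * (P (c + t) - P c)); last by ring.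
  rewrite (le_trans (csqD_le _ _))// ler_wpM2l// lerD2l; exact: green_cell hm mM ll mc t01.
have B : csq (l' * (b0 + N (c + t))) <= 2 * (csq (l' * (b0 + N c)) + M * win c).
  rewrite [l' * _](_ : _ = l' * (b0 + N c) + l' * (N (c + t) - N c)); last by ring.
  rewrite (le_trans (csqD_le _ _))// ler_wpM2l// lerD2l; exact: green_cell hp pM l'l pc t01.
rewrite (le_trans (csqD_le _ _))// csqN.
rewrite [(a0 + _) * _](_ : _ = (l * (a0 + P (c + t))) * p t); last by ring.
rewrite [(b0 + _) * _](_ : _ = (l' * (b0 + N (c + t))) * m t); last by ring.
rewrite !(csqM _ (p t)) !(csqM _ (m t)).
have pt := pM t01; have mt := mM t01.
have A' : csq (l * (a0 + P (c + t))) * csq (p t) <= 2 * (csq (l * (a0 + P c)) + M * win c) * M.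
  by rewrite ler_pM ?csq_ge0.
have B' : csq (l' * (b0 + N (c + t))) * csq (m t) <= 2 * (csq (l' * (b0 + N c)) + M * win c) * M.
  by rewrite ler_pM ?csq_ge0.
rewrite (le_trans (ler_wpM2l _ (lerD A' B')))// le_eqVlt; apply/orP; left; apply/eqP.
by rewrite /K; ring.
Qed.

Lemma green_window_right n : itg (fun t => csq (g t)) 0 n%:R = \sum_(0 <= k < n) win k%:R.
Proof.
elim: n => [|n IH]; first by rewrite itgxx big_nil.
by rewrite big_nat_recr//= -IH /win natr1 -itg_split// ler_nat.
Qed.

Lemma green_window_left n : itg (fun t => csq (g t)) (- n%:R) 0 = \sum_(0 <= k < n) win (- k.+1%:R).
Proof.
elim: n => [|n IH]; first by rewrite oppr0 itgxx big_nil.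
rewrite big_nat_recr//= -IH /win (_ : - n.+1%:R + 1 = - n%:R); last first.
  by rewrite -natr1 opprD subrK.
by rewrite addrC -itg_split// ?lerN2 ?ler_nat// oppr_le0.
Qed.

(** The coefficients of p and m, normalised by their growth on each unit cell, obey recursions with
    the contracting factor rho, forced by the local masses of g. Summing these recursions over the
    cells of each half-line bounds the mass of u by a constant independent of g. *)
Lemma green_estimate theta K : 0 <= theta -> theta < 1 -> 0 <= K ->
  (forall a f : C, csq (rho * a + f) <= theta * csq a + K * csq f) ->
  exists u u1, sol Q z u u1 g /\ forall n : nat, itg (fun x => csq (u x)) (- n%:R) n%:R <=
    8 * M * (4 * (K * M) / (1 - theta) + 2 * M) * S0.
Proof.
move=> t0 t1 K0 ctr.
have [a0 [B1 aB]] := green_select_left; have [b0 [B2 bB]] := green_select_right.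
pose al x := a0 + P x; pose be x := b0 + N x.
have dal x y : al x - al y = P x - P y by rewrite /al opprD addrACA subrr add0r.
have dbe x y : be x - be y = N x - N y by rewrite /be opprD addrACA subrr add0r.
have t1' : 0 < 1 - theta by rewrite subr_gt0.
have S00 : 0 <= S0 by apply: le_trans (cL2_itg 0 0 Lg); rewrite itgxx.
have KM0 : 0 <= K * M by exact: mulr_ge0.
pose S := K * M * S0; have SS : 0 <= S by rewrite mulr_ge0.
pose yr n := K * M * win n%:R; pose yl n := K * M * win (- n.+1%:R).
have yr0 n : 0 <= yr n by rewrite mulr_ge0.
have yl0 n : 0 <= yl n by rewrite mulr_ge0.
have yrS n : \sum_(0 <= k < n) yr k <= S.
  by rewrite -mulr_sumr -green_window_right ler_wpM2l//; exact: cL2_itg.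
have ylS n : \sum_(0 <= k < n) yl k <= S.
  by rewrite -mulr_sumr -green_window_left ler_wpM2l//; exact: cL2_itg.
have step a f (y : R) : csq f <= M * y -> csq (rho * a + f) <= theta * csq a + K * M * y.
  by move=> H; rewrite (le_trans (ctr _ _))// lerD2l -mulrA ler_wpM2l.
have rk n : rho ^+ n * kap ^+ n = 1 by rewrite mulrC krn.
have pR n t : p (n%:R + t) = rho ^+ n * p t by rewrite addrC; exact: mult_add.
have mR n t : m (n%:R + t) = kap ^+ n * m t by rewrite addrC; exact: mult_add.
have pL n t : p (- n%:R + t) = kap ^+ n * p t by rewrite addrC; exact: (mult_sub _ _ kr pE).
have mL n t : m (- n%:R + t) = rho ^+ n * m t by rewrite addrC; apply: (mult_sub _ _ _ mE); rewrite mulrC.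
have i1 : 0 <= (1 : R) <= 1 by rewrite ler01 lexx.
have nS n : - n.+1%:R + 1 = - n%:R :> R by rewrite -natr1 opprD subrK.
have csq_small (w f : C) (y : R) : csq w <= 1 -> csq f <= M * y -> csq (w * f) <= M * y.
  by move=> w1 fy; rewrite csqM (le_trans _ fy)// ler_piMl// csq_ge0.
have fR n : csq (rho * (rho ^+ n * (al n.+1%:R - al n%:R))) <= M * win n%:R.
  apply: csq_small; first exact: ltW.
  by rewrite dal -natr1; exact: (green_cell hm mM (rk n) (mR n) i1).
have gR n : csq (- (kap ^+ n * (be n.+1%:R - be n%:R))) <= M * win n%:R.
  by rewrite csqN dbe -natr1; exact: (green_cell hp pM (krn n) (pR n) i1).
have fL n : csq (rho * (kap ^+ n.+1 * (al (- n%:R) - al (- n.+1%:R)))) <= M * win (- n.+1%:R).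
  apply: csq_small; first exact: ltW.
  by rewrite dal -nS; exact: (green_cell hm mM (krn n.+1) (mL n.+1) i1).
have gL n : csq (- (rho ^+ n.+1 * (be (- n%:R) - be (- n.+1%:R)))) <= M * win (- n.+1%:R).
  by rewrite csqN dbe -nS; exact: (green_cell hp pM (rk n.+1) (pL n.+1) i1).
have kS n : rho * kap ^+ n.+1 = kap ^+ n by rewrite exprS mulrA (mulrC rho) kr mul1r.
(* The coefficient of the solution that grows along the half-line satisfies the recursion from
   infinity inwards; the selection of [b0] supplies the required boundedness. *)
have [bS bsum] : csq (be 0) <= S /\ forall k, \sum_(0 <= n < k) csq (kap ^+ n * be n%:R) <= 2 * S / (1 - theta).
  have [|||||||E1 E2] := @sum_backward _ (fun n => csq (kap ^+ n * be n%:R)) yr theta S B2 => //.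
  - by move=> n; exact: csq_ge0.
  - move=> n; rewrite [kap ^+ n * _](_ : _ = rho * (kap ^+ n.+1 * be n.+1%:R) + - (kap ^+ n * (be n.+1%:R - be n%:R))).
      exact: step (gR n).
    by rewrite mulrA kS; ring.
  by split=> //; move: E1; rewrite expr0 mul1r.
have [aS asum] : csq (al 0) <= S /\ forall k, \sum_(0 <= n < k) csq (kap ^+ n * al (- n%:R)) <= 2 * S / (1 - theta).
  have [|||||||E1 E2] := @sum_backward _ (fun n => csq (kap ^+ n * al (- n%:R))) yl theta S B1 => //.
  - by move=> n; exact: csq_ge0.
  - move=> n; rewrite [kap ^+ n * _](_ : _ = rho * (kap ^+ n.+1 * al (- n.+1%:R)) + rho * (kap ^+ n.+1 * (al (- n%:R) - al (- n.+1%:R)))).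
      exact: step (fL n).
    by rewrite !mulrA kS; ring.
  by split=> //; move: E1; rewrite expr0 mul1r oppr0.
(* The coefficient of the decaying solution is summed outwards from 0; its initial value [al 0] was
   bounded by S from the other half-line. *)
have a2sum k : \sum_(0 <= n < k) csq (rho ^+ n * al n%:R) <= 2 * S / (1 - theta).
  have := @sum_forward _ (fun n => csq (rho ^+ n * al n%:R)) yr theta S t0 t1.
  rewrite expr0 mul1r => H; apply: le_trans (H _ _ _ SS k) _ => //.
  - by move=> n; exact: csq_ge0.
  - move=> n; rewrite [rho ^+ n.+1 * _](_ : _ = rho * (rho ^+ n * al n%:R) + rho * (rho ^+ n * (al n.+1%:R - al n%:R))).
      exact: step (fR n).
    by rewrite exprS; ring.
  - by rewrite ler_pM2r ?invr_gt0//; lra.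
have b2sum k : \sum_(0 <= n < k) csq (rho ^+ n * be (- n%:R)) <= 2 * S / (1 - theta).
  have := @sum_forward _ (fun n => csq (rho ^+ n * be (- n%:R))) yl theta S t0 t1.
  rewrite expr0 mul1r oppr0 => H; apply: le_trans (H _ _ _ SS k) _ => //.
  - by move=> n; exact: csq_ge0.
  - move=> n; rewrite [rho ^+ n.+1 * _](_ : _ = rho * (rho ^+ n * be (- n%:R)) + - (rho ^+ n.+1 * (be (- n%:R) - be (- n.+1%:R)))).
      exact: step (gL n).
    by rewrite exprS; ring.
  - by rewrite ler_pM2r ?invr_gt0//; lra.
pose u x := al x * p x - be x * m x.
have su := green_sol a0 b0.
exists u, (fun x => al x * p1 x - be x * m1 x); split=> // n.
have lu : lint (fun x => csq (u x)) by apply: lint_cont; exact: hsol_csq_cont su.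
have M4 : 0 <= 4 * M by rewrite mulr_ge0.
have T0 : 0 <= 2 * S / (1 - theta) by rewrite divr_ge0 ?mulr_ge0// ltW.
have right k : itg (fun x => csq (u x)) 0 k%:R <= \sum_(0 <= n < k)
   4 * M * (csq (rho ^+ n * al n%:R) + csq (kap ^+ n * be n%:R) + 2 * M * win n%:R).
  elim: k => [|k IH]; first by rewrite itgxx big_nil.
  rewrite big_nat_recr//= (@itg_split _ _ 0 k%:R)// ?ler_nat// lerD// -natr1.
  exact: (green_cell_u a0 b0 (rk k) (pR k) (mR k)).
have left k : itg (fun x => csq (u x)) (- k%:R) 0 <= \sum_(0 <= n < k)
   4 * M * (csq (kap ^+ n.+1 * al (- n.+1%:R)) + csq (rho ^+ n.+1 * be (- n.+1%:R)) + 2 * M * win (- n.+1%:R)).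
  elim: k => [|k IH]; first by rewrite oppr0 itgxx big_nil.
  rewrite big_nat_recr//= (@itg_split _ _ _ (- k%:R))// ?lerN2 ?ler_nat ?oppr_le0// addrC lerD//.
  rewrite -[X in itg _ _ X <= _]nS.
  exact: (green_cell_u a0 b0 (krn k.+1) (pL k.+1) (mL k.+1)).
have bnd (f h y : nat -> R) : \sum_(0 <= i < n) f i <= 2 * S / (1 - theta) ->
   \sum_(0 <= i < n) h i <= 2 * S / (1 - theta) -> \sum_(0 <= i < n) y i <= S0 ->
   \sum_(0 <= i < n) 4 * M * (f i + h i + 2 * M * y i) <= 4 * M * (4 * (K * M) / (1 - theta) + 2 * M) * S0.
  move=> H1 H2 H3; rewrite -mulr_sumr !big_split /= -mulr_sumr -[leRHS]mulrA ler_wpM2l//.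
  rewrite (@le_trans _ _ (2 * S / (1 - theta) + 2 * S / (1 - theta) + 2 * M * S0))//.
    by rewrite lerD ?lerD// ler_wpM2l// mulr_ge0.
  by rewrite le_eqVlt; apply/orP; left; apply/eqP; rewrite /S; ring.
have shiftsum (f : nat -> R) : (forall k, 0 <= f k) -> \sum_(0 <= k < n) f k.+1 <= \sum_(0 <= k < n.+1) f k.
  by move=> f0; rewrite [leRHS]big_nat_recl// lerDr.
rewrite (@itg_split _ _ _ 0) ?oppr_le0//.
(* The factor 8 is 4 for each half-line. *)
rewrite (_ : 8 * M * _ * S0 = 4 * M * (4 * (K * M) / (1 - theta) + 2 * M) * S0 + 4 * M * (4 * (K * M) / (1 - theta) + 2 * M) * S0); last by ring.
rewrite lerD//.
  rewrite (le_trans (left n))//; apply: bnd.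
  - apply: le_trans (shiftsum (fun k => csq (kap ^+ k * al (- k%:R))) _) (asum n.+1).
    by move=> k; exact: csq_ge0.
  - apply: le_trans (shiftsum (fun k => csq (rho ^+ k * be (- k%:R))) _) (b2sum n.+1).
    by move=> k; exact: csq_ge0.
  - by rewrite -green_window_left; exact: cL2_itg.
rewrite (le_trans (right n))//; apply: bnd => //.
by rewrite -green_window_right; exact: cL2_itg.
Qed.
End green.

(** The Green solution gives surjectivity with a bound. The bound extends to every u in the domain,
    because u minus the Green solution for the same g is a square-integrable homogeneous solution,
    hence zero. *)
Lemma resolvent : S_resolvent Q z.
Proof.
have [p [p1 [m [m1 [[hp hm] pE mE W1]]]]] := floquet_pair.
have [theta [K [t0 t1 K0 ctr]]] := csq_contract r1.
have [M1 M10 M1P] := cont_bounded 0 1 (hsol_csq_cont hp).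
have [M2 M20 M2P] := cont_bounded 0 1 (hsol_csq_cont hm).
pose M := Num.max M1 M2.
have pM t : 0 <= t <= 1 -> csq (p t) <= M.
  by move=> /M1P; rewrite ger0_norm ?csq_ge0// => H; rewrite le_max H.
have mM t : 0 <= t <= 1 -> csq (m t) <= M.
  by move=> /M2P; rewrite ger0_norm ?csq_ge0// => H; rewrite le_max H orbT.
pose D := 8 * M * (4 * (K * M) / (1 - theta) + 2 * M).
have M0 : 0 < M by rewrite lt_max M10.
have D0 : 0 < D.
  rewrite /D pmulr_rgt0 ?mulr_gt0// ltr_wpDl ?mulr_gt0// divr_ge0 ?subr_ge0 ?(ltW t1)//.
  by rewrite !mulr_ge0// ltW.
have ex g (Lg : cL2 setT g) : exists u u1, [/\ sol Q z u u1 g, cL2 setT u & norm2 u <= D * norm2 g].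
  have [u [u1 [su uB]]] := green_estimate hp hm pE mE W1 pM mM Lg t0 t1 K0 ctr.
  have lu := lint_cont (hsol_csq_cont su).
  have [iu nu] := integrable_line lu (fun t => csq_ge0 (u t)) uB.
  exists u, u1; split=> //; split=> //.
  by case: su => /cac_meas.
split; last first.
  move=> g Lg; have [u [u1 [su Lu _]]] := ex g Lg.
  exists u; eexists; split; first exact: sol_graph su Lu Lg.
  by apply: aeW => x; ring.
exists (Num.sqrt D); split; first by rewrite sqrtr_gt0.
move=> u f G; have [Lu [Lf _]] := G; pose g x := f x - z * u x.
have Lg : cL2 setT g by apply: cL2B => //; exact: cL2Z.
have [u1 su] : exists u1, sol Q z u u1 g.
  by apply: (graph_sol mQ G); [case: Lg|exact: aeW].
have [v [v1 [sv Lv vD]]] := ex g Lg.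
have hd : hsol z (fun x => u x - v x) (fun x => u1 x - v1 x).
  by apply: sol_ext (solB su sv) => // x; rewrite subrr.
have Ld : cL2 setT (fun x => u x - v x) by exact: cL2B.
have d0 : forall x, u x - v x = 0.
  apply: (hsol_L2_zero mQ lQ2 perQ hd (B := norm2 (fun x => u x - v x))) => x y _.
  exact: (cL2_itg x y Ld).
have uv : u = v by apply/funext => x; apply/eqP; rewrite -subr_eq0 d0.
rewrite /L2norm -sqrtrM ?(ltW D0)//; apply: ler_wsqrtr.
by move: vD; rewrite -uv.
Qed.
End resolvent.

                         

(** * Real energies: the discriminant and its derivative *)

Section real_spectral.
Variables (R : realType) (Q : R -> R).
Local Notation C := R[i].
Implicit Types (x y l : R) (a b : R -> R).
Hypotheses (mQ : measurable_fun setT Q) (lQ2 : lint (fun x => Q x ^+ 2)).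
Let lQ : lint Q. Proof. exact: lint_sqrt. Qed.

Definition rsol l a a1 := ac a (fun x => a1 x + Q x * a x) /\
  ac a1 (fun x => - Q x ^+ 2 * a x - Q x * a1 x - l * a x).

Lemma rsolD l a a1 b b1 : rsol l a a1 -> rsol l b b1 ->
  rsol l (fun x => a x + b x) (fun x => a1 x + b1 x).
Proof.
move=> [A A1] [B B1]; split.
  by apply: ac_ext (acD A B) => x //; ring.
by apply: ac_ext (acD A1 B1) => x //; ring.
Qed.

Lemma rsolZ k l a a1 : rsol l a a1 -> rsol l (fun x => k * a x) (fun x => k * a1 x).
Proof.
move=> [A A1]; split.
  by apply: ac_ext (acZ k A) => x //; ring.
by apply: ac_ext (acZ k A1) => x //; ring.
Qed.

Lemma rsol_lagrange l l' a a1 b b1 : rsol l a a1 -> rsol l' b b1 ->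
  ac (fun x => a x * b1 x - a1 x * b x) (fun x => (l - l') * (a x * b x)).
Proof.
move=> [A A1] [B B1].
by apply: ac_ext (acB (acM A B1) (acM A1 B)) => x //; ring.
Qed.

Definition rth l x := reC (th mQ lQ2 l%:C x).
Definition rth1 l x := reC (th1 mQ lQ2 l%:C x).
Definition rph l x := reC (ph mQ lQ2 l%:C x).
Definition rph1 l x := reC (ph1 mQ lQ2 l%:C x).

Lemma real_eq (z : C) : conjc z = z -> imC z = 0.
Proof.
move=> /(congr1 (@imC R)); rewrite imC_conj => /eqP; rewrite eq_sym -subr_eq0 opprK.
by rewrite -mulr2n mulrn_eq0 /= => /eqP.
Qed.

(** For real l, conjugation preserves the equation and the real Cauchy data, so uniqueness makes the
    fundamental solutions real. *)
Lemma fund_real l x : [/\ imC (th mQ lQ2 l%:C x) = 0, imC (th1 mQ lQ2 l%:C x) = 0,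
  imC (ph mQ lQ2 l%:C x) = 0 & imC (ph1 mQ lQ2 l%:C x) = 0].
Proof.
have lc : conjc (l%:C : C) = l%:C by apply: reim_inj; rewrite !reimE ?oppr0.
have H u u1 : hsol Q l%:C u u1 ->
   hsol Q l%:C (fun x => conjc (u x)) (fun x => conjc (u1 x)).
  move=> /sol_conj; rewrite lc; apply: sol_ext => // t.
  by apply: reim_inj; rewrite !reimE ?oppr0.
have c0 : conjc (0 : C) = 0 by apply: reim_inj; rewrite !reimE ?oppr0.
have c1 : conjc (1 : C) = 1 by apply: reim_inj; rewrite !reimE ?oppr0.
have [A B] := hsol_repr mQ lQ2 x (H _ _ (th_hom mQ lQ2 l%:C)).
have [D E] := hsol_repr mQ lQ2 x (H _ _ (ph_hom mQ lQ2 l%:C)).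
move: A B D E; rewrite th0 th10 ph0 ph10 c0 c1 !mul1r !mul0r !addr0 !add0r => A B D E.
by split; apply: real_eq.
Qed.

Lemma rth_sol l : rsol l (rth l) (rth1 l).
Proof.
have [/cacP[A _] /cacP[B _]] := th_hom mQ lQ2 l%:C; split.
  apply: ac_ext A => // x; have [_ h1 h2 _] := fund_real l x.
  by rewrite !reimE ?h1 /rth /rth1; ring.
apply: ac_ext B => // x; have [h1 h2 _ _] := fund_real l x.
by rewrite !expr2 !reimE ?h1 ?h2 /rth /rth1; ring.
Qed.

Lemma rph_sol l : rsol l (rph l) (rph1 l).
Proof.
have [/cacP[A _] /cacP[B _]] := ph_hom mQ lQ2 l%:C; split.
  apply: ac_ext A => // x; have [_ _ h1 h2] := fund_real l x.
  by rewrite !reimE ?h1 /rph /rph1; ring.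
apply: ac_ext B => // x; have [_ _ h1 h2] := fund_real l x.
by rewrite !expr2 !reimE ?h1 ?h2 /rph /rph1; ring.
Qed.

Lemma rth0 l : rth l 0 = 1. Proof. by rewrite /rth th0. Qed.
Lemma rth10 l : rth1 l 0 = 0. Proof. by rewrite /rth1 th10. Qed.
Lemma rph0 l : rph l 0 = 0. Proof. by rewrite /rph ph0. Qed.
Lemma rph10 l : rph1 l 0 = 1. Proof. by rewrite /rph1 ph10. Qed.

Lemma rwronsk l x : rth l x * rph1 l x - rth1 l x * rph l x = 1.
Proof.
have := congr1 (@reC R) (fund_wronsk mQ lQ2 l%:C x); have [h1 h2 h3 h4] := fund_real l x.
by rewrite !reimE h1 h2 h3 h4 /rth /rth1 /rph /rph1 => <-; ring.
Qed.

Definition disc l := rth l 1 + rph1 l 1.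

Lemma discE l : disc l = rth l 1 + rph1 l 1. Proof. by []. Qed.

Lemma Delta_disc l : Delta mQ lQ2 l%:C = (disc l)%:C.
Proof.
have [h1 h2 h3 h4] := fund_real l 1.
by apply: reim_inj; rewrite !reimE// h1 h4 addr0.
Qed.

Lemma rsol_cont l a a1 : rsol l a a1 -> continuous a /\ continuous a1.
Proof. by move=> [/ac_cont ? /ac_cont]. Qed.

Lemma fund_bound_unif (L : R) : exists2 K, 1 <= K & forall l x, `|l| <= L -> 0 <= x <= 1 ->
  [/\ `|rth l x| <= K, `|rth1 l x| <= K, `|rph l x| <= K & `|rph1 l x| <= K].
Proof.
pose K := expR (itg (sol_rate Q) 0 1 + 2 * L); exists (1 + K); first by rewrite lerDl expR_ge0.
move=> l x lL x01; have := th_bound mQ lQ2 l%:C x01; rewrite /sol_bound !reimE normr0 mulr0 addr0.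
have : expR (itg (sol_rate Q) 0 1 + 2 * `|l|) <= 1 + K.
  by apply: (@le_trans _ _ K); [rewrite ler_expR lerD2l ler_wpM2l|rewrite lerDr].
by move=> H [A B D E]; split; apply: le_trans H.
Qed.

(** [gA], [gB] and [gC] are the entries of the Gram matrix of the two fundamental solutions in
    L_2(0,1). *)
Definition gA l := itg (fun t => rth l t * rth l t) 0 1.
Definition gB l := itg (fun t => rth l t * rph l t) 0 1.
Definition gC l := itg (fun t => rph l t * rph l t) 0 1.

Lemma continuousM' (f g : R -> R) : continuous f -> continuous g -> continuous (fun x => f x * g x).
Proof. by move=> cf cg x; apply: continuousM; [exact: cf|exact: cg]. Qed.

Lemma continuousD' (f g : R -> R) : continuous f -> continuous g -> continuous (fun x => f x + g x).
Proof. by move=> cf cg x; apply: continuousD; [exact: cf|exact: cg]. Qed.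

(** Lagrange's identity for b against [rth] and [rph] is a linear system of determinant one for the
    differences b - c and b1 - c1. The formula is exact: it yields Lipschitz dependence on the
    energy first, and a first-order expansion afterwards. *)
Lemma rsol_perturb l l' c c1 b b1 x : rsol l c c1 -> rsol l' b b1 ->
  b 0 = c 0 -> b1 0 = c1 0 -> 0 <= x ->
  b x - c x = (l' - l) * (rth l x * itg (fun t => rph l t * b t) 0 x
     - rph l x * itg (fun t => rth l t * b t) 0 x) /\
  b1 x - c1 x = (l' - l) * (rth1 l x * itg (fun t => rph l t * b t) 0 x
     - rph1 l x * itg (fun t => rth l t * b t) 0 x).
Proof.
move=> hc hb bc0 bc1 x0; have D := rwronsk l x.
have cb : continuous b by case: (rsol_cont hb).
have H a a1 : rsol l a a1 -> a x * (b1 x - c1 x) - a1 x * (b x - c x) =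
    (l - l') * itg (fun t => a t * b t) 0 x.
  move=> ha; have [_ /(_ 0 x x0)] := rsol_lagrange ha hb.
  have /(ac_const (rsol_lagrange ha hc)) /(_ 0 x) : forall t, (l - l) * (a t * c t) = 0.
    by move=> t; rewrite subrr mul0r.
  rewrite itgZ; last by apply: lint_cont; apply: continuousM' cb; case: (rsol_cont ha).
  rewrite bc0 bc1 => E <-; rewrite E; ring.
have := H _ _ (rth_sol l); have := H _ _ (rph_sol l).
set IP := itg _ 0 x; set IT := itg _ 0 x => E1 E2.
split.
  rewrite -[LHS]mulr1 -D [LHS](_ : _ = rph l x * (rth l x * (b1 x - c1 x) - rth1 l x * (b x - c x)) -
    rth l x * (rph l x * (b1 x - c1 x) - rph1 l x * (b x - c x))); last by ring.
  by rewrite E1 E2; ring.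
rewrite -[LHS]mulr1 -D [LHS](_ : _ = rph1 l x * (rth l x * (b1 x - c1 x) - rth1 l x * (b x - c x)) -
    rth1 l x * (rph l x * (b1 x - c1 x) - rph1 l x * (b x - c x))); last by ring.
by rewrite E1 E2; ring.
Qed.

Lemma itg_norm_le (f : R -> R) (B x : R) : lint f -> 0 <= x <= 1 ->
  (forall t, 0 <= t <= x -> `|f t| <= B) -> `|itg f 0 x| <= B.
Proof.
move=> lf /andP[x0 x1] fB; rewrite (le_trans (itg_norm _ _ lf))//.
apply: (@le_trans _ _ (itg (fun=> B) 0 x)).
  by apply: le_itg => //; [exact: lint_norm|exact: lint_cst].
rewrite itg_cst// subr0 ler_piMr//.
by apply: le_trans (fB 0 _); rewrite ?lexx ?normr_ge0.
Qed.

Lemma norm_lincomb (p q X Y K B : R) : `|p| <= K -> `|q| <= K -> `|X| <= B -> `|Y| <= B ->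
  `|p * X - q * Y| <= 2 * (K * B).
Proof.
move=> pK qK XB YB; rewrite (le_trans (ler_normB _ _))// !normrM.
by rewrite mulrDl mul1r lerD// ler_pM.
Qed.

Lemma rsol_lipschitz (L : R) : exists2 K, 0 <= K & forall l l' x, `|l| <= L -> `|l'| <= L -> 0 <= x <= 1 ->
  [/\ `|rth l' x - rth l x| <= K * `|l' - l|, `|rth1 l' x - rth1 l x| <= K * `|l' - l|,
      `|rph l' x - rph l x| <= K * `|l' - l| & `|rph1 l' x - rph1 l x| <= K * `|l' - l|].
Proof.
have [K K1 KP] := fund_bound_unif L.
have K0 : 0 <= K by exact: le_trans K1.
exists (2 * (K * (K * K))); first by rewrite !mulr_ge0.
move=> l l' x lL l'L x01; have /andP[x0 x1] := x01.
have [t1 t2 p1 p2] := KP l x lL x01.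
have [cT _] := rsol_cont (rth_sol l); have [cP _] := rsol_cont (rph_sol l).
have I c b c1 b1 : rsol l c c1 -> rsol l' b b1 -> (forall t, 0 <= t <= 1 -> `|b t| <= K) ->
   `|itg (fun t => rph l t * b t) 0 x| <= K * K /\ `|itg (fun t => rth l t * b t) 0 x| <= K * K.
  move=> hc hb bK; have [cb _] := rsol_cont hb.
  have bd (f : R -> R) : continuous f -> (forall t, 0 <= t <= 1 -> `|f t| <= K) -> `|itg (fun t => f t * b t) 0 x| <= K * K.
    move=> cf fK; apply: itg_norm_le => //; first by apply: lint_cont; exact: continuousM'.
    move=> t /andP[t0 tx]; have t01 : 0 <= t <= 1 by rewrite t0 (le_trans tx).
    by rewrite normrM ler_pM ?fK ?bK.
  by split; apply: bd => // t /(KP l _ lL)[].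
have [E1 E2] := rsol_perturb (rth_sol l) (rth_sol l') (etrans (rth0 _) (esym (rth0 _))) (etrans (rth10 _) (esym (rth10 _))) x0.
have [E3 E4] := rsol_perturb (rph_sol l) (rph_sol l') (etrans (rph0 _) (esym (rph0 _))) (etrans (rph10 _) (esym (rph10 _))) x0.
have [I1 I2] : `|itg (fun t => rph l t * rth l' t) 0 x| <= K * K /\ `|itg (fun t => rth l t * rth l' t) 0 x| <= K * K.
  by apply: (I _ _ _ _ (rth_sol l) (rth_sol l')) => t /(KP l' _ l'L)[].
have [I3 I4] : `|itg (fun t => rph l t * rph l' t) 0 x| <= K * K /\ `|itg (fun t => rth l t * rph l' t) 0 x| <= K * K.
  by apply: (I _ _ _ _ (rph_sol l) (rph_sol l')) => t /(KP l' _ l'L)[].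
rewrite E1 E2 E3 E4 !normrM.
by split; rewrite mulrC ler_wpM2r// norm_lincomb.
Qed.

(** In [rsol_perturb] the perturbed solution under the integrals is replaced by the unperturbed one;
    by [rsol_lipschitz] this costs one more factor |l' - l|. *)
Lemma monodromy_expand l : exists2 K, 0 <= K & forall l', `|l' - l| <= 1 ->
  [/\ `|rth l' 1 - rth l 1 - (l' - l) * (rth l 1 * gB l - rph l 1 * gA l)| <= K * (l' - l) ^+ 2,
      `|rth1 l' 1 - rth1 l 1 - (l' - l) * (rth1 l 1 * gB l - rph1 l 1 * gA l)| <= K * (l' - l) ^+ 2,
      `|rph l' 1 - rph l 1 - (l' - l) * (rth l 1 * gC l - rph l 1 * gB l)| <= K * (l' - l) ^+ 2 &
      `|rph1 l' 1 - rph1 l 1 - (l' - l) * (rth1 l 1 * gC l - rph1 l 1 * gB l)| <= K * (l' - l) ^+ 2].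
Proof.
pose L := `|l| + 1.
have [K K1 KP] := fund_bound_unif L; have [J J0 JP] := rsol_lipschitz L.
have K0 : 0 <= K by exact: le_trans K1.
exists (2 * (K * (K * J))); first by rewrite !mulr_ge0.
move=> l' l'l; have lL : `|l| <= L by rewrite lerDl.
have l'L : `|l'| <= L by rewrite -(subrK l l') (le_trans (ler_normD _ _))// addrC lerD2l.
have i1 : 0 <= (1:R) <= 1 by rewrite ler01 lexx.
have [t1 t2 p1 p2] := KP l 1 lL i1.
have [cT _] := rsol_cont (rth_sol l); have [cP _] := rsol_cont (rph_sol l).
have I (f c b : R -> R) : continuous f -> continuous b -> continuous c -> (forall t, 0 <= t <= 1 -> `|f t| <= K) ->
   (forall t, 0 <= t <= 1 -> `|b t - c t| <= J * `|l' - l|) ->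
   `|itg (fun t => f t * b t) 0 1 - itg (fun t => f t * c t) 0 1| <= K * (J * `|l' - l|).
  move=> cf cb cc fK bc; have lb := lint_cont (continuousM' cf cb); have lc := lint_cont (continuousM' cf cc).
  rewrite -itgB//; apply: itg_norm_le => //; first exact: lintB.
  by move=> t t01; rewrite -mulrBr normrM ler_pM ?fK ?bc.
have [E1 E2] := rsol_perturb (rth_sol l) (rth_sol l') (etrans (rth0 _) (esym (rth0 _))) (etrans (rth10 _) (esym (rth10 _))) ler01.
have [E3 E4] := rsol_perturb (rph_sol l) (rph_sol l') (etrans (rph0 _) (esym (rph0 _))) (etrans (rph10 _) (esym (rph10 _))) ler01.
have [cT' _] := rsol_cont (rth_sol l'); have [cP' _] := rsol_cont (rph_sol l').
have TK t : 0 <= t <= 1 -> `|rth l t| <= K by move=> /(KP l _ lL)[].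
have PK t : 0 <= t <= 1 -> `|rph l t| <= K by move=> /(KP l _ lL)[].
have dT t : 0 <= t <= 1 -> `|rth l' t - rth l t| <= J * `|l' - l| by move=> /(JP l l' _ lL l'L)[].
have dP t : 0 <= t <= 1 -> `|rph l' t - rph l t| <= J * `|l' - l| by move=> /(JP l l' _ lL l'L)[].
have gBC : gB l = itg (fun t => rph l t * rth l t) 0 1.
  by apply: eq_itg => t _; rewrite mulrC.
have I1 := I _ _ _ cP cT' cT PK dT; have I2 := I _ _ _ cT cT' cT TK dT.
have I3 := I _ _ _ cP cP' cP PK dP; have I4 := I _ _ _ cT cP' cP TK dP.
rewrite E1 E2 E3 E4 -!mulrBr.
rewrite -gBC -/(gA l) in I1 I2; rewrite -/(gC l) -/(gB l) in I3 I4.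
have fin (m n X X' Y Y' : R) : `|m| <= K -> `|n| <= K -> `|X - X'| <= K * (J * `|l' - l|) ->
   `|Y - Y'| <= K * (J * `|l' - l|) ->
   `|(l' - l) * (m * X - n * Y - (m * X' - n * Y'))| <= 2 * (K * (K * J)) * (l' - l) ^+ 2.
  move=> mK nK XX YY; rewrite (_ : _ - (_ - _) = m * (X - X') - n * (Y - Y')); last by ring.
  rewrite normrM (le_trans (ler_wpM2l (normr_ge0 _) (norm_lincomb mK nK XX YY)))//.
  rewrite -[(l' - l) ^+ 2]real_normK ?num_real// le_eqVlt; apply/orP; left; apply/eqP; ring.
by split; apply: fin.
Qed.

Lemma gram_pos l (a b : R) : ~ (a = 0 /\ b = 0) ->
  0 < a ^+ 2 * gA l + 2 * a * b * gB l + b ^+ 2 * gC l.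
Proof.
move=> ab; have [cT _] := rsol_cont (rth_sol l); have [cP _] := rsol_cont (rph_sol l).
have lA := lint_cont (continuousM' cT cT); have lB := lint_cont (continuousM' cT cP).
have lC := lint_cont (continuousM' cP cP).
rewrite /gA /gB /gC -!itgZ// -itgD; [|exact: lintZ|exact: lintZ].
rewrite -itgD; [|by apply: lintD; exact: lintZ|exact: lintZ].
rewrite ltNge; apply/negP => I0; apply: ab.
have h : hsol Q l%:C (fun x => a%:C * th mQ lQ2 l%:C x + b%:C * ph mQ lQ2 l%:C x)
   (fun x => a%:C * th1 mQ lQ2 l%:C x + b%:C * ph1 mQ lQ2 l%:C x).
  by apply: homD; apply: homZ; [exact: th_hom|exact: ph_hom].
have := hsol_itg_eq0 mQ lQ2 h ltr01; rewrite (@eq_itg _ _ (fun t => a ^+ 2 * (rth l t * rth l t) +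
   2 * a * b * (rth l t * rph l t) + b ^+ 2 * (rph l t * rph l t))).
  move=> /(_ I0 0); rewrite th0 th10 ph0 ph10 !mulr1 !mulr0 addr0 add0r => -[].
  by move=> /(congr1 (@reC R)) /= -> /(congr1 (@reC R)) /= ->.
move=> t _; have [h1 h2 h3 h4] := fund_real l t.
by rewrite /csq !reimE h1 h3 /rth /rph; ring.
Qed.

(** Strict Cauchy-Schwarz, from positivity of the Gram form at the vectors (1,0), (0,1) and (-gB,
    gA). *)
Lemma gram_det l : [/\ 0 < gA l, 0 < gC l & gB l ^+ 2 < gA l * gC l].
Proof.
have A0 : 0 < gA l.
  have := @gram_pos l 1 0; rewrite expr1n mul1r mulr0 mul0r expr0n mul0r !addr0; apply.
  by move=> [/eqP]; rewrite oner_eq0.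
have C0 : 0 < gC l.
  have := @gram_pos l 0 1; rewrite expr1n mul1r mulr0 !mul0r expr0n mul0r !add0r; apply.
  by move=> [_ /eqP]; rewrite oner_eq0.
split=> //; have : 0 < (- gB l) ^+ 2 * gA l + 2 * (- gB l) * gA l * gB l + gA l ^+ 2 * gC l.
  by apply: gram_pos => -[_ A1]; move: A0; rewrite A1 ltxx.
rewrite (_ : _ + _ = gA l * (gA l * gC l - gB l ^+ 2)); last by ring.
by rewrite pmulr_rgt0// subr_gt0.
Qed.

(** The derivative of [disc]: the trace of the first-order term in [monodromy_expand]. *)
Definition ddisc l := rth l 1 * gB l - rph l 1 * gA l + (rth1 l 1 * gC l - rph1 l 1 * gB l).

Lemma disc_expand l : exists2 K, 0 <= K & forall l', `|l' - l| <= 1 ->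
  `|disc l' - disc l - (l' - l) * ddisc l| <= K * (l' - l) ^+ 2.
Proof.
have [K K0 KP] := monodromy_expand l; exists (K + K); first exact: addr_ge0.
move=> l' /KP[h1 _ _ h4]; rewrite [X in `|X|](_ : _ =
  rth l' 1 - rth l 1 - (l' - l) * (rth l 1 * gB l - rph l 1 * gA l) +
  (rph1 l' 1 - rph1 l 1 - (l' - l) * (rth1 l 1 * gC l - rph1 l 1 * gB l))).
  by rewrite [leRHS]mulrDl; apply: le_trans (ler_normD _ _) _; apply: lerD.
by rewrite /disc /ddisc; ring.
Qed.

                                                                                   
                                                                                     
                                        
(** Write A, B, C for the Gram entries and m_ij for the monodromy. If the derivative vanished, then
    (m11 - m22) B = m12 A - m21 C, and determinant one would give (m12 A + m21 C)^2 = (m11 - m22)^2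
    (B^2 - AC) - (4 - disc^2) AC, whose right side is negative. *)
Lemma ddisc_neq0 l : `|disc l| < 2 -> ddisc l != 0.
Proof.
move=> D2; apply/eqP => d0; have [A0 C0 BAC] := gram_det l.
have W := rwronsk l 1; move: d0; rewrite /ddisc.
set m11 := rth l 1 in W *; set m12 := rph l 1 in W *.
set m21 := rth1 l 1 in W *; set m22 := rph1 l 1 in W * => d0.
have : (disc l) ^+ 2 < 4.
  by rewrite -real_normK ?num_real// (_ : 4 = 2 ^+ 2 :> R) ?ltr_pXn2r ?nnegrE//; ring.
rewrite /disc -/m11 -/m22 => D4.
have : (m12 * gA l + m21 * gC l) ^+ 2 =
   (m11 - m22) ^+ 2 * (gB l ^+ 2 - gA l * gC l) - (4 - (m11 + m22) ^+ 2) * (gA l * gC l).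
  have E : (m11 - m22) * gB l = m12 * gA l - m21 * gC l by apply/eqP; rewrite -subr_eq0 -d0; apply/eqP; ring.
  have -> : (m12 * gA l + m21 * gC l) ^+ 2 = (m12 * gA l - m21 * gC l) ^+ 2 + 4 * m12 * m21 * (gA l * gC l) by ring.
  rewrite -E; have -> : 4 * m12 * m21 = (m11 + m22) ^+ 2 - (m11 - m22) ^+ 2 - 4.
    by move: W; lra.
  by ring.
have : 0 < (4 - (m11 + m22) ^+ 2) * (gA l * gC l) by rewrite mulr_gt0 ?mulr_gt0 ?subr_gt0.
have : (m11 - m22) ^+ 2 * (gB l ^+ 2 - gA l * gC l) <= 0.
  by rewrite mulr_ge0_le0 ?sqr_ge0// subr_le0 ltW.
have := sqr_ge0 (m12 * gA l + m21 * gC l); lra.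
Qed.

(** The identity behind [ddisc_neq0] with disc^2 = 4 equates a square with a nonpositive quantity,
    so m11 = m22; then both off-diagonal entries vanish and the monodromy is plus or minus the
    identity. *)
Lemma degenerate_monodromy l : `|disc l| = 2 -> ddisc l = 0 ->
  [/\ rph l 1 = 0, rth1 l 1 = 0, rth l 1 = rph1 l 1 & rth l 1 ^+ 2 = 1].
Proof.
move=> D2 d0; have [A0 C0 BAC] := gram_det l.
have W := rwronsk l 1; move: d0; rewrite /ddisc.
set m11 := rth l 1 in W *; set m12 := rph l 1 in W *.
set m21 := rth1 l 1 in W *; set m22 := rph1 l 1 in W * => d0.
have : (disc l) ^+ 2 = 4 by rewrite -real_normK ?num_real// D2; ring.
rewrite /disc -/m11 -/m22 => D4.
have E : (m11 - m22) * gB l = m12 * gA l - m21 * gC l by apply/eqP; rewrite -subr_eq0 -d0; apply/eqP; ring.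
have H : (m12 * gA l + m21 * gC l) ^+ 2 = (m11 - m22) ^+ 2 * (gB l ^+ 2 - gA l * gC l).
  have -> : (m12 * gA l + m21 * gC l) ^+ 2 = (m12 * gA l - m21 * gC l) ^+ 2 + 4 * m12 * m21 * (gA l * gC l) by ring.
  rewrite -E; have -> : 4 * m12 * m21 = (m11 + m22) ^+ 2 - (m11 - m22) ^+ 2 - 4.
    by move: W; lra.
  by rewrite D4; ring.
have s0 : m11 - m22 = 0.
  apply/eqP; rewrite -sqrf_eq0 -[_ == 0]orbF -(@lt_eqF _ _ (gB l ^+ 2 - gA l * gC l) 0) ?subr_lt0//.
  rewrite -mulf_eq0 -H eq_le sqr_ge0 andbT H mulr_ge0_le0 ?sqr_ge0// subr_le0 ltW//.
have X0 : m12 * gA l + m21 * gC l = 0.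
  by apply/eqP; rewrite -sqrf_eq0 H s0 expr0n mul0r.
move: E; rewrite s0 mul0r => /esym X1.
have m120 : m12 = 0.
  have : m12 * gA l == 0 by apply/eqP; lra.
  by rewrite mulf_eq0 (gt_eqF A0) orbF => /eqP.
have m210 : m21 = 0.
  have : m21 * gC l == 0 by apply/eqP; lra.
  by rewrite mulf_eq0 (gt_eqF C0) orbF => /eqP.
split=> //; first by apply/eqP; rewrite -subr_eq0 s0.
have m11E : m11 = m22 by apply/eqP; rewrite -subr_eq0 s0.
by rewrite -W m210 mul0r subr0 -m11E expr2.
Qed.

                                                                                   
                                  
(** Determinant one gives trace^2 - 4 = (n11 - n22)^2 + 4 n12 n21. Inserting the expansion around s
    times the identity leaves 4 d^2 (b^2 - ac) plus terms of order |d|^3, and the last hypothesis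
    makes the negative main term dominate. *)
Lemma perturbed_identity (s a b c n11 n12 n21 n22 d K : R) : s ^+ 2 = 1 -> 0 < a -> 0 < c -> 0 <= K ->
  `|n11 - s - d * (s * b)| <= K * d ^+ 2 -> `|n21 + d * (s * a)| <= K * d ^+ 2 ->
  `|n12 - d * (s * c)| <= K * d ^+ 2 -> `|n22 - s + d * (s * b)| <= K * d ^+ 2 ->
  n11 * n22 - n21 * n12 = 1 -> 0 < `|d| -> `|d| <= 1 ->
  `|d| * (8 * K * `|b| + 8 * K ^+ 2 + 4 * K * (a + c)) < 4 * (a * c - b ^+ 2) ->
  (n11 + n22) ^+ 2 < 4.
Proof.
move=> s2 a0 c0 K0 h1 h2 h3 h4 W d0 d1 dE.
have s1 : `|s| = 1 by apply/eqP; rewrite -sqrp_eq1// real_normK ?num_real// s2.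
pose e := `|d|; have e0 : 0 <= e by exact: normr_ge0.
have de : d ^+ 2 = e ^+ 2 by rewrite real_normK ?num_real.
pose X := n11 - n22 - 2 * (d * (s * b)); pose Y := n12 - d * (s * c); pose Z := n21 + d * (s * a).
have X2 : `|X| <= 2 * K * e ^+ 2.
  rewrite (_ : X = (n11 - s - d * (s * b)) - (n22 - s + d * (s * b))); last by rewrite /X; ring.
  apply: le_trans (ler_normB _ _) _; rewrite -de -mulrA mulrDl mul1r; exact: lerD.
have Y2 : `|Y| <= K * e ^+ 2 by rewrite -de.
have Z2 : `|Z| <= K * e ^+ 2 by rewrite -de.
rewrite -subr_lt0 (_ : _ - 4 = 4 * (s ^+ 2 * d ^+ 2) * (b ^+ 2 - a * c) + (4 * (d * (s * b)) * X + X * X +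
   4 * (d * (s * c)) * Z - 4 * (d * (s * a)) * Y + 4 * (Y * Z))); last first.
  by move: W; rewrite /X /Y /Z; lra.
have KE : 0 <= K * e ^+ 2 by rewrite mulr_ge0 ?exprn_ge0.
have e1 : e <= 1 by [].
have Ke : K * e ^+ 2 <= K * e by rewrite expr2 mulrA ler_piMr// mulr_ge0.
have t1 : 4 * (d * (s * b)) * X <= 8 * K * `|b| * e * e ^+ 2.
  apply: le_trans (ler_norm _) _; rewrite !normrM s1 mul1r (ger0_norm (ler0n _ 4)).
  rewrite (_ : 8 * K * _ * e * _ = 4 * (e * `|b|) * (2 * K * e ^+ 2)); last by ring.
  by apply: ler_wpM2l X2; rewrite !mulr_ge0.
have t2 : X * X <= 4 * K ^+ 2 * e * e ^+ 2.
  apply: le_trans (ler_norm _) _; rewrite normrM.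
  apply: (@le_trans _ _ ((2 * K * e ^+ 2) * (2 * K * e))).
    apply: ler_pM => //; apply: le_trans X2 _; rewrite -!mulrA; exact: ler_wpM2l.
  by rewrite le_eqVlt; apply/orP; left; apply/eqP; ring.
have t3 : 4 * (d * (s * c)) * Z <= 4 * K * c * e * e ^+ 2.
  apply: le_trans (ler_norm _) _; rewrite !normrM s1 mul1r (ger0_norm (ler0n _ 4)) (gtr0_norm c0).
  rewrite (_ : 4 * K * _ * e * _ = 4 * (e * c) * (K * e ^+ 2)); last by ring.
  by apply: ler_wpM2l Z2; rewrite !mulr_ge0// ltW.
have t4 : - (4 * (d * (s * a)) * Y) <= 4 * K * a * e * e ^+ 2.
  apply: le_trans (ler_norm _) _; rewrite normrN !normrM s1 mul1r (ger0_norm (ler0n _ 4)) (gtr0_norm a0).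
  rewrite (_ : 4 * K * _ * e * _ = 4 * (e * a) * (K * e ^+ 2)); last by ring.
  by apply: ler_wpM2l Y2; rewrite !mulr_ge0// ltW.
have t5 : 4 * (Y * Z) <= 4 * K ^+ 2 * e * e ^+ 2.
  apply: le_trans (ler_norm _) _; rewrite !normrM (ger0_norm (ler0n _ 4)).
  rewrite (_ : 4 * K ^+ 2 * e * e ^+ 2 = 4 * ((K * e ^+ 2) * (K * e))); last by ring.
  apply: ler_wpM2l => //; apply: ler_pM => //; exact: le_trans Z2 Ke.
have F : e * (8 * K * `|b| + 8 * K ^+ 2 + 4 * K * (a + c)) * e ^+ 2 < 4 * (a * c - b ^+ 2) * e ^+ 2.
  by rewrite ltr_pM2r ?exprn_gt0.
rewrite s2 mul1r de; lra.
Qed.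

Lemma degenerate_gap l : `|disc l| = 2 -> ddisc l = 0 ->
  exists2 e, 0 < e & forall l', 0 < `|l' - l| -> `|l' - l| < e -> `|disc l'| < 2.
Proof.
move=> D2 d0; have [m12 m21 m11 s2] := degenerate_monodromy D2 d0.
have [A0 C0 BAC] := gram_det l; have [K K0 KP] := monodromy_expand l.
set sg := rth l 1 in m11 s2.
pose E := 8 * K * `|gB l| + 8 * K ^+ 2 + 4 * K * (gA l + gC l).
have E0 : 0 <= E by rewrite /E !addr_ge0 ?mulr_ge0 ?addr_ge0 ?sqr_ge0 ?(ltW A0) ?(ltW C0).
have G0 : 0 < 4 * (gA l * gC l - gB l ^+ 2) by rewrite mulr_gt0// subr_gt0.
have E1 : 0 < E + 1 by rewrite ltr_wpDl.
exists (Num.min 1 (4 * (gA l * gC l - gB l ^+ 2) / (E + 1))).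
  by rewrite lt_min ltr01 divr_gt0.
move=> l' l'0; rewrite lt_min ltr_pdivlMr// => /andP[l'1 l'E].
have [h1 h2 h3 h4] := KP l' (ltW l'1).
suff : (disc l') ^+ 2 < 2 ^+ 2 by rewrite -real_normK ?num_real// ltr_pXn2r ?nnegrE.
rewrite (_ : 2 ^+ 2 = 4); last by ring.
move: h1 h2 h3 h4; rewrite -/sg -m11 m12 m21 !mul0r !subr0 !sub0r !mulrN !opprK => h1 h2 h3 h4.
apply: (perturbed_identity s2 A0 C0 K0 h1 h2 h3 h4 (rwronsk l' 1) l'0 (ltW l'1)).
by apply: le_lt_trans l'E; rewrite ler_wpM2l// -/E lerDl.
Qed.
End real_spectral.

(** * Very negative energies *)

Section low_energy.
Variables (R : realType) (Q : R -> R).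
Implicit Types (x y l : R) (a b : R -> R).
Hypotheses (mQ : measurable_fun setT Q) (lQ2 : lint (fun x => Q x ^+ 2)).
Let lQ : lint Q. Proof. exact: lint_sqrt. Qed.
Local Notation rth := (rth mQ lQ2).
Local Notation rth1 := (rth1 mQ lQ2).
Local Notation rph := (rph mQ lQ2).
Local Notation rph1 := (rph1 mQ lQ2).
Local Notation disc := (disc mQ lQ2).
Local Notation rsol := (rsol Q).
Let q := itg (fun t => Q t ^+ 2) 0 1.
Let q0 : 0 <= q. Proof. by apply: itg_ge0 => t _; exact: sqr_ge0. Qed.

Lemma continuous_sq a : continuous a -> continuous (fun x => a x ^+ 2).
Proof. by move=> ca x; exact: (@exprn_continuous' _ _ 2 ca x). Qed.

Lemma rsol_deriv_sq l a a1 : rsol l a a1 -> [/\ lint (fun t => a t ^+ 2),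
  lint (fun t => (a1 t + Q t * a t) ^+ 2), lint (fun t => Q t ^+ 2 * a t ^+ 2) &
  lint (fun t => 2 * `|a t * (a1 t + Q t * a t)|)].
Proof.
move=> h; have [ca ca1] := rsol_cont h; have ca2 := continuous_sq ca.
have la2 : lint (fun t => a t ^+ 2) := lint_cont ca2.
have lQa : lint (fun t => Q t ^+ 2 * a t ^+ 2).
  by apply: lint_ext (lint_mulc ca2 lQ2) => t; rewrite mulrC.
have lp : lint (fun t => (a1 t + Q t * a t) ^+ 2).
  apply: lint_ext (lintD (lintD (lint_cont (continuous_sq ca1)) (lintZ 2 (lint_mulc (continuousM' ca ca1) lQ))) lQa) => t.
  by ring.
split=> //; apply: lintZ; apply: lint_norm.
apply: lint_ext (lintD (lint_cont (continuousM' ca ca1)) (lint_mulc ca2 lQ)) => t; ring.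
Qed.

(** With a' = a1 + Q a the integrand is a'^2 - 2 Q a a' - l a^2, the density of the quadratic form
    shifted by l. *)
Lemma rsol_energy l a a1 : rsol l a a1 -> ac (fun x => a x * a1 x)
  (fun x => (a1 x + Q x * a x) ^+ 2 - 2 * (Q x * a x * (a1 x + Q x * a x)) - l * a x ^+ 2).
Proof. by move=> [A B]; apply: ac_ext (acM A B) => x //; ring. Qed.

                                                                                                 
                                                                                            
(** The cross term 2 Q a a' is absorbed by a'^2/2 + 2 Q^2 a^2, and the integral of Q^2 a^2 is at
    most q sup a^2. The assumed bound on sup a^2 and Young's inequality turn this into a small
    multiple of the integral of a'^2 plus a multiple of the integral of a^2, which the term with -l
    outweighs. *)
Lemma rsol_form_bound l a a1 y : rsol l a a1 -> 0 <= y <= 1 ->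
  l <= - (2 * q * (4 * q + 5) + 1) ->
  (forall x, 0 <= x <= y -> a x ^+ 2 <= itg (fun t => a t ^+ 2) 0 y +
      itg (fun t => 2 * `|a t * (a1 t + Q t * a t)|) 0 y) ->
  itg (fun t => a t ^+ 2) 0 y <= a y * a1 y - a 0 * a1 0.
Proof.
move=> h /andP[y0 y1] lq sup; have [la lp lQa lap] := rsol_deriv_sq h.
have [lE ->] := rsol_energy h => //.
set I := itg (fun t => a t ^+ 2) 0 y in sup *.
pose J := itg (fun t => (a1 t + Q t * a t) ^+ 2) 0 y.
have I0 : 0 <= I by apply: itg_ge0 => t _; exact: sqr_ge0.
have J0 : 0 <= J by apply: itg_ge0 => t _; exact: sqr_ge0.
have q0' : 0 <= q := q0.
have q1 : 0 < 4 * (q + 1) by rewrite mulr_gt0// ltr_wpDl.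
(* This choice gives 2 q e <= 1/2, so the derivative terms are absorbed; 1/e + 1 = 4 q + 5 is the
   factor in the threshold on l. *)
pose e := (4 * (q + 1))^-1; have e0 : 0 < e by rewrite invr_gt0.
have eq1 : e * (4 * (q + 1)) = 1 by rewrite mulVf// lt0r_neq0.
have ap : itg (fun t => 2 * `|a t * (a1 t + Q t * a t)|) 0 y <= e * J + 4 * (q + 1) * I.
  rewrite -!itgZ// -itgD; [|exact: lintZ|exact: lintZ].
  apply: le_itg => //; first by apply: lintD; exact: lintZ.
  move=> t _; set A := a t; set P := a1 t + Q t * A.
  rewrite normrM -[A ^+ 2]real_normK ?num_real// -[P ^+ 2]real_normK ?num_real//.
  have : 0 <= e * (`|P| - 4 * (q + 1) * `|A|) ^+ 2 by rewrite mulr_ge0 ?sqr_ge0 ?ltW.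
  rewrite (_ : e * _ = e * `|P| ^+ 2 - 2 * (e * (4 * (q + 1))) * (`|A| * `|P|) + (e * (4 * (q + 1))) * (4 * (q + 1)) * `|A| ^+ 2); last by ring.
  by rewrite eq1; lra.
pose S := I + (e * J + 4 * (q + 1) * I).
have QS : itg (fun t => Q t ^+ 2 * a t ^+ 2) 0 y <= S * q.
  apply: (@le_trans _ _ (itg (fun t => S * Q t ^+ 2) 0 y)).
    apply: le_itg => //; first exact: lintZ.
    move=> t ty; rewrite mulrC ler_wpM2r ?sqr_ge0// (le_trans (sup t ty))// lerD2l//.
  have S0 : 0 <= S by rewrite /S !addr_ge0// mulr_ge0// ltW.
  rewrite itgZ// ler_wpM2l// /q; apply: itg_ge => // t; exact: sqr_ge0.
have lower : J / 2 - 2 * itg (fun t => Q t ^+ 2 * a t ^+ 2) 0 y - l * I <=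
   itg (fun x => (a1 x + Q x * a x) ^+ 2 - 2 * (Q x * a x * (a1 x + Q x * a x)) - l * a x ^+ 2) 0 y.
  rewrite mulrC -!itgZ//.
  have l1 : lint (fun t => 2^-1 * (a1 t + Q t * a t) ^+ 2) by exact: lintZ.
  have l2 : lint (fun t => 2 * (Q t ^+ 2 * a t ^+ 2)) by exact: lintZ.
  have l3 : lint (fun t => l * a t ^+ 2) by exact: lintZ.
  have l12 := lintB l1 l2.
  rewrite -(itgB _ _ l1 l2) -(itgB _ _ l12 l3); apply: le_itg => //; first exact: lintB.
  move=> t _; rewrite lerD2r; set P := a1 t + _; set w := Q t; set A := a t.
  by have := sqr_ge0 (P - 2 * (w * A)); lra.
apply: le_trans lower.
have qe : 2 * q * e <= 2^-1.
  by clear -eq1 e0; clearbody e q; lra.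
have qeJ : 2 * q * e * J <= 2^-1 * J by rewrite ler_wpM2r.
have lI : l * I <= - (2 * q * (4 * q + 5) + 1) * I by rewrite ler_wpM2r.
rewrite /S in QS; move: QS; clear -qeJ lI; clearbody e I J q; lra.
Qed.

Lemma rsol_sq_osc l a a1 x t y : rsol l a a1 -> 0 <= x <= y -> 0 <= t <= y ->
  a x ^+ 2 <= a t ^+ 2 + itg (fun t => 2 * `|a t * (a1 t + Q t * a t)|) 0 y.
Proof.
move=> h /andP[x0 xy] /andP[t0 ty]; have [_ _ _ lap] := rsol_deriv_sq h.
have [A _] := h; have A2 := acM A A.
have E : (fun s => `|(a1 s + Q s * a s) * a s + a s * (a1 s + Q s * a s)|) =
   (fun s => 2 * `|a s * (a1 s + Q s * a s)|).
  apply/funext => s; rewrite (_ : _ + _ = 2 * (a s * (a1 s + Q s * a s))); last by ring.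
  by rewrite normrM ger0_norm.
have n0 s : 0 <= 2 * `|a s * (a1 s + Q s * a s)| by rewrite mulr_ge0.
rewrite -lerBlDl !expr2; apply: le_trans (ler_norm _) _.
have [xt|/ltW tx] := leP t x.
  by apply: le_trans (ac_norm A2 xt) _; rewrite E; apply: itg_ge.
by rewrite distrC; apply: le_trans (ac_norm A2 tx) _; rewrite E; apply: itg_ge.
Qed.

Lemma form_bound_zero l a a1 y : rsol l a a1 -> 0 <= y <= 1 ->
  l <= - (2 * q * (4 * q + 5) + 1) -> a y = 0 ->
  itg (fun t => a t ^+ 2) 0 y <= a y * a1 y - a 0 * a1 0.
Proof.
move=> h y01 lq ay; apply: (rsol_form_bound h y01 lq) => x xy.
have /andP[y0 _] := y01; have := @rsol_sq_osc _ _ _ x y y h xy; rewrite lexx y0 ay expr0n add0r => /(_ isT) H.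
by rewrite (le_trans H)// lerDr; apply: itg_ge0 => t _; exact: sqr_ge0.
Qed.

(** On the full unit interval the bound on sup a^2 comes from averaging [rsol_sq_osc] over the
    comparison point; in [form_bound_zero] it came from a zero of a. *)
Lemma form_bound_one l a a1 : rsol l a a1 -> l <= - (2 * q * (4 * q + 5) + 1) ->
  itg (fun t => a t ^+ 2) 0 1 <= a 1 * a1 1 - a 0 * a1 0.
Proof.
move=> h lq; apply: (rsol_form_bound h _ lq); first by rewrite ler01 lexx.
move=> x x01; have [la _ _ _] := rsol_deriv_sq h; rewrite -lerBlDr.
set k := itg (fun t => 2 * _) 0 1.
have -> : a x ^+ 2 - k = itg (fun=> a x ^+ 2 - k) 0 1 by rewrite itg_cst// subr0 mulr1.
apply: le_itg => //; first exact: lint_cst.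
by move=> t t01; rewrite lerBlDr; exact: rsol_sq_osc h x01 t01.
Qed.

(** Positivity of the form shows that [rth] has no zero on [0,1] and that a1 a increases from 0 to 1
    for every nonzero solution a. In terms of the monodromy this gives m11 > 0 and m12 m21 > 0,
    hence m11 m22 >= 1 and a trace of at least 2. *)
Lemma disc_low : exists L, forall l, l <= L -> 2 <= disc l.
Proof.
exists (- (2 * q * (4 * q + 5) + 1)) => l lq.
have pos a a1 x y : rsol l a a1 -> 0 < y -> 0 <= x <= y -> 0 < a x ^+ 2 -> 0 < itg (fun t => a t ^+ 2) 0 y.
  move=> h y0 xy ax; have [ca _] := rsol_cont h.
  by apply: (itg_gt0 (continuous_sq ca) _ y0 xy ax) => t; exact: sqr_ge0.
have T0 x : 0 <= x <= 1 -> rth l x != 0.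
  move=> /andP[x0 x1]; apply/eqP => Tx.
  have xn0 : x != 0 by apply/eqP => xE; move: Tx; rewrite xE rth0 => /eqP; rewrite oner_eq0.
  have xp : 0 < x by rewrite lt_def xn0 x0.
  have := form_bound_zero (rth_sol mQ lQ2 l) _ lq Tx; rewrite x0 x1 => /(_ isT).
  rewrite Tx rth10 mul0r mulr0 subrr leNgt.
  by rewrite (pos _ _ 0 _ (rth_sol mQ lQ2 l) xp) ?lexx ?x0// rth0 expr1n ltr01.
have T1 : 0 < rth l 1.
  rewrite ltNge; apply/negP => Tle.
  have [cT _] := rsol_cont (rth_sol mQ lQ2 l).
  have [c c01 Tc] : exists2 c, c \in `[0, 1] & rth l c = 0.
    apply: IVT => //; first exact: continuous_subspaceT.
    by rewrite rth0 ge_min Tle orbT le_max ler01.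
  by have := T0 c; rewrite Tc eqxx => /(_ c01).
have B (s t : R) : ~ (s = 0 /\ t = 0) -> 0 < (s * rth l 1 + t * rph l 1) * (s * rth1 l 1 + t * rph1 l 1) - s * t.
  move=> st; have h := rsolD (rsolZ s (rth_sol mQ lQ2 l)) (rsolZ t (rph_sol mQ lQ2 l)).
  have := form_bound_one h lq; rewrite rth0 rph0 rth10 rph10 !mulr0 !mulr1 addr0 add0r.
  apply: lt_le_trans.
  rewrite (_ : itg _ 0 1 = s ^+ 2 * gA mQ lQ2 l + 2 * s * t * gB mQ lQ2 l + t ^+ 2 * gC mQ lQ2 l); first exact: gram_pos.
  have [cT _] := rsol_cont (rth_sol mQ lQ2 l); have [cP _] := rsol_cont (rph_sol mQ lQ2 l).
  have lA := lint_cont (continuousM' cT cT); have lB := lint_cont (continuousM' cT cP).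
  have lC := lint_cont (continuousM' cP cP).
  rewrite /gA /gB /gC -!itgZ// -itgD; [|exact: lintZ|exact: lintZ].
  rewrite -itgD; [|by apply: lintD; exact: lintZ|exact: lintZ].
  by apply: eq_itg => x _; ring.
have W := rwronsk mQ lQ2 l 1; rewrite discE.
move: T1 W B; set m11 := rth l 1; set m12 := rph l 1; set m21 := rth1 l 1; set m22 := rph1 l 1 => T1 W B.
have b1 : 0 < m11 * m21.
  have := B 1 0; rewrite !mul1r !mul0r !addr0 subr0; apply.
  by move=> [/eqP]; rewrite oner_eq0.
have b2 : 0 < m12 * m22.
  have := B 0 1; rewrite !mul1r !mul0r !add0r subr0; apply.
  by move=> [_ /eqP]; rewrite oner_eq0.
(* The combination with these coefficients vanishes at 1, so only the product of its Cauchy data at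
   0 is left. *)
have b3 := B (- (m12 * m21)) (m11 * m21).
have {}b3 : 0 < (m11 * m21) * (m12 * m21).
  have : ~ (- (m12 * m21) = 0 /\ m11 * m21 = 0) by move=> [_ E]; move: b1; rewrite E ltxx.
  move=> /b3; set V := _ - _.
  have -> : V = (m11 * m21) * (m12 * m21) by rewrite /V; ring.
  by [].
have P0 : 0 < m12 * m21 by rewrite pmulr_rgt0 in b3.
have P1 : 1 <= m11 * m22 by move: W P0; lra.
have m22p : 0 < m22 by have : 0 < m11 * m22 by [exact: lt_le_trans P1]; rewrite pmulr_rgt0.
have := sqr_ge0 (m11 - m22); have : 0 < m11 + m22 by exact: addr_gt0.
by nra.
Qed.
End low_energy.

                          

(** * High energies and the Pruefer angle *)

Section pruefer.
Variables (R : realType) (Q : R -> R).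
Implicit Types (x y l m : R) (a b : R -> R).
Hypotheses (mQ : measurable_fun setT Q) (lQ2 : lint (fun x => Q x ^+ 2)).
Let lQ : lint Q. Proof. exact: lint_sqrt. Qed.
Local Notation rth := (rth mQ lQ2).
Local Notation rth1 := (rth1 mQ lQ2).
Local Notation rph := (rph mQ lQ2).
Local Notation rph1 := (rph1 mQ lQ2).
Local Notation disc := (disc mQ lQ2).

Lemma lipschitz_at_continuous (f : R -> R) x (K : R) :
  (forall y, `|y - x| <= 1 -> `|f y - f x| <= K * `|y - x|) -> {for x, continuous f}.
Proof.
move=> fK; apply/cvgrPdist_lt => e e0.
pose d := Num.min 1 (e / (1 + `|K|)).
have k0 : 0 < 1 + `|K| by rewrite ltr_pwDl.
have d0 : 0 < d by rewrite lt_min ltr01 divr_gt0.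
near=> y; rewrite distrC.
have yd : `|y - x| < d.
  by rewrite distrC; near: y; apply/nbhs_ballP; exists d.
move: yd; rewrite lt_min => /andP[y1 ye].
apply: le_lt_trans (fK y (ltW y1)) _; rewrite ltr_pdivlMr// mulrC in ye.
apply: le_lt_trans ye; rewrite ler_wpM2r// (le_trans (ler_norm K))// lerDr//.
Unshelve. all: by end_near. Qed.

(** An integrating factor E with E' = -k E makes E b constant; E has no zero because it is inverse
    to a solution of F' = k F. *)
Lemma scalar_ac_zero (k b : R -> R) : lint k -> ac b (fun x => k x * b x) -> b 0 = 0 ->
  forall x, b x = 0.
Proof.
move=> lk bk b0.
have ex (c : R -> R) : lint c -> exists2 w, ac w (fun x => c x * w x) & w 0 = 1.
  move=> lc; have [w [wc w0 _]] := @picard_sol _ unit (fun _ _ => c) (fun=> 1) (fun _ _ => lc).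
  exists (w tt) => //; apply: ac_ext (wc tt) => // x.
  by rewrite (big_pred1 tt)//; case.
have [E Ek E0] := ex _ (lintN lk); have [F Fk F0] := ex _ lk.
have EF x : E x * F x = 1.
  rewrite (@ac_const _ _ _ (acM Ek Fk) _ x 0) ?E0 ?F0 ?mulr1//.
  by move=> t; ring.
have Eb x : E x * b x = 0.
  rewrite (@ac_const _ _ _ (acM Ek bk) _ x 0) ?b0 ?mulr0//.
  by move=> t; ring.
by move=> x; rewrite -[b x]mul1r -(EF x) mulrAC Eb mul0r.
Qed.

(** At energy m^2 put u = [rph], v = [rph1]/m and u = r sin T, v = r cos T. Then T' = m + (2uv/r^2)
    Q + (u^2/(m r^2)) Q^2; [pnorm] is m^2 r^2, and [pA], [pB] are the two coefficients. *)
Definition pnorm m t := m ^+ 2 * rph (m ^+ 2) t ^+ 2 + rph1 (m ^+ 2) t ^+ 2.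
Definition pA m t := 2 * m * (rph (m ^+ 2) t * rph1 (m ^+ 2) t) / pnorm m t.
Definition pB m t := m * rph (m ^+ 2) t ^+ 2 / pnorm m t.
                                                                                                       
                          
(** The angle is defined by integrating m + [prate] along the solution already known, so no
    nonlinear equation has to be solved. *)
Definition prate m t := pA m t * Q t + pB m t * Q t ^+ 2.

Lemma pnorm_gt0 m t : 0 < m -> 0 < pnorm m t.
Proof.
move=> m0; have n0 : 0 <= pnorm m t by apply: addr_ge0; [apply: mulr_ge0|]; exact: sqr_ge0.
rewrite lt_def n0 andbT.
apply/eqP => /eqP; rewrite (paddr_eq0 (mulr_ge0 (sqr_ge0 m) (sqr_ge0 _)) (sqr_ge0 _)) mulf_eq0 !sqrf_eq0 (gt_eqF m0) /=.
move=> /andP[/eqP u0 /eqP v0]; have := rwronsk mQ lQ2 (m ^+ 2) t.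
by rewrite u0 v0 !mulr0 subrr => /eqP; rewrite eq_sym oner_eq0.
Qed.

Lemma cdiv (f g : R -> R) : continuous f -> continuous g -> (forall t, g t != 0) ->
  continuous (fun t => f t / g t).
Proof.
move=> cf cg g0; apply: continuousM' => // x.
by apply: continuousV; [exact: g0|exact: cg].
Qed.

Lemma continuousN' (f : R -> R) : continuous f -> continuous (fun t => - f t).
Proof. by move=> cf x; apply: continuousN; exact: cf. Qed.

Lemma pnorm_cont m : continuous (pnorm m).
Proof.
have [cu cv] := rsol_cont (rph_sol mQ lQ2 (m ^+ 2)).
apply: continuousD'; last exact: continuous_sq.
by apply: continuousM' (continuous_sq cu) => x; exact: cst_continuous.
Qed.

Lemma pAB_cont m : 0 < m -> continuous (pA m) /\ continuous (pB m).
Proof.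
move=> m0; have [cu cv] := rsol_cont (rph_sol mQ lQ2 (m ^+ 2)).
have n0 t : pnorm m t != 0 by rewrite gt_eqF ?pnorm_gt0.
have cc (c : R) : continuous (fun _ : R => c) by move=> x; exact: cst_continuous.
split; apply: cdiv => //; try exact: pnorm_cont.
- by apply: continuousM' (cc _) _; exact: continuousM'.
- by apply: continuousM' (cc _) _; exact: continuous_sq.
Qed.

Lemma prate_lint m : 0 < m -> lint (prate m).
Proof. by move=> /pAB_cont[cA cB]; apply: lintD; apply: lint_mulc. Qed.

Lemma pAB_bound m t : 0 < m -> `|pA m t| <= 1 /\ 0 <= pB m t <= m^-1.
Proof.
move=> m0; have n0 := pnorm_gt0 t m0; rewrite /pA /pB.
set u := rph _ t; set v := rph1 _ t; have nE : pnorm m t = m ^+ 2 * u ^+ 2 + v ^+ 2 by [].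
split.
  rewrite normrM normfV (gtr0_norm n0) ler_pdivrMr// mul1r ler_norml nE.
  have := sqr_ge0 (m * u - v); have := sqr_ge0 (m * u + v).
  by move=> h1 h2; apply/andP; split; lra.
apply/andP; split; first by apply: divr_ge0; [apply: mulr_ge0; [exact: ltW|exact: sqr_ge0]|exact: ltW].
rewrite ler_pdivrMr// nE mulrDr.
rewrite (_ : m^-1 * (m ^+ 2 * u ^+ 2) = m * u ^+ 2); first by rewrite lerDl mulr_ge0 ?sqr_ge0 ?invr_ge0 ?ltW.
by field; rewrite gt_eqF.
Qed.

Lemma prate_ge m x : 0 < m -> 0 <= x -> m * x - itg (fun t => `|Q t|) 0 x <= itg (fun t => m + prate m t) 0 x.
Proof.
move=> m0 x0; have -> : m * x = itg (fun=> m) 0 x by rewrite itg_cst// subr0.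
have lc : lint (fun _ : R => m) := lint_cst m; have ln := lint_norm lQ.
rewrite -itgB//; apply: le_itg; [exact: lintB|by apply: lintD => //; exact: prate_lint|].
move=> t _; rewrite lerD2l /prate; have [A1 /andP[B0 _]] := pAB_bound t m0.
rewrite lerNl opprD -[X in _ <= X]addr0 lerD//; last by rewrite oppr_le0 mulr_ge0 ?sqr_ge0.
by rewrite (le_trans (ler_norm _))// normrN normrM ler_piMl.
Qed.

(** It must be shown that the integrated rate really is the polar angle of (v,u). The component b =
    u cos T - v sin T satisfies a scalar linear equation with zero initial value, so it vanishes,
    and the other component, whose square is then u^2 + v^2 > 0, keeps its positive sign. *)
Lemma pruefer_angle m : 0 < m -> let T := itg (fun t => m + prate m t) 0 1 in
  sin T = 0 -> rph (m ^+ 2) 1 = 0 /\ 0 < cos T * rph1 (m ^+ 2) 1.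
Proof.
move=> m0 /=; set F := fun t => _; set l := m ^+ 2.
have lF : lint F by apply: lintD; [exact: lint_cst|exact: prate_lint].
have TE : itg F 0 1 = prim F 1 by rewrite /prim ler01.
rewrite TE; pose u := rph l; pose v t := m^-1 * rph1 l t.
have [U V] := rph_sol mQ lQ2 l; have {}V := acZ m^-1 V.
have TF := ac_primE lF; have C := ac_cos TF; have S := ac_sin TF.
pose k t := (u t ^+ 2 - v t ^+ 2) / (u t ^+ 2 + v t ^+ 2) * Q t
   - u t * v t / (u t ^+ 2 + v t ^+ 2) / m * Q t ^+ 2.
have n0 t : u t ^+ 2 + v t ^+ 2 = m ^- 2 * pnorm m t.
  by rewrite /pnorm /v -/l -/(u t) /l; field; rewrite gt_eqF.
have r0 t : u t ^+ 2 + v t ^+ 2 != 0.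
  by rewrite n0 mulf_neq0// ?invr_eq0 ?expf_neq0// gt_eqF ?pnorm_gt0.
have [cu cv] : continuous u /\ continuous v by split; [exact: ac_cont U|exact: ac_cont V].
have cr : continuous (fun t => u t ^+ 2 + v t ^+ 2) by apply: continuousD'; exact: continuous_sq.
have lk : lint k.
  apply: lintB; apply: lint_mulc => //.
    apply: cdiv => //; apply: continuousD'; first exact: continuous_sq.
    by apply: continuousN'; exact: continuous_sq.
  by apply: cdiv => // [|x|_]; [apply: cdiv => //; exact: continuousM'|exact: cst_continuous|rewrite gt_eqF].
have FE t : F t = m + 2 * Q t * (u t * v t) / (u t ^+ 2 + v t ^+ 2) + Q t ^+ 2 * u t ^+ 2 / (m * (u t ^+ 2 + v t ^+ 2)).
  rewrite n0 /F /prate /pA /pB /v /u -/l; have : pnorm m t != 0 by rewrite gt_eqF ?pnorm_gt0.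
  have : m != 0 by rewrite gt_eqF.
  move: (pnorm m t) (rph l t) (rph1 l t) (Q t) => N a b c mn Nn.
  by rewrite /l; field; rewrite mn Nn.
have b0 : forall x, cos (prim F x) * u x - sin (prim F x) * v x = 0.
  apply: (scalar_ac_zero lk); last by rewrite prim0 sin0 mul0r subr0 /u rph0 mulr0.
  apply: ac_ext (acB (acM C U) (acM S V)) => // t.
  have vE : rph1 l t = m * v t by rewrite /v mulVKf// gt_eqF.
  have r := r0 t; rewrite FE /k -/(u t) -/(v t) vE; move: r.
  have : m != 0 by rewrite gt_eqF.
  rewrite /l; move: (u t) (v t) (Q t) (cos _) (sin _) => a b c C1 S1 mn Nn.
  by field; rewrite mn Nn.
pose a t := cos (prim F t) * v t + sin (prim F t) * u t.
have a2 t : a t ^+ 2 = u t ^+ 2 + v t ^+ 2.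
  have e2 : (cos (prim F t) * u t - sin (prim F t) * v t) ^+ 2 = 0 by rewrite b0 expr0n.
  rewrite -[LHS]addr0 -e2 /a.
  rewrite -[RHS]mul1r -(cos2Dsin2 (prim F t)); ring.
have a0 t : a t != 0 by rewrite -sqrf_eq0 a2.
have ca : continuous a.
  by apply: continuousD'; apply: continuousM' => //; [exact: ac_cont C|exact: ac_cont S].
have a1 : 0 < a 1.
  rewrite ltNge; apply/negP => ale.
  have [c c01 ac0] : exists2 c, c \in `[0, 1] & a c = 0.
    apply: IVT => //; first exact: continuous_subspaceT.
    rewrite /a prim0 cos0 sin0 mul0r mul1r addr0 -/(a 1) ge_min ale orbT le_max /v rph10 mulr1.
    by rewrite invr_ge0 ltW.
  by have := a0 c; rewrite ac0 eqxx.
move=> sT; have := b0 1; move: a1; rewrite /a sT !mul0r addr0 subr0 => a1 /eqP.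
rewrite mulf_eq0 => /orP[/eqP cT|/eqP u1]; first by rewrite cT mul0r ltxx in a1.
by split=> //; move: a1; rewrite /v mulrCA pmulr_rgt0// invr_gt0.
Qed.

Lemma rph_continuous t : 0 <= t <= 1 -> continuous (rph ^~ t) /\ continuous (rph1 ^~ t).
Proof.
move=> t01; split=> l; have [K K0 KP] := rsol_lipschitz mQ lQ2 (`|l| + 1).
- apply: (@lipschitz_at_continuous _ _ K) => l' ll'.
  have nl : `|l'| <= `|l| + 1 by rewrite -(subrK l l') addrC (le_trans (ler_normD _ _))// lerD.
  by have [|//|//|_ _ ? _] := KP l l' t; first by rewrite lerDl.
- apply: (@lipschitz_at_continuous _ _ K) => l' ll'.
  have nl : `|l'| <= `|l| + 1 by rewrite -(subrK l l') addrC (le_trans (ler_normD _ _))// lerD.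
  by have [|//|//|_ _ _ ?] := KP l l' t; first by rewrite lerDl.
Qed.

Lemma disc_continuous : continuous disc.
Proof.
move=> l; have [K K0 KP] := disc_expand mQ lQ2 l.
apply: (@lipschitz_at_continuous _ _ (K + `|ddisc mQ lQ2 l|)) => l' ll'; have := KP _ ll'.
set d := (l' - l) * _ => H.
rewrite -(subrK d (disc l' - disc l)) (le_trans (ler_normD _ _))// mulrDl lerD//; last by rewrite normrM mulrC.
apply: le_trans H _; rewrite -[X in _ * X]real_normK ?num_real// expr2 mulrA ler_piMr// mulr_ge0//.
Qed.

Lemma max_continuous (a : R) : continuous (Num.max a).
Proof.
move=> x; apply: (@lipschitz_at_continuous _ _ 1) => y _; rewrite mul1r.
have h1 := ler_norm (y - x); have h2 := ler_norm (- (y - x)); rewrite normrN in h2.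
by rewrite ler_norml; case: (leP a x) => ax; case: (leP a y) => ay; apply/andP; split; lra.
Qed.

Lemma min_continuous (a : R) : continuous (Num.min a).
Proof.
move=> x; apply: (@lipschitz_at_continuous _ _ 1) => y _; rewrite mul1r.
have h1 := ler_norm (y - x); have h2 := ler_norm (- (y - x)); rewrite normrN in h2.
by rewrite ler_norml; case: (leP a x) => ax; case: (leP a y) => ay; apply/andP; split; lra.
Qed.

(** Dependence on the energy is controlled only for t in [0,1], whereas [itg_dct] requires
    convergence and domination at every t. *)
Definition clamp01 (t : R) := Num.max 0 (Num.min 1 t).

Lemma clamp01_continuous : continuous clamp01.
Proof. by move=> t; apply: continuous_comp; [exact: min_continuous|exact: max_continuous]. Qed.

Lemma clamp01P t : 0 <= clamp01 t <= 1.
Proof. by rewrite /clamp01 le_max lexx ge_max ler01 ge_min lexx. Qed.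

Lemma clamp01_id t : 0 <= t <= 1 -> clamp01 t = t.
Proof. by move=> /andP[t0 t1]; rewrite /clamp01 min_r// max_r. Qed.

Lemma pAB_continuous_energy t m : 0 <= t <= 1 -> 0 < m ->
  {for m, continuous (pA ^~ t)} /\ {for m, continuous (pB ^~ t)}.
Proof.
move=> t01 m0; have [cu cv] := rph_continuous t01.
have ci : continuous (fun m : R => m) by move=> x.
have c2 : continuous (fun m : R => m ^+ 2) := continuous_sq ci.
have cu2 : continuous (fun m => rph (m ^+ 2) t).
  by move=> x; apply: (@continuous_comp _ _ _ (fun m : R => m ^+ 2) (rph ^~ t)); [exact: c2|exact: cu].
have cv2 : continuous (fun m => rph1 (m ^+ 2) t).
  by move=> x; apply: (@continuous_comp _ _ _ (fun m : R => m ^+ 2) (rph1 ^~ t)); [exact: c2|exact: cv].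
have cN : continuous (pnorm ^~ t).
  by apply: continuousD'; [apply: continuousM' => //|]; exact: continuous_sq.
have cNV : {for m, continuous (fun m => (pnorm m t)^-1)}.
  by apply: continuousV; [rewrite gt_eqF ?pnorm_gt0|exact: cN].
have c2m : continuous (fun m : R => 2 * m).
  by apply: continuousM' => // x; exact: cst_continuous.
have P (f g : R -> R) : {for m, continuous f} -> {for m, continuous g} ->
    {for m, continuous (fun x => f x * g x)} by move=> cf cg; apply: continuousM.
split; apply: P => //.
- by apply: (continuousM' c2m (continuousM' cu2 cv2)).
- by apply: (continuousM' ci (continuous_sq cu2)).
Qed.

(** Dominated convergence; truncating m from below at a keeps 1/m at most 1/a, so |Q| + Q^2/a
    majorises all the rates. *)
Lemma pruefer_continuous (a : R) : 0 < a ->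
  continuous (fun m => itg (prate (Num.max a m)) 0 1).
Proof.
move=> a0 m; apply/(@cvg_nbhsP _ R^o) => w wm.
pose M s := Num.max a s; have M0 s : 0 < M s by rewrite lt_max a0.
have ms s : (M s)^-1 <= a^-1 by rewrite lef_pV2 ?posrE// le_max lexx.
pose f s t := pA (M s) (clamp01 t) * Q t + pB (M s) (clamp01 t) * Q t ^+ 2.
have fE s : itg (prate (M s)) 0 1 = itg (f s) 0 1.
  by apply: eq_itg => t t01; rewrite /f clamp01_id.
have lf s : lint (f s).
  have [cA cB] := pAB_cont (M0 s).
  apply: lintD; apply: lint_mulc => //.
    by move=> t; apply: continuous_comp; [exact: clamp01_continuous|exact: cA].
  by move=> t; apply: continuous_comp; [exact: clamp01_continuous|exact: cB].
have lg : lint (fun t => `|Q t| + a^-1 * Q t ^+ 2).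
  by apply: lintD; [exact: lint_norm|exact: lintZ].
under eq_fun do rewrite fE; rewrite fE.
have [|||_ H] := @itg_dct _ (fun n => f (w n)) (f m) _ _ _ lg; [by []| | |exact: H].
- move=> t; have [cA cB] := pAB_continuous_energy (clamp01P t) (M0 m).
  have wM : (fun n => M (w n)) @ \oo --> M m by apply: (cvg_comp _ _ wm); exact: max_continuous.
  apply: cvgD; apply: cvgM; try exact: cvg_cst.
    exact: (cvg_comp _ _ wM cA).
  exact: (cvg_comp _ _ wM cB).
- move=> n t; have [A1 /andP[B0 B1]] := pAB_bound (clamp01 t) (M0 (w n)).
  rewrite /f (le_trans (ler_normD _ _))// lerD//; first by rewrite normrM ler_piMl.
  by rewrite normrM (ger0_norm B0) (ger0_norm (sqr_ge0 _)) ler_wpM2r ?sqr_ge0// (le_trans B1).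
Qed.

(** The intermediate value theorem in m: by [prate_ge] the total angle is at least m minus the
    integral of |Q|, which exceeds any target for large m. *)
Lemma pruefer_hits (a : R) (k : nat) : 0 < a -> itg (fun t => a + prate a t) 0 1 <= k%:R * pi ->
  exists2 m, a <= m & itg (fun t => m + prate m t) 0 1 = k%:R * pi.
Proof.
move=> a0 ak; pose G m := m + itg (prate (Num.max a m)) 0 1.
have GE m : a <= m -> itg (fun t => m + prate m t) 0 1 = G m.
  move=> am; rewrite itgD; [|exact: lint_cst|by apply: prate_lint; exact: lt_le_trans am].
  by rewrite (itg_cst _ ler01) subr0 mulr1 /G max_r.
have cG : continuous G by apply: continuousD' (pruefer_continuous a0) => x.
pose b := Num.max a (k%:R * pi + itg (fun t => `|Q t|) 0 1).
have ab : a <= b by rewrite le_max lexx.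
have Gb : k%:R * pi <= G b.
  have := @prate_ge b 1 (lt_le_trans a0 ab) ler01; rewrite GE// mulr1.
  by apply: le_trans; rewrite lerBrDr le_max lexx orbT.
have [c /andP[]] : exists2 c, c \in `[a, b] & G c = k%:R * pi.
  apply: IVT => //; first exact: continuous_subspaceT.
  by rewrite ge_min -GE ?lexx// ak le_max Gb orbT.
by rewrite !bnd_simp => ac _ Gc; exists c => //; rewrite GE.
Qed.

(** At a Dirichlet eigenvalue the monodromy is triangular with diagonal entries v and 1/v, and v +
    1/v >= 2 when v > 0. *)
Lemma disc_sum_ge2 l : rph l 1 = 0 -> 0 < rph1 l 1 -> 2 <= disc l.
Proof.
move=> u0 v0; have := rwronsk mQ lQ2 l 1; rewrite u0 mulr0 subr0 discE => W.
have := sqr_ge0 (rth l 1 - rph1 l 1).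
have r0 : 0 < rth l 1 by rewrite -(pmulr_lgt0 _ v0) W ltr01.
by have := addr_gt0 r0 v0; nra.
Qed.

Lemma disc_sum_leN2 l : rph l 1 = 0 -> rph1 l 1 < 0 -> disc l <= - 2.
Proof.
move=> u0 v0; have := rwronsk mQ lQ2 l 1; rewrite u0 mulr0 subr0 discE => W.
have := sqr_ge0 (rth l 1 - rph1 l 1).
have r0 : rth l 1 < 0 by rewrite -(nmulr_lgt0 _ v0) W ltr01.
by rewrite -oppr_gt0 in r0; rewrite -oppr_gt0 in v0; have := addr_gt0 r0 v0; nra.
Qed.

(** When the total angle is k pi, the energy is a Dirichlet eigenvalue and the sign of [rph1] at 1
    is (-1)^k. Even and odd large k give the two alternatives. *)
Lemma disc_oscillates (L : R) : (exists2 l, L < l & 2 <= disc l) /\ (exists2 l, L < l & disc l <= -2).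
Proof.
pose a := `|L| + 1; have a1 : 1 <= a by rewrite lerDr.
have a0 : 0 < a := lt_le_trans ltr01 a1.
pose T := itg (fun t => a + prate a t) 0 1.
(* From K on, k pi exceeds the total angle at m = a, as [pruefer_hits] requires. *)
pose K := (Num.trunc (`|T| / pi)).+1.
have KT (k : nat) : (K <= k)%N -> T <= k%:R * pi.
  move=> Kk; rewrite -ler_pdivrMr ?pi_gt0//.
  have h : `|T| / pi < K%:R by rewrite Num.Theory.truncnS_gt.
  rewrite (@le_trans _ _ (`|T| / pi))//; first by rewrite ler_wpM2r ?invr_ge0 ?pi_ge0 ?ler_norm.
  by rewrite (le_trans (ltW h))// ler_nat.
have K2 : (K <= K.*2)%N by rewrite -addnn leq_addr.
have big m : a <= m -> L < m ^+ 2.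
  move=> am; apply: le_lt_trans (ler_norm L) _.
  have : `|L| + 1 <= m by [].
  by have := normr_ge0 L; nra.
have cosk (k : nat) : cos (k%:R * pi) = (-1) ^+ k :> R.
  by have := alternatingn (@cosDpi R) k 0; rewrite add0r cos0 mulr1 mulr_natl.
have sink (k : nat) : sin (k%:R * pi) = 0 :> R.
  by have := alternatingn (@sinDpi R) k 0; rewrite add0r sin0 mulr0 mulr_natl.
split.
- have [m am mk] := pruefer_hits a0 (KT (K.*2)%N K2).
  exists (m ^+ 2); first exact: big.
  have := pruefer_angle (lt_le_trans a0 am); rewrite /= mk => /(_ (sink _))[u0].
  by rewrite cosk -signr_odd odd_double expr0 mul1r; exact: disc_sum_ge2.
- have [m am mk] := pruefer_hits a0 (KT (K.*2.+1)%N (leqW K2)).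
  exists (m ^+ 2); first exact: big.
  have := pruefer_angle (lt_le_trans a0 am); rewrite /= mk => /(_ (sink _))[u0].
  rewrite cosk -signr_odd /= odd_double expr1 mulN1r oppr_gt0; exact: disc_sum_leN2.
Qed.
End pruefer.

                                                

(** * Band structure from local properties of a discriminant *)

Section bands.
Variable R : realType.
Implicit Types (f df : R -> R) (x y a b : R).

(** What is kept of the discriminant: [df] is its derivative with quadratic remainder, it does not
    vanish where |f| < 2, and a critical point at level 2 or -2 has |f| < 2 on both sides. The
    conditions are symmetric under f to -f. *)
Definition bandlike f df := [/\ continuous f,
  forall x, exists2 K, 0 <= K & forall y, `|y - x| <= 1 ->
    `|f y - f x - (y - x) * df x| <= K * (y - x) ^+ 2,
  forall x, `|f x| < 2 -> df x != 0 &
  forall x, `|f x| = 2 -> df x = 0 ->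
    exists2 e, 0 < e & forall y, 0 < `|y - x| -> `|y - x| < e -> `|f y| < 2].

Lemma bandlikeN f df : bandlike f df -> bandlike (fun x => - f x) (fun x => - df x).
Proof.
move=> [cf hexp h1 h2]; split.
- exact: continuousN'.
- move=> x; have [K K0 KP] := hexp x; exists K => // y yx.
  have -> : - f y - - f x - (y - x) * - df x = - (f y - f x - (y - x) * df x) by ring.
  by rewrite normrN; exact: KP.
- by move=> x; rewrite normrN oppr_eq0; exact: h1.
- move=> x; rewrite normrN => fx /eqP; rewrite oppr_eq0 => /eqP dx.
  by have [e e0 eP] := h2 x fx dx; exists e => // y y1 y2; rewrite normrN; exact: eP.
Qed.

Section one.
Variables (f df : R -> R).
Hypothesis H : bandlike f df.

Lemma deriv_sign x : 0 < df x -> exists2 e, 0 < e &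
  forall h, 0 < h -> h < e -> f x < f (x + h) /\ f (x - h) < f x.
Proof.
move=> d0; have [_ /(_ x)[K K0 KP] _ _] := H.
pose e := Num.min 1 (df x / (K + 1)).
have K1 : 0 < K + 1 by rewrite ltr_wpDl.
exists e; first by rewrite lt_min ltr01 divr_gt0.
move=> h h0; rewrite lt_min => /andP[h1 he].
rewrite ltr_pdivlMr// in he.
have hK : K * h ^+ 2 < h * df x.
  rewrite expr2 mulrA mulrC ltr_pM2l//; apply: le_lt_trans he.
  by rewrite mulrDr mulr1 mulrC lerDl ltW.
split.
- have := KP (x + h); rewrite addrAC subrr add0r gtr0_norm// => /(_ (ltW h1)).
  by rewrite ler_norml => /andP[]; lra.
- have := KP (x - h); rewrite addrAC subrr add0r normrN gtr0_norm// sqrrN => /(_ (ltW h1)).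
  by rewrite ler_norml => /andP[]; lra.
Qed.
End one.

Section two.
Variables (f df : R -> R).
Hypothesis H : bandlike f df.

Lemma local_min_critical x e : 0 < e -> (forall y, `|y - x| < e -> f x <= f y) -> df x = 0.
Proof.
move=> e0 fx; apply/eqP; apply: contraT; rewrite neq_lt => /orP[] d0.
- have := @deriv_sign _ _ (bandlikeN H) x; rewrite oppr_gt0 => /(_ d0)[e' e'0 /(_ (Num.min e e' / 2))].
  have m0 : 0 < Num.min e e' by rewrite lt_min e0.
  have m2 : Num.min e e' / 2 < Num.min e e' by rewrite ltr_pdivrMr// ltr_pMr// ltr1n.
  move: (m2); rewrite lt_min => /andP[me me'].
  move=> [||+ _]; rewrite ?divr_gt0//.
  by rewrite ltrN2 ltNge fx// addrAC subrr add0r gtr0_norm// divr_gt0.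
- have [e' e'0 /(_ (Num.min e e' / 2))] := deriv_sign H d0.
  have m0 : 0 < Num.min e e' by rewrite lt_min e0.
  have m2 : Num.min e e' / 2 < Num.min e e' by rewrite ltr_pdivrMr// ltr_pMr// ltr1n.
  move: (m2); rewrite lt_min => /andP[me me'].
  move=> [||_]; rewrite ?divr_gt0//.
  by rewrite ltNge fx// addrAC subrr add0r normrN gtr0_norm// divr_gt0.
Qed.

(** If f(x) were 2, x would be a local minimum, hence critical, and then |f| < 2 next to x. *)
Lemma gap_strict x e : 0 < e -> (forall y, `|y - x| < e -> 2 <= f y) -> 2 < f x.
Proof.
move=> e0 fe; have fx : 2 <= f x by apply: fe; rewrite subrr normr0.
rewrite lt_def fx andbT; apply/eqP => fx2.
have d0 : df x = 0 by apply: (local_min_critical e0) => y ye; rewrite fx2; exact: fe.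
have [_ _ _ /(_ x)] := H; rewrite fx2 ger0_norm// => /(_ erefl d0)[e' e'0 /(_ (x + Num.min e e' / 2))].
have m0 : 0 < Num.min e e' by rewrite lt_min e0.
have m2 : Num.min e e' / 2 < Num.min e e' by rewrite ltr_pdivrMr// ltr_pMr// ltr1n.
move: (m2); rewrite lt_min => /andP[me me'].
rewrite addrAC subrr add0r gtr0_norm ?divr_gt0// => /(_ isT me').
by rewrite ltNge (le_trans _ (ler_norm _))// fe// addrAC subrr add0r gtr0_norm ?divr_gt0.
Qed.

Lemma cont_ball x e : 0 < e -> exists2 d, 0 < d & forall y, `|y - x| < d -> `|f y - f x| < e.
Proof.
move=> e0; have [cf _ _ _] := H.
have /cvgrPdist_lt/(_ _ e0)/nbhs_ballP[d d0 dP] := cf x.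
by exists d => // y yx; rewrite distrC; apply: dP; rewrite /ball /= distrC.
Qed.

(** The point b is the infimum of the later points where f < 2; [gap_strict] makes the inequality
    strict inside the gap. When a already is the exit point, b = a and the gap is empty. *)
Lemma gap_end a : 2 <= f a -> (exists2 x, a < x & f x < 2) ->
  exists b, [/\ a <= b, f b = 2, forall x, a < x < b -> 2 < f x &
    exists2 e, 0 < e & forall x, b < x < b + e -> f x < 2].
Proof.
move=> fa [x0 ax0 fx0]; pose A := [set x | a < x /\ f x < 2].
have A0 : A !=set0 by exists x0.
have lA : has_lbound A by exists a => x [/ltW].
have hA : has_inf A by split.
pose b := inf A.
have ab : a <= b by apply: lb_le_inf => // x [/ltW].
have bge x : a < x < b -> 2 <= f x.
  move=> /andP[ax xb]; rewrite leNgt; apply/negP => fx.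
  by have := ge_inf lA (conj ax fx : A x); rewrite leNgt xb.
have bnear e : 0 < e -> exists2 x, A x & b <= x < b + e.
  move=> e0; have [x Ax xe] := inf_adherent e0 hA; exists x => //.
  by rewrite xe andbT; exact: ge_inf.
have fb : 2 <= f b.
  have [->//|nab] := eqVneq b a; have {}nab : a < b by rewrite lt_def nab.
  rewrite leNgt; apply/negP => fb.
  have e0 : 0 < 2 - f b by rewrite subr_gt0.
  have [d d0 dP] := cont_ball b e0.
  pose y := b - Num.min (b - a) d / 2.
  have m0 : 0 < Num.min (b - a) d by rewrite lt_min subr_gt0 nab.
  have m2 : Num.min (b - a) d / 2 < Num.min (b - a) d by rewrite ltr_pdivrMr// ltr_pMr// ltr1n.
  move: (m2); rewrite lt_min => /andP[me me'].
  have h0 : 0 < Num.min (b - a) d / 2 by rewrite divr_gt0.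
  have := dP y; rewrite /y addrAC subrr add0r normrN gtr0_norm// => /(_ me').
  have := bge y; rewrite /y => /(_ _)H1.
  have : 2 <= f (b - Num.min (b - a) d / 2) by apply: H1; apply/andP; split; lra.
  by rewrite ltr_norml => ? /andP[_]; lra.
have fb2 : f b = 2.
  apply/eqP; rewrite eq_le fb andbT leNgt; apply/negP => fb'.
  have e0 : 0 < f b - 2 by rewrite subr_gt0.
  have [d d0 dP] := cont_ball b e0.
  have [x [ax fx] /andP[bx xd]] := bnear _ d0.
  have := dP x; rewrite ger0_norm ?subr_ge0// => /(_ ltac:(lra)).
  by rewrite ltr_norml => /andP[]; lra.
exists b; split=> //.
- move=> x /andP[ax xb]; apply: (@gap_strict x (Num.min (x - a) (b - x))).
    by rewrite lt_min !subr_gt0 ax.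
  move=> y; rewrite lt_min => /andP[y1 y2]; apply: bge.
  by move: y1 y2; rewrite !ltr_norml => /andP[? ?] /andP[? ?]; apply/andP; split; lra.
(* A negative derivative gives the exit at once; a positive one contradicts that points with f < 2
   accumulate at b from the right; a zero one is the degenerate case. *)
- have [d0|d0|d0] := ltgtP (df b) 0.
  + have := @deriv_sign _ _ (bandlikeN H) b; rewrite oppr_gt0 => /(_ d0)[e e0 eP].
    exists e => // x /andP[bx xe]; have := eP (x - b); rewrite subr_gt0 => /(_ bx).
    rewrite ltrBlDl => /(_ xe)[+ _]; rewrite addrC subrK ltrN2 fb2//.
  + have [e e0 eP] := deriv_sign H d0.
    have [x [ax fx] /andP[bx xd]] := bnear _ e0.
    have nbx : b < x by rewrite lt_def bx andbT; apply/eqP => xb; move: fx; rewrite xb fb2 ltxx.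
    have := eP (x - b); rewrite subr_gt0 => /(_ nbx).
    rewrite ltrBlDl => /(_ xd)[+ _]; rewrite addrC subrK fb2 => /lt_trans /(_ fx).
    by rewrite ltxx.
  + have [_ _ _ /(_ b)] := H; rewrite fb2 ger0_norm// => /(_ erefl d0)[e e0 eP].
    exists e => // x /andP[bx xe]; apply: le_lt_trans (ler_norm _) _.
    by apply: eP; rewrite gtr0_norm ?subr_gt0// ltrBlDl.
Qed.

(** The point b is the first later point where f reaches -2. A return to level 2 before b would
    produce an interior minimum with |f| < 2, a forbidden critical point. *)
Lemma band_end a e : f a = 2 -> 0 < e -> (forall x, a < x < a + e -> f x < 2) ->
  (exists2 x, a < x & f x <= -2) ->
  exists b, [/\ a < b, f b = -2 & forall x, a < x < b -> `|f x| < 2].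
Proof.
move=> fa e0 fe [x0 ax0 fx0]; pose A := [set x | a < x /\ f x <= -2].
have A0 : A !=set0 by exists x0.
have lA : has_lbound A by exists a => x [/ltW].
have hA : has_inf A by split.
pose b := inf A.
have ab : a <= b by apply: lb_le_inf => // x [/ltW].
have bgt x : a < x < b -> -2 < f x.
  move=> /andP[ax xb]; rewrite ltNge; apply/negP => fx.
  by have := ge_inf lA (conj ax fx : A x); rewrite leNgt xb.
have bnear e' : 0 < e' -> exists2 x, A x & b <= x < b + e'.
  move=> e'0; have [x Ax xe] := inf_adherent e'0 hA; exists x => //.
  by rewrite xe andbT; exact: ge_inf.
have fb : f b <= -2.
  rewrite leNgt; apply/negP => fb'.
  have e1 : 0 < f b + 2 by rewrite -[2]opprK subr_gt0.
  have [d d0 dP] := cont_ball b e1.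
  have [x [ax fx] /andP[bx xd]] := bnear _ d0.
  have := dP x; rewrite ger0_norm ?subr_ge0// => /(_ ltac:(lra)).
  by rewrite ltr_norml => /andP[]; lra.
have {}ab : a < b.
  by rewrite lt_def ab andbT; apply/eqP => ba; move: fb; rewrite ba fa; lra.
have fb2 : f b = -2.
  apply/eqP; rewrite eq_le fb leNgt; apply/negP => fb'.
  have e1 : 0 < -2 - f b by rewrite subr_gt0.
  have [d d0 dP] := cont_ball b e1.
  pose y := b - Num.min (b - a) d / 2.
  have m0 : 0 < Num.min (b - a) d by rewrite lt_min subr_gt0 ab.
  have m2 : Num.min (b - a) d / 2 < Num.min (b - a) d by rewrite ltr_pdivrMr// ltr_pMr// ltr1n.
  move: (m2); rewrite lt_min => /andP[me me'].
  have h0 : 0 < Num.min (b - a) d / 2 by rewrite divr_gt0.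
  have := dP y; rewrite /y addrAC subrr add0r normrN gtr0_norm// => /(_ me').
  have : -2 < f y by apply: bgt; rewrite /y; apply/andP; split; lra.
  by rewrite /y ltr_norml => ? /andP[_]; lra.
exists b; split=> // x /andP[ax xb].
rewrite ltr_norml (bgt _ _) ?ax//= ltNge; apply/negP => fx.
have [cf _ h1 _] := H.
have [c + cmin] := EVT_min (ltW ax) (continuous_subspaceT cf : {within `[a, x], continuous f}).
rewrite in_itv /= => /andP[ac cx].
pose y := a + Num.min (x - a) e / 2.
have m0 : 0 < Num.min (x - a) e by rewrite lt_min subr_gt0 ax.
have m2 : Num.min (x - a) e / 2 < Num.min (x - a) e by rewrite ltr_pdivrMr// ltr_pMr// ltr1n.
move: (m2); rewrite lt_min => /andP[me me'].
have h0 : 0 < Num.min (x - a) e / 2 by rewrite divr_gt0.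
have fy : f y < 2 by apply: fe; rewrite /y; apply/andP; split; lra.
have fc : f c < 2.
  by apply: le_lt_trans fy; apply: cmin; rewrite in_itv /= /y; apply/andP; split; lra.
have {}ac : a < c by rewrite lt_def ac andbT; apply/eqP => ca; move: fc; rewrite ca fa ltxx.
have {}cx : c < x by rewrite lt_def cx andbT; apply/eqP => xc; move: fx; rewrite xc leNgt fc.
have : df c != 0 by apply: h1; rewrite ltr_norml fc bgt// ac (lt_trans cx).
apply/negP; rewrite negbK; apply/eqP; apply: (@local_min_critical c (Num.min (c - a) (x - c))).
  by rewrite lt_min !subr_gt0 ac.
move=> z; rewrite lt_min !ltr_norml => /andP[/andP[? ?] /andP[? ?]].
by apply: cmin; rewrite in_itv /=; apply/andP; split; lra.
Qed.
End two.

Section structure.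
Variables (D d : R -> R).
Hypothesis H : bandlike D d.
Hypothesis low : exists L, forall x, x <= L -> 2 <= D x.
Hypothesis osc : forall L, (exists2 x, L < x & 2 <= D x) /\ (exists2 x, L < x & D x <= -2).

(** With the sign (-1)^k every band starts at level 2 and goes down to -2, so one pair of lemmas
    serves bands of either direction. *)
Let sg (k : nat) x : R := (-1) ^+ k * D x.
Let dsg (k : nat) x : R := (-1) ^+ k * d x.

Let sgS k x : sg k.+1 x = - sg k x.
Proof. by rewrite /sg exprS mulN1r mulNr. Qed.

Let sg_norm k x : `|sg k x| = `|D x|.
Proof. by rewrite normrM normrX normrN1 expr1n mul1r. Qed.

Let sg_bandlike k : bandlike (sg k) (dsg k).
Proof.
elim: k => [|k IH].
  have -> : sg 0 = D by apply/funext => x; rewrite /sg expr0 mul1r.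
  by have -> : dsg 0 = d by apply/funext => x; rewrite /dsg expr0 mul1r.
have -> : sg k.+1 = fun x => - sg k x by apply/funext => x; rewrite sgS.
have -> : dsg k.+1 = fun x => - dsg k x by apply/funext => x; rewrite /dsg exprS mulN1r mulNr.
exact: bandlikeN.
Qed.

Let sg_osc k L : exists2 x, L < x & sg k x <= -2.
Proof.
have [[x Lx x2] [y Ly y2]] := osc L; rewrite /sg -signr_odd; case: odd.
- by exists x => //; rewrite expr1 mulN1r lerN2.
- by exists y => //; rewrite expr0 mul1r.
Qed.

(** The invariant of the recursion: p is a left endpoint of band k, with the signed discriminant
    leaving level 2 downwards. *)
Let start k p := sg k p = 2 /\ exists2 e, 0 < e & forall x, p < x < p + e -> sg k x < 2.

Let step k p : start k p -> exists qr : R * R,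
  [/\ p < qr.1, qr.1 <= qr.2, sg k.+1 qr.1 = 2 /\ start k.+1 qr.2,
    forall x, p < x < qr.1 -> `|D x| < 2 & forall x, qr.1 < x < qr.2 -> 2 < `|D x|].
Proof.
move=> [p2 [e e0 eP]].
have [q [pq q2 qb]] := band_end (sg_bandlike k) p2 e0 eP (sg_osc k p).
have q2' : sg k.+1 q = 2 by rewrite sgS q2 opprK.
have [||r [qr r2 gap exit]] := @gap_end _ _ (sg_bandlike k.+1) q; first by rewrite q2'.
  have [x qx x2] := sg_osc k.+1 q; exists x => //; apply: le_lt_trans x2 _; lra.
exists (q, r); split=> //= x xqr; first by rewrite -(sg_norm k); exact: qb.
by rewrite -(sg_norm k.+1); apply: lt_le_trans (gap x xqr) (ler_norm _).
Qed.

(** Band and gap ends are produced alternately, starting from the first exit from level 2. No point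
    is missed, because the left endpoints tend to infinity. *)
Lemma band_structure : exists lp lm : nat -> R,
  [/\ forall k, lp k < lm k.+1 /\ lm k.+1 <= lp k.+1,
      forall k, (-1) ^+ k * D (lp k) = 2,
      forall k, (-1) ^+ k.+1 * D (lm k.+1) = 2,
      forall x, `|D x| <= 2 <-> exists k, lp k <= x <= lm k.+1 &
      forall x, ~ `|D x| <= 2 <-> x < lp 0%N \/ exists k, lm k.+1 < x < lp k.+1].
Proof.
have [L LP] := low.
have L1 : L - 1 <= L by rewrite lerBlDr lerDl.
have [||l0 [l0L D0 D0gt exit0]] := @gap_end _ _ (sg_bandlike 0) (L - 1).
- by rewrite /sg mul1r LP.
- by have [x Lx x2] := sg_osc 0 (L - 1); exists x => //; apply: le_lt_trans x2 _; lra.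
have Dlow x : x < l0 -> 2 < `|D x|.
  move=> xl0; apply: lt_le_trans (ler_norm _); have [xL|Lx] := leP x (L - 1); last first.
    by have := D0gt x; rewrite Lx xl0 /sg mul1r; exact.
  apply: (@gap_strict _ _ H x 1) => // y; rewrite ltr_norml => /andP[_ ?]; apply: LP; lra.
(* The step is made total, with the dummy (0, 0) off the invariant, so that choice applies to all
   pairs. *)
have stepE (kp : nat * R) : exists qr : R * R, start kp.1 kp.2 ->
  [/\ kp.2 < qr.1, qr.1 <= qr.2, sg kp.1.+1 qr.1 = 2 /\ start kp.1.+1 qr.2,
    forall x, kp.2 < x < qr.1 -> `|D x| < 2 & forall x, qr.1 < x < qr.2 -> 2 < `|D x|].
  case: kp => k p /=; have [s|ns] := pselect (start k p); last by exists (0, 0).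
  by have [qr qrP] := step s; exists qr.
have [F FP] := boolp.choice stepE.
pose lp := fix lp k := if k is k'.+1 then (F (k', lp k')).2 else l0.
(* Band k runs from [lp k] to [lm k.+1]; the value [lm 0] is a dummy. *)
pose lm k := (F (k.-1, lp k.-1)).1.
have lpP k : start k (lp k).
  elim: k => [|k IH]; first by split.
  by have [_ _ [_ ?] _ _] := FP (k, lp k) IH.
have FPk k := FP (k, lp k) (lpP k).
have mono k : lp k < lm k.+1 /\ lm k.+1 <= lp k.+1 by have [? ? _ _ _] := FPk k.
have lpS k : lp k < lp k.+1 by have [h1 h2] := mono k; exact: lt_le_trans h2.
have lp2 k : sg k (lp k) = 2 by have [] := lpP k.
have lm2 k : sg k.+1 (lm k.+1) = 2 by have [_ _ []] := FPk k.
(* Bounded left endpoints would accumulate at their supremum, where continuity of D is incompatible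
   with the alternating values 2 and -2. *)
have unbounded x : exists k, x < lp k.
  apply: contrapT => /forallNP nx.
  have ub k : lp k <= x by rewrite leNgt; apply/negP; exact: nx.
  pose S := range lp.
  have hS : has_sup S by split; [exists (lp 0%N), 0%N|exists x => _ [k _ <-]].
  have [e e0 eP] := cont_ball H (sup S) ltr01.
  have [_ [k _ <-] ke] := sup_adherent e0 hS.
  have S1 j : lp j <= sup S by apply: ub_le_sup; [case: hS|exists j].
  have near j : (k <= j)%N -> `|D (lp j) - D (sup S)| < 1.
    move=> kj; apply: eP; rewrite distrC ger0_norm ?subr_ge0// ltrBlDr -ltrBlDl.
    have : lp k <= lp j.
      elim: j kj => [|j IH]; first by rewrite leqn0 => /eqP ->.
      by rewrite leq_eqVlt => /predU1P[->//|/IH/le_trans]; apply; exact: ltW.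
    by lra.
  have := near k (leqnn _); have := near k.+1 (leqnSn _).
  have := lp2 k; have := lp2 k.+1; rewrite sgS /sg -signr_odd.
  rewrite !ltr_norml; case: odd; rewrite ?expr1 ?expr0 ?mul1r ?mulN1r => ? ? /andP[? ?] /andP[? ?]; lra.
have Din k x : lp k <= x <= lm k.+1 -> `|D x| <= 2.
  move=> /andP[]; rewrite le_eqVlt => /predU1P[<- _|x1]; first by rewrite -(sg_norm k) lp2 ger0_norm.
  rewrite le_eqVlt => /predU1P[->|x2]; first by rewrite -(sg_norm k.+1) lm2 ger0_norm.
  by have [_ _ _ h _] := FPk k; apply/ltW/h; rewrite x1.
have Dout k x : lm k.+1 < x < lp k.+1 -> 2 < `|D x| by have [_ _ _ _ h] := FPk k; exact: h.
have cover x : [\/ x < l0, exists k, lp k <= x <= lm k.+1 | exists k, lm k.+1 < x < lp k.+1].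
  have [xl0|l0x] := ltP x l0; first exact: Or31.
  have [[|k] kx kmin] := ex_minnP (unbounded x).
    by move: kx => /=; rewrite ltNge l0x.
  have kx' : lp k <= x by rewrite leNgt; apply/negP => /kmin; rewrite ltnn.
  have [xm|mx] := leP x (lm k.+1); first by apply: Or32; exists k; rewrite kx'.
  by apply: Or33; exists k; rewrite mx.
exists lp, lm; split=> // x.
- split=> [x2|[k]]; last exact: Din.
  have [/Dlow|//|[k /Dout]] := cover x; by rewrite ltNge x2.
- split=> [nx|[/Dlow|[k /Dout]]]; [|by rewrite ltNge => /negP..].
  by have [|[k /Din]|] := cover x; [left| |right].
Qed.
End structure.
End bands.

(** * From integrability on [0,1] to local integrability on the line *)

Section restriction.
Variable R : realType.
Local Notation mu := (@lebesgue_measure R).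

Implicit Types f : R -> R.

Definition cut01 (f : R -> R) (t : R) := f t * \1_(`[0, 1]%classic : set R) t.

Lemma cut01_in f t : 0 <= t <= 1 -> cut01 f t = f t.
Proof. by move=> t01; rewrite /cut01 indicE mem_set ?mulr1//= in_itv. Qed.

Lemma lint_cut01 (f : R -> R) : mu.-integrable `[0, 1] (EFin \o f) -> lint (cut01 f).
Proof.
move=> If; apply: lint_line; rewrite (_ : EFin \o _ = (EFin \o f) \_ `[0, 1]%classic).
  exact: (proj1 (@integrable_mkcond _ _ _ mu _ (EFin \o f) (measurable_itv `[0, 1])) If).
apply/funext => t; rewrite patchE /cut01 /= indicE.
by case: ifPn => _; rewrite ?mulr1 ?mulr0.
Qed.

(** On a bounded interval f is dominated by a finite sum of translates of its restriction to
    [0,1]. *)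
Lemma lint_periodic (f : R -> R) : measurable_fun setT f -> (forall t, f (t + 1) = f t) ->
  (forall t, 0 <= f t) -> mu.-integrable `[0, 1] (EFin \o f) -> lint f.
Proof.
move=> mf pf f0 If a b; have lg := lint_cut01 If.
have pn (n : nat) t : f (t - n%:R) = f t.
  elim: n => [|n IH]; first by rewrite subr0.
  by rewrite -IH -(pf (t - n.+1%:R)); congr f; rewrite -natr1; ring.
have pp (n : nat) t : f (t + n%:R) = f t by rewrite -(pn n) addrK.
pose n := (Num.truncn (`|a| + `|b|)).+1.
have nab : `|a| + `|b| <= n%:R by rewrite ltW// truncnS_gt.
pose G t := \sum_(k < (2 * n).+1) cut01 f (t + (n%:R - k%:R)).
have lG : lint G by apply: lint_sum => k; have [] := itg_shift (n%:R - k%:R) 0 0 lg.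
apply: (le_integrable _ _ _ (lG a b)) => //; first by apply/measurable_EFinP; exact: measurable_funTS.
move=> t /=; rewrite in_itv /= => /andP[at' tb].
have g0 s : 0 <= cut01 f s by rewrite mulr_ge0.
have G0 : 0 <= G t by apply: sumr_ge0.
rewrite lee_fin !ger0_norm//.
have nt : 0 <= t + n%:R.
  by have := ler_norm (- a); rewrite normrN; have := normr_ge0 b; move: nab at'; clearbody n; lra.
have tn : t <= n%:R.
  by have := ler_norm b; have := normr_ge0 a; move: nab tb; clearbody n; lra.
have /andP[j1 j2] := truncn_itv nt; set j := Num.truncn _ in j1 j2.
have jn : (j < (2 * n).+1)%N.
  rewrite ltnS -(ler_nat R) (le_trans j1)// natrM; clearbody n; lra.
(* The index j is the integer part of t + n, so the j-th translate brings t into [0,1] and its term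
   is f(t). *)
rewrite /G (bigD1 (Ordinal jn))//= cut01_in.
  by rewrite addrA pn pp lerDl sumr_ge0.
by rewrite -natr1 in j2; clearbody n j; apply/andP; split; lra.
Qed.
End restriction.

(** * The spectrum via the discriminant, and the problems on [0,1] *)

Section quasiperiodic.
Variables (R : realType) (Q : R -> R).
Local Notation C := R[i].
Local Notation mu := (@lebesgue_measure R).
Implicit Types (x y l : R) (z w : C) (u v g h : R -> C).
Hypotheses (mQ : measurable_fun setT Q) (lQ2 : lint (fun x => Q x ^+ 2)).
Hypothesis perQ : forall x, Q (x + 1) = Q x.
Let lQ : lint Q. Proof. exact: lint_sqrt. Qed.
Local Notation Delta := (Delta mQ lQ2).
Local Notation disc := (disc mQ lQ2).
Local Notation hsol := (hsol Q).

(** The multiplier is e^(i k) with cos k = disc/2 and sin k = sqrt(1 - disc^2/4). *)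
Lemma unimodular_root l : `|disc l| <= 2 -> exists rho : C,
  rho ^+ 2 - Delta l%:C * rho + 1 = 0 /\ csq rho = 1.
Proof.
move=> D2; set D := disc l; have s0 : 0 <= 1 - D ^+ 2 / 4.
  rewrite subr_ge0 ler_pdivrMr// mul1r -real_normK ?num_real//.
  by have := normr_ge0 D; rewrite -/D in D2; nra.
pose s := Num.sqrt (1 - D ^+ 2 / 4); have s2 : s ^+ 2 = 1 - D ^+ 2 / 4 by rewrite sqr_sqrtr.
have ss : s * s = 1 - D ^+ 2 / 4 by rewrite -expr2.
exists ((D / 2) +i* s); split; last first.
  by rewrite /csq /reC /imC /= s2; field.
rewrite Delta_disc -/D; apply: reim_inj; rewrite !expr2 !reimE /reC /imC /=.
  by rewrite ss; field.
by field.
Qed.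

(** Some multiplier has modulus at most one. If it is smaller than one, z is in the resolvent set;
    if it is one, z is real and [Delta] is twice the real part of rho. *)
Lemma spectrumP z : S_spectrum Q z <-> imC z = 0 /\ `|disc (reC z)| <= 2.
Proof.
split=> [Sz|[z0 D2]]; last first.
  have zE : z = (reC z)%:C by apply: reim_inj; rewrite !reimE.
  have [rho [rE r1]] := unimodular_root D2; rewrite -zE in rE.
  exact: unimodular_spectrum mQ lQ2 perQ _ _ rE r1.
have [rho [rE]] : exists rho : C, rho ^+ 2 - Delta z * rho + 1 = 0 /\ csq rho <= 1 by exact: multiplier.
rewrite le_eqVlt => /predU1P[r1|r1]; last by case: Sz; exact: (resolvent perQ rE r1).
have z0 := unimodular_real perQ rE r1; split=> //.
have zE : z = (reC z)%:C by apply: reim_inj; rewrite !reimE.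
have r0 : rho != 0 by rewrite -csq_gt0 r1.
(* For |rho| = 1 the other root 1/rho is the conjugate of rho. *)
have DE : Delta z = rho + conjc rho.
  have : (Delta z - (rho + conjc rho)) * rho = 0.
    transitivity (- (rho ^+ 2 - Delta z * rho + 1) + (1 - rho * conjc rho)); first by ring.
    by rewrite rE mulr_conj r1 oppr0 add0r subrr.
  by move/eqP; rewrite mulf_eq0 (negbTE r0) orbF subr_eq0 => /eqP.
have := congr1 (@reC R) DE; rewrite zE Delta_disc !reimE => ->.
move: r1; rewrite /csq => r1; have := sqr_ge0 (imC rho); rewrite ler_norml.
by move=> i0; apply/andP; split; nra.
Qed.

Lemma cL2_lint01 (h : R -> C) : cL2 `[0, 1] h ->
  lint (cut01 (fun t => reC (h t))) /\ lint (cut01 (fun t => imC (h t))).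
Proof.
move=> [[mr mi] ih].
have i1 : mu.-integrable `[0, 1] (EFin \o (fun t => 1 + csq (h t))).
  have := lint_cst (1 : R) 0 1 => i1; exact: (integrableD _ i1 ih).
have B (a b : R) : `|a| <= 1 + (a ^+ 2 + b ^+ 2).
  have := sqr_ge0 b; have := sqr_ge0 (a - 1); have := sqr_ge0 (a + 1).
  by rewrite ler_norml => *; apply/andP; split; lra.
split; apply: lint_cut01; apply: (le_integrable _ _ _ i1) => //.
- exact/measurable_EFinP.
- by move=> t _ /=; rewrite lee_fin (le_trans (B _ (imC (h t))) (ler_norm _)).
- exact/measurable_EFinP.
- move=> t _ /=; rewrite lee_fin; have := B (imC (h t)) (reC (h t)).
  by rewrite [X in 1 + X]addrC => /le_trans; apply; exact: ler_norm.
Qed.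

(** Extending the test function to the line, with derivative zero outside [0,1], makes the
    whole-line product rule available for the integration by parts in [hsol_t_form]. *)
Lemma H1_01_extend v h : H1_01 v h -> exists V H,
  [/\ cac V H, forall t, 0 <= t <= 1 -> V t = v t & forall t, 0 <= t <= 1 -> H t = h t].
Proof.
move=> [Lh vh]; have [lr li] := cL2_lint01 Lh.
pose H t : C := cut01 (fun t => reC (h t)) t +i* cut01 (fun t => imC (h t)) t.
have HE t : 0 <= t <= 1 -> H t = h t.
  by move=> t01; apply: reim_inj; rewrite /H /reC /imC /= cut01_in.
have cH : cac (cprim H) H by exact: cac_prim.
exists (fun x => v 0 + cprim H x), H; split=> //.
  by apply: cac_ext (cacD (cac_cst (v 0)) cH) => // x; rewrite add0r.
move=> t /andP[t0 t1]; have := vh 0 t (lexx 0) t0 t1.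
have [_ /(_ 0 t t0)] := cH; rewrite cprim0 subr0 => ->.
have -> : cint `[0, t] H = cint `[0, t] h.
  by apply: reim_inj; apply: eq_itg => s /andP[s0 st]; rewrite HE// s0 (le_trans st).
by move=> <-; rewrite addrC subrK.
Qed.

                                                                                         
(** Integration by parts: the form differs from the inner product by the increment over [0,1] of p1
    times the conjugate of v. Both factors are multiplied by s from 0 to 1, and s^2 = 1, so this
    increment is zero. *)
Lemma hsol_t_form z p p1 (s : R) v h : hsol z p p1 -> s ^+ 2 = 1 ->
  p1 1 = s%:C * p1 0 -> tdom s v h ->
  t_form Q p (fun x => p1 x + (Q x)%:C * p x) v h = cint `[0, 1] (fun x => z * p x * (v x)^* ).
Proof.
move=> [pa p1a] s2 p1s [/H1_01_extend[V [H [cV VE HE]]] vs].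
pose G x := (- (Q x)%:C ^+ 2 * p x - (Q x)%:C * p1 x - z * p x - 0) * conjc (V x) + p1 x * conjc (H x).
have M : cac (fun x => p1 x * conjc (V x)) G := cacM p1a (cac_conj cV).
pose W x := z * (p x * conjc (V x)).
have [cr ci] : continuous (fun x => reC (W x)) /\ continuous (fun x => imC (W x)).
  exact: cac_cont (cacZ z (cacM pa (cac_conj cV))).
have [[lGr _] [lGi _]] := (cacP _ _).1 M.
have bd : p1 1 * conjc (V 1) = p1 0 * conjc (V 0).
  rewrite !VE ?lexx ?ler01// vs p1s; apply: reim_inj; rewrite !reimE.
    by rewrite -[RHS]mul1r -s2; ring.
  by rewrite -[RHS]mul1r -s2; ring.
have E t : 0 <= t <= 1 -> (p1 t + (Q t)%:C * p t) * (h t)^* - (Q t)%:C * p t * (h t)^*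
    - (Q t)%:C * (p1 t + (Q t)%:C * p t) * (v t)^* = G t + W t.
  by move=> t01; rewrite /G /W VE// HE// !conjE; ring.
have E' t : 0 <= t <= 1 -> z * p t * (v t)^* = W t.
  by move=> t01; rewrite /W VE// conjE; ring.
apply: reim_inj.
- transitivity (itg (fun t => reC (G t) + reC (W t)) 0 1).
    by apply: eq_itg => t t01; rewrite E// reCD.
  transitivity (itg (fun t => reC (W t)) 0 1).
    rewrite itgD//; last exact: lint_cont.
    by rewrite -(cac_re M ler01) bd subrr add0r.
  by apply: eq_itg => t t01; rewrite E'.
- transitivity (itg (fun t => imC (G t) + imC (W t)) 0 1).
    by apply: eq_itg => t t01; rewrite E// imCD.
  transitivity (itg (fun t => imC (W t)) 0 1).
    rewrite itgD//; last exact: lint_cont.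
    by rewrite -(cac_im M ler01) bd subrr add0r.
  by apply: eq_itg => t t01; rewrite E'.
Qed.

Lemma hsol_quasi_deriv_cL2 z p p1 : hsol z p p1 -> cL2 `[0, 1] (fun x => p1 x + (Q x)%:C * p x).
Proof.
move=> [pa p1a]; set g := fun x => _.
have [mr mi] : cmeasurable setT g.
  by apply: cmeasD; [exact: cac_meas p1a|apply: cmeasM; [exact: cmeas_real|exact: cac_meas pa]].
split; first by split; exact: measurable_funTS.
suff : lint (fun x => csq (g x)) by exact.
apply: (@lint_le _ _ (fun x => 2 * (csq (p1 x) + csq (p x) * Q x ^+ 2))).
- by apply: measurable_funD; exact: measurable_funX.
- move=> x; rewrite ger0_norm ?csq_ge0// (le_trans (csqD_le _ _))//.
  have -> : csq ((Q x)%:C * p x) = csq (p x) * Q x ^+ 2.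
    by rewrite csqM /csq reC_real imC_real expr0n addr0 mulrC.
  exact: lexx.
- apply: lintZ; apply: lintD; first exact: lint_cont (cac_csq p1a).
  exact: lint_mulc (cac_csq pa) lQ2.
Qed.

(** When disc = 2 s with s^2 = 1, the characteristic equation is (rho - s)^2 = 0, and the Floquet
    solution for rho = s satisfies the boundary conditions for both u and u1. *)
Lemma quasiperiodic_eigenvalue l (s : R) : s ^+ 2 = 1 -> disc l = 2 * s -> Spm_eigenvalue Q s l%:C.
Proof.
move=> s2 Ds; have rE : (s%:C : C) ^+ 2 - Delta l%:C * s%:C + 1 = 0.
  rewrite Delta_disc Ds; apply: reim_inj; rewrite !expr2 !reimE; last by ring.
  by move: s2; rewrite expr2; lra.
have [p [p1 [hp pE p1E pn]]] := floquet perQ rE.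
have [pa p1a] := hp.
exists p, (fun x => p1 x + (Q x)%:C * p x); split; [split; [split|]|split].
- exact: hsol_quasi_deriv_cL2 hp.
- by move=> x y _ xy _; have [_] := pa; apply.
- by rewrite -[X in p X]add0r pE.
- move=> p0; apply: pn; apply: (hsol_itg_eq0 mQ lQ2 hp ltr01).
  have mc : measurable_fun setT (fun t => csq (p t)) by exact: continuous_measurable_fun (cac_csq pa).
  rewrite /itg /Rintegral (@ae_eq_integral _ _ _ mu _ (cst 0%E))//.
  + by rewrite integral0.
  + by apply/measurable_EFinP; exact: measurable_funTS.
  + by apply: ae_sub p0 => x px xI; rewrite px ?csq0// inE.
- move=> v h vh; apply: hsol_t_form hp s2 _ vh.
  by rewrite -[X in p1 X]add0r p1E.
Qed.
End quasiperiodic.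

(** * Assembly of the spectral statement *)

Theorem theorem3p15 (R : realType) (qhat : int -> R[i]) (Q : R -> R) :
  Hm1per qhat -> qhat 0 = 0 -> Q_of qhat Q ->
  (forall z : R[i], ~ S_eigenvalue Q z) /\
  exists (l0 : R) (lm lp : nat -> R),
    [/\ l0 < lm 1%N,
        (forall k : nat, (0 < k)%N -> lm k <= lp k /\ lp k < lm k.+1),
        (forall z : R[i], S_spectrum Q z <->
           imC z = 0 /\
           (l0 <= reC z <= lm 1%N \/
            exists k : nat, (0 < k)%N /\ lp k <= reC z <= lm k.+1)),
        (forall x : R, ~ S_spectrum Q x%:C <->
           x < l0 \/ exists k : nat, (0 < k)%N /\ lm k < x < lp k)
      & [/\ Spm_eigenvalue Q 1 l0%:C,
            (forall k : nat, (0 < k)%N ->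
               Spm_eigenvalue Q 1 (lm (2 * k)%N)%:C /\
               Spm_eigenvalue Q 1 (lp (2 * k)%N)%:C)
          & (forall k : nat, (0 < k)%N ->
               Spm_eigenvalue Q (-1) (lm (2 * k).-1)%:C /\
               Spm_eigenvalue Q (-1) (lp (2 * k).-1)%:C)]].
Proof.
move=> _ _ [perQ [mQ [iQ2 _]]].
have lQ2 : lint (fun x => Q x ^+ 2).
  apply: lint_periodic iQ2 => [|t|t]; [exact: measurable_funX|by rewrite perQ|exact: sqr_ge0].
split; first by move=> z; exact: no_eigenvalue.
pose D := disc mQ lQ2.
have DB : bandlike D (ddisc mQ lQ2).
  split; [exact: disc_continuous|exact: disc_expand|exact: ddisc_neq0|exact: degenerate_gap].
have [lp [lm [mono lp2 lm2 inside outside]]] := band_structure DB (disc_low mQ lQ2) (disc_oscillates mQ lQ2).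
have eig (k : nat) l : (-1) ^+ k * D l = 2 -> Spm_eigenvalue Q ((-1) ^+ k) l%:C.
  move=> Dl; have s2 : ((-1) ^+ k) ^+ 2 = 1 :> R by rewrite -exprM mulnC exprM sqrrN !expr1n.
  have DE : D l = 2 * (-1) ^+ k by rewrite -Dl mulrAC -expr2 s2 mul1r.
  exact (@quasiperiodic_eigenvalue R Q mQ lQ2 perQ l ((-1) ^+ k) s2 DE).
have sgn_even k : (-1) ^+ (2 * k) = 1 :> R by rewrite exprM sqrrN !expr1n.
have sgn_odd k : (0 < k)%N -> (-1) ^+ (2 * k).-1 = -1 :> R.
  by case: k => // k _; rewrite mulnS /= exprS sgn_even mulr1.
exists (lp 0%N), lm, lp; split.
- by case: (mono 0%N).
- by case=> // k _; split; [case: (mono k)|case: (mono k.+1)].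
- move=> z; rewrite (spectrumP mQ lQ2 perQ); split=> -[z0 H]; split=> //.
    by have [[|k] kz] := (inside _).1 H; [left|right; exists k.+1].
  by apply/inside; case: H => [H|[k [_ H]]]; [exists 0%N|exists k].
- move=> x; rewrite (spectrumP mQ lQ2 perQ).
  have -> : ~ (imC x%:C = 0 /\ `|disc mQ lQ2 (reC x%:C)| <= 2) <-> ~ `|D x| <= 2.
    by split=> [N H|N [_ H]]; apply: N.
  split=> [/outside[?|[k H]]|]; [by left|by right; exists k.+1|].
  by move=> H; apply/outside; case: H => [?|[k [k0 H]]]; [left|right; exists k.-1; rewrite prednK].
- split.
  + by rewrite -[1](expr0 (-1)); apply: eig; exact: lp2.
  (* The sign at index 2(k + 1) is 1; [mulnS] exposes that index as a successor, the form in which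
     [lm2] covers the left ends of gaps. *)
  + case=> // k _; rewrite -(sgn_even k.+1); split; apply: eig; last exact: lp2.
    by rewrite mulnS; exact: lm2.
  + case=> // k _; rewrite -(sgn_odd k.+1)//; split; apply: eig; last exact: lp2.
    by rewrite mulnS; exact: lm2.
Qed.
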